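(* Consider the stochastic control problems $(\mathcal{C}_\theta)$, $\theta>0$, and their value functions $V(\cdot,\cdot;\theta)$ described in the context, and assume the following. (i) The random variable $X_0$ is a constant. (ii) The set $U$ is compact and its interior $\mathrm{int}(U)$ is nonempty. (iii) The functions $b$, $\sigma$, $f$, and $g$ are of $C^2$-class in $x$. (iv) There exist a constant $C_0>0$ and a modulus of continuity $\rho:[0,\infty)\to[0,\infty)$ such that for $\varphi(t,x,u)=b(t,x,u)$, $\sigma(t,x,u)$, $f(t,x)$, $g(x)$, we have \begin{align*} |\varphi(t,x,u)-\varphi(t,x',u')| &\le C_0|x-x'|+\rho(|u-u'|),\\ |\varphi(t,0,u)| &\le C_0,\\ |D_x\varphi(t,x,u)-D_x\varphi(t,x',u')| &\le C_0|x-x'|+\rho(|u-u'|),\\ |D_x^2\varphi(t,x,u)-D_x^2\varphi(t,x',u')| &\le \rho(|x-x'|+|u-u'|), \end{align*} for $t\in[0,T]$, $x,x'\in\mathbb{R}^d$, and $u,u'\in U$. (v) The functions $b$ and $\sigma$ are of $C^1$-class in $u$. Further, with the same $C_0$ and $\rho$ as in (iv), for $\varphi(t,x,u)=b(t,x,u)$, $\sigma(t,x,u)$, $f(t,x)$, $g(x)$, we have \begin{align*} |\varphi(t,x,u)|+|D_u\varphi(t,x,u)| &\le C_0,\\ |D_u\varphi(t,x,u)-D_u\varphi(t,x',u')| &\le \rho(|x-x'|+|u-u'|), \end{align*} for $t\in[0,T]$, $x,x'\in\mathbb{R}^d$, and $u,u'\in U$. Let $\{u^*(t)\}_{0\le t\le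 T}\in\mathcal{U}$ solve $(\mathcal{C}_{\theta^*})$ for some $\theta^*>0$, and let $\{X^*(t)\}_{0\le t\le T}$ be the corresponding state trajectory. Suppose that $\mathbb{P}(u^*(t_0)\in\mathrm{int}(U)\setminus\{0\})>0$ for some $t_0\in[0,T]$. Then $\theta^*$ is the unique positive root of the equation $$\Phi(\theta):=\mathbb{E}\left[g(X^*(T))+\int_0^T\left(f(t,X^*(t))+\theta|u^*(t)|^2\right)dt-V(0,X_0;\theta)\right]=0.$$
   Context: Let $T>0$ and $d,k,m\in\mathbb{N}$. Let $\{W(t)\}_{0\le t\le T}$ be an $m$-dimensional standard Brownian motion on a complete probability space $(\Omega,\mathcal{F},\mathbb{P})$, and let $X_0$ be a random variable ($\mathbb{R}^d$-valued) independent of $\{W(t)\}_{0\le t\le T}$. Let $\{\mathcal{F}(t)\}_{0\le t\le T}$ be the augmented filtration generated by $\{W(t)\}_{0\le t\le T}$ and $X_0$. Let $U$ be a closed subset of $\mathbb{R}^k$. The class $\mathcal{U}$ of controls is the set of all $U$-valued $\{\mathcal{F}(t)\}$-adapted processes $\{u(t)\}_{0\le t\le T}$ satisfying $\mathbb{E}\int_0^T|u(t)|^2dt<\infty$. For $u\in\mathcal{U}$, the state process (state trajectory) $\{X(t)\}_{0\le t\le T}$ corresponding to $u$ is the $d$-dimensional solution of $$dX(t)=b(t,X(t),u(t))dt+\sigma(t,X(t),u(t))dW(t),\qquad X(0)=X_0,$$ where $b:[0,T]\times\mathbb{R}^d\times U\to\mathbb{R}^d$ and $\sigma:[0,T]\times\mathbb{R}^d\times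 U\to\mathbb{R}^{d\times m}$ are measurable and such that for every $u\in\mathcal{U}$ there exists a unique continuous $\{\mathcal{F}(t)\}$-adapted solution. The cost functions $g:\mathbb{R}^d\to\mathbb{R}$ and $f:[0,T]\times\mathbb{R}^d\to\mathbb{R}$ are measurable and such that $\mathbb{E}[g(X(T))+\int_0^Tf(t,X(t))dt]>-\infty$ for every $u\in\mathcal{U}$. For $\theta>0$, problem $(\mathcal{C}_\theta)$ is to minimize $$J[u]:=\mathbb{E}\left[g(X(T))+\int_0^T\{f(t,X(t))+\theta|u(t)|^2\}dt\right]$$ over $u\in\mathcal{U}$; a control $u^*\in\mathcal{U}$ is optimal for (solves) $(\mathcal{C}_\theta)$ if it attains this minimum. The value function of $(\mathcal{C}_\theta)$ is $$V(t,x;\theta)=\inf_{u\in\mathcal{U}_t}\mathbb{E}\left[\left.g(X(T))+\int_t^T\left(f(s,X(s))+\theta|u(s)|^2\right)ds\,\right|X(t)=x\right],\quad (t,x)\in[0,T]\times\mathbb{R}^d,$$ where $\mathcal{U}_t$ is the set of all $U$-valued $\{\mathcal{F}(s)\}$-adapted processes $\{u(s)\}_{t\le s\le T}$ satisfying $\mathbb{E}\int_t^T|u(s)|^2ds<\infty$, and $X$ is the controlled state process on $[t,T]$ started from $X(t)=x$. $D_\xi\varphi$ and $D_\xi^2\varphi$ denote the gradient and Hessian of $\varphi$ with respect to the variable $\xi$ (taken componentwise for vector- or matrix-valued $\varphi$).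
   Formalization: ''P(u*(t0) in int(U)\{0})>0 for some t0'' is required of every process equal to u* dt×dP-a.e. (t0 may depend on it): for a single process and time the claim fails, e.g. b=sigma=f=g=0, U=[-1,1], u*(t)=1/2 at t=0 and 0 otherwise. *)

(* Defs.v *)
From HB Require Import structures.
From mathcomp Require Import all_boot all_order all_algebra.
From mathcomp Require Import all_classical all_reals all_analysis.

Set Implicit Arguments.
Unset Strict Implicit.
Unset Printing Implicit Defensive.

Import Order.TTheory GRing.Theory Num.Theory.
Import numFieldNormedType.Exports.

Local Open Scope classical_set_scope.
Local Open Scope ring_scope.

(* Functions on [0, T] x R^d x U are total functions on R x R^d x R^k that are
   only constrained on [0, T] x R^d x U. *)

(* The norm the library puts on matrices is the sup norm, hence [enorm]. *)
Definition enorm {R : realType} {p q : nat} (A : 'M[R]_(p, q)) : R :=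
  Num.sqrt (\sum_i \sum_j A i j ^+ 2).

Definition famnorm {R : realType} {p q : nat} {I : finType}
    (A : I -> 'M[R]_(p, q)) : R :=
  Num.sqrt (\sum_i enorm (A i) ^+ 2).

Notation borelType V := (g_sigma_algebraType (@open V%type)).

Section differentiation.
Context {R : realType} {n p q : nat}.
Implicit Types h : 'cV[R]_n -> 'M[R]_(p, q).

Definition basis_vec (i : 'I_n) : 'cV[R]_n := delta_mx i 0.

Definition grad h (x : 'cV[R]_n) (i : 'I_n) : 'M[R]_(p, q) :=
  'D_(basis_vec i) h x.

Definition hess h (x : 'cV[R]_n) (ij : 'I_n * 'I_n) : 'M[R]_(p, q) :=
  grad (grad h ^~ ij.1) x ij.2.

Definition classC1 h : Prop :=
  forall i, (forall x, derivable h x (basis_vec i)) /\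
            continuous (grad h ^~ i).

Definition classC2 h : Prop :=
  classC1 h /\ forall i, classC1 (grad h ^~ i).

(* C^1 on the closed set U: Du is the gradient of h in the interior of U, and it
   is a continuous function on all of U.  This is implied by the existence of a
   C^1 extension of h to a neighbourhood of U. *)
Definition classC1_on (U : set 'cV[R]_n) h
    (Du : 'cV[R]_n -> 'I_n -> 'M[R]_(p, q)) : Prop :=
  forall i, [/\ forall u, (U°) u -> derivable h u (basis_vec i),
                forall u, (U°) u -> grad h u i = Du u i &
                {within U, continuous (Du ^~ i)}].

End differentiation.

Definition modulus_of_continuity {R : realType} (rho : R -> R) : Prop :=
  [/\ forall r, 0 <= r -> 0 <= rho r, rho 0 = 0 &
      rho r @[r --> 0^'+] --> (0 : R)].

Section coefficient_conditions.
Context {R : realType} {d k p q : nat}.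
Variables (T : R) (U : set 'cV[R]_k) (C0 : R) (rho : R -> R).
Variable phi : R -> 'cV[R]_d -> 'cV[R]_k -> 'M[R]_(p, q).

Definition x_regular : Prop :=
  forall t x x' u u', 0 <= t <= T -> U u -> U u' ->
  let phix s y v := grad (fun z => phi s z v) y in
  let phixx s y v := hess (fun z => phi s z v) y in
  [/\ enorm (phi t x u - phi t x' u')
        <= C0 * enorm (x - x') + rho (enorm (u - u')),
      enorm (phi t 0 u) <= C0,
      famnorm (fun i => phix t x u i - phix t x' u' i)
        <= C0 * enorm (x - x') + rho (enorm (u - u')) &
      famnorm (fun ij => phixx t x u ij - phixx t x' u' ij)
        <= rho (enorm (x - x') + enorm (u - u'))].

Definition u_regular : Prop :=
  exists phiu : R -> 'cV[R]_d -> 'cV[R]_k -> 'I_k -> 'M[R]_(p, q),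
    (forall t x, 0 <= t <= T -> classC1_on U (phi t x) (phiu t x)) /\
    forall t x x' u u', 0 <= t <= T -> U u -> U u' ->
      enorm (phi t x u) + famnorm (phiu t x u) <= C0 /\
      famnorm (fun i => phiu t x u i - phiu t x' u' i)
        <= rho (enorm (x - x') + enorm (u - u')).

End coefficient_conditions.

Section stochastic_basis.
Context {R : realType} {dO : measure_display} {Omega : measurableType dO}.
Context (P : probability Omega R) {d m : nat}.
Variables (T : R) (W : R -> Omega -> 'cV[R]_m) (X0 : Omega -> 'cV[R]_d).

Definition noise_events (t : R) : set (set Omega) :=
  [set A | exists s B, [/\ 0 <= s <= t, <<s @open 'cV[R]_m >> B &
                           A = W s @^-1` B]].

Definition initial_events : set (set Omega) :=
  [set A | exists2 B, <<s @open 'cV[R]_d >> B & A = X0 @^-1` B].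

(* The sigma-algebra F(t) of the augmented filtration is the one carried by
   [filtrationType t]. *)
Definition filtration_generators (t : R) : set (set Omega) :=
  noise_events t `|` initial_events `|` [set A | P.-negligible A].

Local Notation filtrationType t :=
  (g_sigma_algebraType (filtration_generators t)).

Definition brownian_motion : Prop :=
  [/\ forall t, 0 <= t <= T ->
        measurable_fun [set: Omega] (W t : Omega -> borelType 'cV[R]_m),
      {ae P, forall w, W 0 w = 0},
      {ae P, forall w, {within `[0, T], continuous (W ^~ w)}} &
      forall (s t : R) (G : set Omega) (B : 'I_m -> set (measurableTypeR R)),
        0 <= s -> s < t -> t <= T ->
        <<s noise_events s >> G -> (forall i, measurable (B i)) ->
        P (G `&` [set w | forall i, B i (W t w i 0 - W s w i 0)]) =
        (P G * \big[*%E/1%E]_(i < m) normal_prob 0 (Num.sqrt (t - s)) (B i))%E].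

Definition initial_independent : Prop :=
  forall G A, <<s noise_events T >> G -> initial_events A ->
    P (G `&` A) = (P G * P A)%E.

Definition adapted {V : ptopologicalType} (s t : R) (Y : R -> Omega -> V) :=
  forall r, s <= r <= t ->
    measurable_fun [set: filtrationType r]
      (Y r : filtrationType r -> borelType V).

Definition jointly_measurable {V : ptopologicalType} (s t : R)
    (Y : R -> Omega -> V) :=
  measurable_fun (`[s, t] `*` [set: Omega])
    (fun z : measurableTypeR R * Omega => Y z.1 z.2 : borelType V).

Record simple_process := SimpleProcess {
  sp_size : nat;
  sp_time : nat -> R;
  sp_coef : nat -> Omega -> 'M[R]_(d, m) }.

Definition is_simple (s t : R) (Z : simple_process) : Prop :=
  [/\ sp_time Z 0%N = s, sp_time Z (sp_size Z) = t,
      forall j, (j < sp_size Z)%N -> sp_time Z j <= sp_time Z j.+1,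
      forall j, (j < sp_size Z)%N ->
        measurable_fun [set: filtrationType (sp_time Z j)]
          (sp_coef Z j : filtrationType (sp_time Z j) ->
                         borelType 'M[R]_(d, m)) &
      exists C, forall j w, (j < sp_size Z)%N -> enorm (sp_coef Z j w) <= C].

Definition sp_value (Z : simple_process) (r : R) (w : Omega) : 'M[R]_(d, m) :=
  \sum_(j < sp_size Z) (\1_`]sp_time Z j, sp_time Z j.+1] r : R)
    *: sp_coef Z j w.

Definition sp_integral (Z : simple_process) (w : Omega) : 'cV[R]_d :=
  \sum_(j < sp_size Z)
    sp_coef Z j w *m (W (sp_time Z j.+1) w - W (sp_time Z j) w).

(* I is (a version of) the Ito integral of H against W over [s, t], for H in
   L^2(dt x dP): the L^2-limit of integrals of simple adapted processes. *)
Definition ito_integral (s t : R) (H : R -> Omega -> 'M[R]_(d, m))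
    (I : Omega -> 'cV[R]_d) : Prop :=
  [/\ adapted s t H, jointly_measurable s t H,
      measurable_fun [set: Omega] (I : Omega -> borelType 'cV[R]_d) &
      exists Z : nat -> simple_process,
      [/\ forall n, is_simple s t (Z n),
          (\int[P]_w \int[lebesgue_measure]_(r in `[s, t])
             ((enorm (sp_value (Z n) r w - H r w)) ^+ 2)%:E)%E
            @[n --> \oo] --> 0%E &
          (\int[P]_w ((enorm (sp_integral (Z n) w - I w)) ^+ 2)%:E)%E
            @[n --> \oo] --> 0%E]].

End stochastic_basis.

Section control.
Context {R : realType} {dO : measure_display} {Omega : measurableType dO}.
Context (P : probability Omega R) {d k m : nat}.
Variables (T : R) (W : R -> Omega -> 'cV[R]_m) (X0 : Omega -> 'cV[R]_d).
Variable U : set 'cV[R]_k.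
Variable b : R -> 'cV[R]_d -> 'cV[R]_k -> 'cV[R]_d.
Variable sigma : R -> 'cV[R]_d -> 'cV[R]_k -> 'M[R]_(d, m).
Variable f : R -> 'cV[R]_d -> R.
Variable g : 'cV[R]_d -> R.

Definition domain_txu : set (borelType (R * 'cV[R]_d * 'cV[R]_k)%type) :=
  [set z | 0 <= z.1.1 <= T /\ U z.2].

Definition domain_tx : set (borelType (R * 'cV[R]_d)%type) :=
  [set z | 0 <= z.1 <= T].

Definition measurable_coefficients : Prop :=
  [/\ measurable_fun domain_txu
        (fun z => b z.1.1 z.1.2 z.2 : borelType 'cV[R]_d),
      measurable_fun domain_txu
        (fun z => sigma z.1.1 z.1.2 z.2 : borelType 'M[R]_(d, m)),
      measurable_fun domain_tx (fun z => f z.1 z.2 : borelType R) &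
      measurable_fun [set: borelType 'cV[R]_d]
        (g : borelType 'cV[R]_d -> borelType R)].

(* The class U_t of controls on [t, T]; the class U is [admissible 0]. *)
Definition admissible (t : R) (u : R -> Omega -> 'cV[R]_k) : Prop :=
  [/\ forall s w, t <= s <= T -> U (u s w),
      adapted P W X0 t T u,
      jointly_measurable t T u &
      (\int[P]_w \int[lebesgue_measure]_(s in `[t, T])
         ((enorm (u s w)) ^+ 2)%:E < +oo)%E].

Definition drift_integral (t s : R) (u : R -> Omega -> 'cV[R]_k)
    (X : R -> Omega -> 'cV[R]_d) (w : Omega) : 'cV[R]_d :=
  \col_i \int[lebesgue_measure]_(r in `[t, s]) (b r (X r w) (u r w) i 0).

(* X solves dX = b dt + sigma dW on [t, T] with X(t) = xi. *)
Definition state_process (t : R) (xi : Omega -> 'cV[R]_d)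
    (u : R -> Omega -> 'cV[R]_k) (X : R -> Omega -> 'cV[R]_d) : Prop :=
  [/\ adapted P W X0 t T X,
      forall w, {within `[t, T], continuous (X ^~ w)},
      {ae P, forall w, forall i, lebesgue_measure.-integrable `[t, T]
         (fun r => (b r (X r w) (u r w) i 0)%:E)} &
      forall s, t <= s <= T ->
        exists2 I, ito_integral P W X0 t s
                     (fun r w => sigma r (X r w) (u r w)) I &
                   {ae P, forall w,
                      X s w = xi w + drift_integral t s u X w + I w}].

Definition well_posed : Prop :=
  forall u, admissible 0 u ->
    (exists X, state_process 0 X0 u X) /\
    forall X Y, state_process 0 X0 u X -> state_process 0 X0 u Y ->
      {ae P, forall w, forall t, 0 <= t <= T -> X t w = Y t w}.

Definition pathwise_cost (t theta : R) (u : R -> Omega -> 'cV[R]_k)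
    (X : R -> Omega -> 'cV[R]_d) (w : Omega) : \bar R :=
  ((g (X T w))%:E + \int[lebesgue_measure]_(s in `[t, T])
     (f s (X s w) + theta * enorm (u s w) ^+ 2)%:E)%E.

Definition cost (t theta : R) (u : R -> Omega -> 'cV[R]_k)
    (X : R -> Omega -> 'cV[R]_d) : \bar R :=
  (\int[P]_w pathwise_cost t theta u X w)%E.

Definition cost_bounded_below : Prop :=
  forall u X, admissible 0 u -> state_process 0 X0 u X ->
    (-oo < \int[P]_w ((g (X T w))%:E +
              \int[lebesgue_measure]_(s in `[0%R, T]) (f s (X s w))%:E))%E.

Definition optimal (theta : R) (u : R -> Omega -> 'cV[R]_k) : Prop :=
  admissible 0 u /\
  forall X v Y, state_process 0 X0 u X ->
    admissible 0 v -> state_process 0 X0 v Y ->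
    (cost 0 theta u X <= cost 0 theta v Y)%E.

Definition value_function (t : R) (x : 'cV[R]_d) (theta : R) : \bar R :=
  ereal_inf [set c | exists u X, [/\ admissible t u,
    state_process t (cst x) u X & c = cost t theta u X]].

Definition Phi (u : R -> Omega -> 'cV[R]_k) (X : R -> Omega -> 'cV[R]_d)
    (theta : R) : \bar R :=
  (\int[P]_w (pathwise_cost 0 theta u X w - value_function 0 (X0 w) theta))%E.

(* Controls are dt x dP-equivalence classes of processes. *)
Definition same_control (u v : R -> Omega -> 'cV[R]_k) : Prop :=
  {ae (@lebesgue_measure R \x P)%E,
    forall z, 0 <= z.1 <= T -> u z.1 z.2 = v z.1 z.2}.

(* P(u(t0) in int(U) \ {0}) > 0 for some t0 in [0, T], whichever
   representative of the control is chosen.  For one fixed representative the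
   condition would be void: changing u at a single time t0 changes neither the
   state nor the cost, while (take b, sigma, f, g = 0 and U = [-1, 1]) u = 0
   is optimal for all theta at once. *)
Definition somewhere_interior_nonzero (u : R -> Omega -> 'cV[R]_k) : Prop :=
  forall v, admissible 0 v -> same_control u v ->
    exists2 t0, 0 <= t0 <= T &
      (0 < P [set w | (U° (v t0 w) /\ v t0 w != 0)%R])%E.

End control.

(* Main.v *)
Require Import Defs.
From HB Require Import structures.
From mathcomp Require Import all_boot all_order all_algebra.
From mathcomp Require Import all_classical all_reals all_analysis.
From mathcomp Require Import measurable_realfun ring lra.

(** [Phi] vanishes at theta exactly when the given control, call it u, is
    optimal for theta as well ([Phi_eq0]), so the claim is that u cannot be
    optimal for two parameters theta1 < theta2. The reason is that theta
    multiplies the energy E int |u|^2, and a control that is optimal for two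
    parameters is stationary for the energy and for the rest of the cost
    separately.

    Perturb u to u (1 + eps chi) and u (1 - eps chi), where chi is the distance
    of u to the complement of U, truncated at 1 ([depth]). These controls are
    admissible for small eps. Using optimality at theta1 against the first and
    at theta2 against the second, the energies contribute
    - 2 (theta2 - theta1) eps q + O(eps^2) with q = E int chi |u|^2
    ([energy_shift]), and the remaining costs contribute a second difference in
    eps. If that is o(eps), then q <= 0, that is, u almost never takes a nonzero
    interior value ([two_minima_rest]). A version of u then never does, since
    such values can be replaced by a point of U that is 0 or on the boundary
    ([resting_point]); the hypothesis on u excludes this
    ([minimal_theta_unique]).

    The second difference of the state costs is o(eps) because the coefficients
    are twice differentiable in the state and once in the control, with moduli
    of continuity ([coef_second]). Let D be the difference of the perturbed and
    the original state, and S the sum of the two differences for opposite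
    perturbations. Gronwall's inequality gives E D^4 = O(eps^4)
    ([state_difference4]) and, since the first-order terms cancel in S,
    E S^2 = O(eta^2 eps^2) for every eta > 0 as eps tends to 0
    ([state_second_difference]); then the costs, again by [coef_second], change
    by O(eta eps) ([second_error_le], [state_cost_second_difference]).

    These moment bounds rest on bounds for the second and fourth moments of Ito
    integrals by the integrals of the corresponding powers of the integrand
    ([ito_moment2], [ito_moment4]). They are proved for stepwise integrands by
    induction on the number of steps, from the independence of the Brownian
    increments from the past ([filtration_indep]) and the moments of the normal
    law, and pass to L^2 limits; for the fourth moment, integrands and integrals
    are truncated. A constant initial value makes the augmented filtration the
    one of the Brownian motion up to null sets ([filtration_noise]). *)

Set Implicit Arguments.
Unset Strict Implicit.
Unset Printing Implicit Defensive.

Import Order.TTheory GRing.Theory Num.Theory.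
Import numFieldNormedType.Exports.

Local Open Scope classical_set_scope.
Local Open Scope ring_scope.

(** * Upper bounds on integrals *)

Ltac nonneg :=
  repeat match goal with
  | _ => assumption
  | |- is_true (0 <= _ + _) => apply: addr_ge0
  | |- is_true (0 <= _ * _) => apply: mulr_ge0
  | |- is_true (0 <= _ ^+ 2) => exact: sqr_ge0
  | |- is_true (0 <= _ ^+ 4) => by rewrite exprn_even_ge0
  | |- is_true (0 <= _ ^+ _) => apply: exprn_ge0
  | |- is_true (0 <= _%:R) => exact: ler0n
  | |- is_true (0 <= \sum_(_ <- _ | _) _) => apply: sumr_ge0 => ? _
  | |- is_true (0 <= `|_|) => exact: normr_ge0
  | |- is_true (0 <= _^-1) => rewrite invr_ge0
  | |- is_true (0 <= expR _) => exact: expR_ge0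
  | |- is_true (0 <= 1) => exact: ler01
  end.

Lemma measurable_EFin_fun d (T : measurableType d) (R : realType) (D : set T)
    (f : T -> R) :
  measurable_fun D f -> measurable_fun D (EFin \o f).
Proof. by move=> mf; apply/measurable_EFinP. Qed.

(** The integral of a nonnegative function is a supremum over the simple
    functions below it. *)
Lemma le_integral_ge0 d (T : measurableType d) (R : realType)
    (mu : {measure set T -> \bar R}) (D : set T) (f g : T -> \bar R) :
  (forall x, D x -> (0 <= f x <= g x)%E) ->
  (\int[mu]_(x in D) f x <= \int[mu]_(x in D) g x)%E.
Proof.
move=> fg; rewrite !ge0_integralE/=; last 2 first.
- by move=> x Dx; have /andP[/le_trans] := fg _ Dx; apply.
- by move=> x Dx; have /andP[] := fg _ Dx.
apply: ub_ereal_sup => _ [h /= hf <-]; apply: ereal_sup_ubound.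
exists h => //= x; apply: le_trans (hf x) _; rewrite !patchE.
by case: ifPn => // /set_mem Dx; have /andP[] := fg _ Dx.
Qed.

Section integral_bounds.
Context d (T : measurableType d) (R : realType) (mu : {measure set T -> \bar R}).
Variable D : set T.
Hypothesis mD : measurable D.
Implicit Types (f g : T -> R) (a b c k : R).

(** Bounds by real numbers: they chain and combine linearly without side
    conditions on the finiteness of the integral. *)
Definition int_le f c := (\int[mu]_(x in D) (f x)%:E <= c%:E)%E.

Lemma int_le_mono f g c : (forall x, D x -> 0 <= f x <= g x) ->
  int_le g c -> int_le f c.
Proof.
by move=> fg; apply: le_trans; apply: le_integral_ge0 => x /fg; rewrite !lee_fin.
Qed.

Lemma int_le_wk f b c : b <= c -> int_le f b -> int_le f c.
Proof. by move=> bc /le_trans; apply; rewrite lee_fin. Qed.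

Lemma int_leD f g a b : measurable_fun D f -> measurable_fun D g ->
  (forall x, D x -> 0 <= f x) -> (forall x, D x -> 0 <= g x) ->
  int_le f a -> int_le g b -> int_le (fun x => f x + g x) (a + b).
Proof.
move=> mf mg f0 g0 fa gb; rewrite /int_le.
under eq_integral do rewrite EFinD.
rewrite ge0_integralD//=; first by rewrite EFinD leeD.
all: by [move=> x /f0; rewrite lee_fin|move=> x /g0; rewrite lee_fin|exact: measurable_EFin_fun].

Qed.

Lemma int_leZ f k c : measurable_fun D f -> (forall x, D x -> 0 <= f x) ->
  0 <= k -> int_le f c -> int_le (fun x => k * f x) (k * c).
Proof.
move=> mf f0 k0 fc; rewrite /int_le.
under eq_integral do rewrite EFinM.
rewrite ge0_integralZl//=; first by rewrite EFinM lee_wpmul2l.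
all: by [exact: measurable_EFin_fun|move=> x /f0; rewrite lee_fin].
Qed.

Lemma int_le_lin2 (f F1 F2 : T -> R) (p1 p2 c1 c2 : R) :
  measurable_fun D F1 -> measurable_fun D F2 ->
  (forall x, D x -> 0 <= F1 x) -> (forall x, D x -> 0 <= F2 x) ->
  0 <= p1 -> 0 <= p2 ->
  (forall x, D x -> 0 <= f x <= p1 * F1 x + p2 * F2 x) ->
  int_le F1 c1 -> int_le F2 c2 -> int_le f (p1 * c1 + p2 * c2).
Proof.
move=> mF1 mF2 F10 F20 p10 p20 fF F1c F2c; apply: int_le_mono fF _.
apply: int_leD; [exact: measurable_funM|exact: measurable_funM| | |exact: int_leZ|exact: int_leZ].
- by move=> x Dx; rewrite mulr_ge0 ?F10.
- by move=> x Dx; rewrite mulr_ge0 ?F20.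
Qed.

Lemma int_le_sum (I : finType) (f : I -> T -> R) (c : I -> R) :
  (forall i, measurable_fun D (f i)) -> (forall i x, D x -> 0 <= f i x) ->
  (forall i, int_le (f i) (c i)) ->
  int_le (fun x => \sum_i f i x) (\sum_i c i).
Proof.
move=> mf f0 fc; rewrite /int_le.
under eq_integral do rewrite -sumEFin.
rewrite ge0_integral_sum//=.
- by rewrite -sumEFin; apply: lee_sum => i _; exact: fc.
- by move=> i; exact: measurable_EFin_fun.
Qed.

Lemma int_le_cst k v : 0 <= k -> (mu D <= v%:E)%E -> int_le (fun=> k) (k * v).
Proof.
by move=> k0 muD; rewrite /int_le integral_cst// EFinM lee_wpmul2l.
Qed.

Lemma int_le_lim f c k : 0 < k ->
  (forall e, 0 < e -> int_le f (c + k * e)) -> int_le f c.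
Proof.
move=> k0 fe; apply/lee_addgt0Pr => e e0; rewrite -EFinD.
have := fe (e / k); rewrite divr_gt0// => /(_ isT).
by rewrite mulrCA divff ?gt_eqF// mulr1.
Qed.

Lemma int_le_ge0 f c : (forall x, D x -> 0 <= f x) -> int_le f c -> 0 <= c.
Proof.
move=> f0; rewrite -lee_fin; apply: le_trans.
by apply: integral_ge0 => x /f0; rewrite lee_fin.
Qed.

Lemma int_le_integrable f c : measurable_fun D f -> int_le (fun x => `|f x|) c ->
  mu.-integrable D (EFin \o f).
Proof.
move=> mf fc; apply/integrableP; split; first exact: measurable_EFin_fun.
by apply: le_lt_trans (ltry c); exact: fc.
Qed.

Lemma int_le_mono_ae f g c : measurable_fun D f -> measurable_fun D g ->
  (forall x, D x -> 0 <= f x) -> (forall x, D x -> 0 <= g x) ->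
  {ae mu, forall x, D x -> f x <= g x} -> int_le g c -> int_le f c.
Proof.
move=> mf mg f0 g0 fg; apply: le_trans; apply: ae_ge0_le_integral => //.
- exact: measurable_EFin_fun.
- exact: measurable_EFin_fun.
Qed.

Lemma integrable_le f g : measurable_fun D f ->
  (forall x, D x -> `|f x| <= g x) -> mu.-integrable D (EFin \o g) ->
  mu.-integrable D (EFin \o f).
Proof.
move=> mf fg; apply: le_integrable => //; first exact: measurable_EFin_fun.
by move=> x /fg/= h; rewrite lee_fin (le_trans h)// ler_norm.
Qed.

(** The shape of the cross terms in the moments of stochastic sums. *)
Definition mean0 f :=
  mu.-integrable D (EFin \o f) /\ (\int[mu]_(x in D) (f x)%:E = 0)%E.

Lemma mean0_sum (I : finType) (f : I -> T -> R) :
  (forall i, mean0 (f i)) -> mean0 (fun x => \sum_i f i x).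
Proof.
move=> f0; split.
  rewrite (_ : _ \o _ = (fun x => \sum_i (f i x)%:E)%E); last first.
    by apply/funext => x /=; rewrite sumEFin.
  by apply: integrable_sum => // i _; exact: (f0 i).1.
under eq_integral do rewrite -sumEFin.
rewrite integral_sum//; last by move=> i; exact: (f0 i).1.
by rewrite big1// => i _; exact: (f0 i).2.
Qed.

(** How the cross terms, which are centered but of no sign, drop out of moment
    bounds. *)
Lemma int_le_mean0 f g h a : measurable_fun D g -> (forall x, D x -> 0 <= g x) ->
  int_le g a -> mean0 h -> (forall x, D x -> 0 <= f x <= g x + h x) ->
  int_le f a.
Proof.
move=> mg g0 ga [hint h0] fgh; apply: int_le_mono fgh _; rewrite /int_le.
have gint : mu.-integrable D (EFin \o g).
  apply: (@int_le_integrable g a) => //; apply: int_le_mono ga => x Dx.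
  by rewrite normr_ge0 ger0_norm ?lexx ?g0.
under eq_integral do rewrite EFinD.
by rewrite integralD//= h0 adde0.
Qed.

End integral_bounds.

(** * Moments of the centered normal law *)

(** The normal law lives on the copy of R that carries the Lebesgue sigma-
    algebra. *)
Lemma exprn_measurableTypeR (R : realType) n :
  measurable_fun setT (fun x : measurableTypeR R => x ^+ n : R).
Proof. exact: (@exprn_measurable R setT n). Qed.

Section normal_moments.
Context {R : realType}.
Local Notation mu := (@lebesgue_measure R).
Import HBNNSimple.

(** The density defines the law on sets; the formula extends to functions by
    linearity and monotone approximation. *)
Lemma ge0_integral_normal_prob (s : R) (f : measurableTypeR R -> R) :
  measurable_fun setT f -> (forall x, 0 <= f x) ->
  (\int[normal_prob 0 s]_x (f x)%:E =
   \int[mu]_x (f x * normal_pdf 0 s x)%:E)%E.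
Proof.
move=> mf f0.
have mEf : measurable_fun [set: measurableTypeR R] (EFin \o f) by exact: measurable_EFin_fun.
pose h := nnsfun_approx measurableT mEf.
have hcvg x : (h n x)%:E @[n --> \oo] --> (f x)%:E.
  by apply: (cvg_nnsfun_approx measurableT mEf) => // y _; rewrite lee_fin.
have mpdf : measurable_fun setT (normal_pdf 0 s : measurableTypeR R -> R).
  exact: measurable_normal_pdf.
have mh n : measurable_fun setT (h n : measurableTypeR R -> R) by exact: measurable_funP.
have lhs : (\int[normal_prob 0 s]_x (f x)%:E =
    limn (fun n => \int[normal_prob 0 s]_x (h n x)%:E))%E.
  rewrite -monotone_convergence//.
  - by apply: eq_integral => x _; apply/esym/cvg_lim.
  - by move=> n; exact: (measurable_EFin_fun (mh n)).
  - by move=> n x _; rewrite lee_fin.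
  - by move=> x _ n m nm; rewrite lee_fin; exact/lefP/nd_nnsfun_approx.
have rhs : (\int[mu]_x (f x * normal_pdf 0 s x)%:E =
    limn (fun n => \int[mu]_x (h n x * normal_pdf 0 s x)%:E))%E.
  rewrite -monotone_convergence//.
  - apply: eq_integral => x _; apply/esym/cvg_lim => //.
    under eq_fun do rewrite EFinM; rewrite EFinM.
    by apply: cvgeM => //; exact: cvg_cst.
  - move=> n; apply: measurable_EFin_fun.
    by apply: measurable_funM => //.
  - by move=> n x _; rewrite lee_fin mulr_ge0 ?normal_pdf_ge0.
  - move=> x _ n m nm; rewrite lee_fin ler_wpM2r ?normal_pdf_ge0//.
    exact/lefP/nd_nnsfun_approx.
rewrite lhs rhs; congr (limn _); apply/funext => n.
have hE x : ((h n x)%:E = \sum_(k \in range (h n)) (k * \1_(h n @^-1` [set k]) x)%:E)%E.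
  by rewrite fimfunE -fsumEFin.
under eq_integral do rewrite hE.
have mk (k : R) : measurable (h n @^-1` [set k]).
  by rewrite -(setTI (_ @^-1` _)); exact: measurable_funP.
rewrite ge0_integral_fsum//; last 2 first.
  by move=> k; apply: measurable_EFin_fun; exact: measurable_funM.
  by move=> k x _; rewrite nnfun_muleindic_ge0.
under [RHS]eq_integral => x _.
  rewrite EFinM hE ge0_mule_fsuml; last by move=> k; rewrite nnfun_muleindic_ge0.
  over.
rewrite [RHS]ge0_integral_fsum//; last 2 first.
  move=> k; apply: emeasurable_funM; apply: measurable_EFin_fun => //.
  exact: measurable_funM.
  by move=> k x _; rewrite mule_ge0 ?nnfun_muleindic_ge0// lee_fin normal_pdf_ge0.
apply: eq_fsbigr => k /set_mem [x _ hx].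
have k0 : 0 <= k by rewrite -hx.
rewrite integralZl_indic_nnsfun// integral_indic// setIT.
under eq_integral do rewrite EFinM -muleA.
rewrite ge0_integralZl//; last 2 first.
- by apply: emeasurable_funM; apply: measurable_EFin_fun.
- by move=> y _; rewrite -EFinM lee_fin mulr_ge0// normal_pdf_ge0.
congr (_ * _)%E; rewrite /normal_prob [LHS]integral_mkcond.
apply: eq_integral => y _; rewrite patchE indicE.
by case: ifP; rewrite ?mul1e ?mul0e.
Qed.


Let peak_ratio (s : R) : 0 < s ->
  normal_peak s <= 2 * normal_peak (Num.sqrt 2 * s).
Proof.
move=> s0; rewrite /normal_peak.
have p0 : 0 < s ^+ 2 * pi *+ 2 :> R.
  by rewrite pmulrn_lgt0// mulr_gt0 ?exprn_gt0 ?pi_gt0.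
have -> : (Num.sqrt 2 * s) ^+ 2 * pi *+ 2 = (s ^+ 2 * pi *+ 2) * 2.
  by rewrite exprMn sqr_sqrtr//; ring.
rewrite (sqrtrM 2 (ltW p0)) invfM mulrCA ler_peMr ?invr_ge0 ?sqrtr_ge0//.
rewrite -[leLHS](@divff _ (Num.sqrt 2)) ?gt_eqF ?sqrtr_gt0//.
rewrite ler_wpM2r ?invr_ge0 ?sqrtr_ge0//.
rewrite -[leRHS]ger0_norm// -sqrtr_sqr ler_sqrt//; lra.
Qed.

(** With y = x^2 / (4 s^2) the exponent of the density is - 2 y; one factor
    expR (- y) absorbs x^4, because y^2 expR (- y) <= 2, and the other one is
    the exponential of the density of N(0, 2 s^2). *)
Let pow4_exp (s x : R) : 0 < s ->
  x ^+ 4 * normal_pdf 0 s x <= 64 * s ^+ 4 * normal_pdf 0 (Num.sqrt 2 * s) x.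
Proof.
move=> s0; have s20 : 0 < Num.sqrt 2 * s by rewrite mulr_gt0// sqrtr_gt0.
rewrite !normal_pdfE ?gt_eqF// /normal_fun subr0.
set y := x ^+ 2 / (4 * s ^+ 2).
have y0 : 0 <= y by rewrite divr_ge0 ?sqr_ge0// mulr_ge0// sqr_ge0.
have -> : - x ^+ 2 / (s ^+ 2 *+ 2) = - y + - y.
  by rewrite /y; field; rewrite gt_eqF.
have -> : - x ^+ 2 / ((Num.sqrt 2 * s) ^+ 2 *+ 2) = - y.
  by rewrite /y exprMn sqr_sqrtr//; field; rewrite gt_eqF.
have -> : x ^+ 4 = 16 * s ^+ 4 * y ^+ 2 by rewrite /y; field; rewrite gt_eqF.
rewrite expRD.
have yexp : y ^+ 2 * expR (- y) <= 2.
  rewrite expRN ler_pdivrMr ?expR_gt0//.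
  by have := expR_ge1Dxn 1 y0; rewrite (_ : 2`! = 2%N)//; lra.
have e0 := expR_gt0 (- y).
have := peak_ratio s0; set a := normal_peak s; set b := normal_peak _ => ab.
have a0 : 0 <= a by exact: normal_peak_ge0.
have -> : 16 * s ^+ 4 * y ^+ 2 * (a * (expR (- y) * expR (- y))) =
  16 * s ^+ 4 * expR (- y) * ((y ^+ 2 * expR (- y)) * a) by ring.
have -> : 64 * s ^+ 4 * (b * expR (- y)) = 16 * s ^+ 4 * expR (- y) * (4 * b).
  by ring.
apply: ler_wpM2l; first by rewrite !mulr_ge0 ?exprn_ge0// ltW.
apply: (@le_trans _ _ (2 * a)); first by rewrite ler_wpM2r.
by rewrite (_ : 4 * b = 2 * (2 * b)) ?ler_wpM2l//; ring.
Qed.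

(** The density of N(0, s^2) times x^4 is at most a multiple of the density of
    N(0, 2 s^2), whose total mass is one. *)
Lemma normal_moment4 (s : R) : 0 < s ->
  int_le (normal_prob 0 s) setT (fun x => x ^+ 4) (64 * s ^+ 4).
Proof.
move=> s0; rewrite /int_le ge0_integral_normal_prob//; last first.
  by move=> x; rewrite exprn_even_ge0.
apply: (@int_le_mono _ _ _ mu setT _
    (fun x => 64 * s ^+ 4 * normal_pdf 0 (Num.sqrt 2 * s) x)).
  by move=> x _; rewrite pow4_exp// mulr_ge0 ?normal_pdf_ge0 ?exprn_even_ge0.
rewrite -[X in int_le _ _ _ X]mulr1; apply: int_leZ => //.
- exact: measurable_normal_pdf.
- by move=> x _; rewrite normal_pdf_ge0.
- by rewrite mulr_ge0// exprn_ge0// ltW.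
- by rewrite /int_le integral_normal_pdf.
Qed.

(** Reduction to the fourth moment by x^2 <= x^4 / s^2 + s^2. *)
Lemma normal_moment2 (s : R) : 0 < s ->
  int_le (normal_prob 0 s) setT (fun x => x ^+ 2) (65 * s ^+ 2).
Proof.
move=> s0; have s20 : 0 < s ^+ 2 by rewrite exprn_gt0.
apply: (@int_le_mono _ _ _ (normal_prob 0 s) setT _ (fun x => (s ^+ 2)^-1 * x ^+ 4 + s ^+ 2)).
  move=> x _; rewrite sqr_ge0/=.
  rewrite -subr_ge0 (_ : _ - _ = (s ^+ 2)^-1 * ((x ^+ 2 - s ^+ 2 / 2) ^+ 2
    + 3 / 4 * s ^+ 4)); last by field; rewrite gt_eqF.
  rewrite mulr_ge0// ?invr_ge0 ?(ltW s20)//.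
  by rewrite addr_ge0// ?sqr_ge0// mulr_ge0// exprn_ge0// ltW.
rewrite (_ : 65 * _ = (s ^+ 2)^-1 * (64 * s ^+ 4) + s ^+ 2 * 1); last first.
  by field; rewrite gt_eqF.
have m4 : measurable_fun setT (fun x : measurableTypeR R => x ^+ 4 : R).
  exact: exprn_measurableTypeR.
apply: int_leD => //.
- exact: measurable_funM.
- by move=> x _; rewrite mulr_ge0 ?invr_ge0 ?exprn_even_ge0// ltW.
- by move=> x _; exact: ltW.
- apply: int_leZ => //; last exact: normal_moment4.
  + by move=> x _; rewrite exprn_even_ge0.
  + by rewrite invr_ge0 ltW.
- by apply: int_le_cst => //; [exact: ltW|exact: probability_le1].
Qed.

Lemma normal_moment1_integrable (s : R) : 0 < s ->
  (normal_prob 0 s).-integrable setT (fun x => x%:E).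
Proof.
move=> s0; apply: (int_le_integrable (c := 65 * s ^+ 2 + 1 * 1)).
  exact: (@exprn_measurableTypeR R 1).
apply: (@int_le_mono _ _ _ (normal_prob 0 s) setT _ (fun x => x ^+ 2 + 1)).
  move=> x _; rewrite normr_ge0/=.
  have := sqr_ge0 (`|x| - 1); rewrite sqrrB1 real_normK ?num_real// => ?.
  have := normr_ge0 x; lra.
apply: int_leD => //.
- by move=> x _; exact: sqr_ge0.
- exact: normal_moment2.
- by apply: int_le_cst => //; exact: probability_le1.
Qed.

(** The law is invariant under x |-> - x. *)
Lemma normal_mean0 (s : R) : 0 < s -> (\int[normal_prob 0 s]_x x%:E = 0)%E.
Proof.
move=> s0; have xint := normal_moment1_integrable s0.
pose N := normal_prob (0:R) s.
pose opp (x : measurableTypeR R) : measurableTypeR R := - x.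
have mopp : measurable_fun setT opp by exact: oppr_measurable.
have NN A : measurable A -> N A = pushforward N opp A.
  move=> mA; rewrite /pushforward /N /normal_prob.
  have -> : (\int[mu]_(x in opp @^-1` A) (normal_pdf 0 s x)%:E =
    \int[mu]_(x in opp @^-1` A) ((EFin \o normal_pdf 0 s) \o opp) x)%E.
    apply: eq_integral => x _ /=; rewrite !normal_pdfE ?gt_eqF// /normal_fun.
    by rewrite !subr0 sqrrN.
  rewrite -ge0_integral_pushforward//.
  - by apply: eq_measure_integral => B mB BA; exact/esym/lebesgue_measureN.
  - apply: measurable_funTS; apply: measurable_EFin_fun.
    exact: measurable_normal_pdf.
  - by move=> x _ /=; rewrite lee_fin normal_pdf_ge0.
have : (\int[N]_x x%:E = \int[N]_x (- x)%:E)%E.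
  transitivity (\int[pushforward N opp]_x x%:E)%E.
    by apply: eq_measure_integral => A mA _; exact: NN.
  rewrite integral_pushforward//.
  rewrite preimage_setT (_ : _ \o _ = -%E \o (EFin : R -> \bar R)); last first.
    by apply/funext => x /=; rewrite EFinN.
  exact: integrableN.
under [RHS]eq_integral do rewrite EFinN.
rewrite integralN//; last exact: integrable_add_def.
have : (\int[N]_x x%:E)%E \is a fin_num by exact: integrable_fin_num.
rewrite -/N; case: (\int[N]_x x%:E)%E => // r _ [] h; congr EFin; lra.
Qed.

End normal_moments.

(** * Integrals of products of independent variables *)

Section independence.
Context dO (Omega : measurableType dO) (R : realType) (P : probability Omega R).
Local Notation rT := (measurableTypeR R).
Variables (nu : probability rT R) (Z Y : Omega -> rT).
Hypotheses (mZ : measurable_fun setT Z) (mY : measurable_fun setT Y).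
Hypothesis ZY : forall A B : set rT, measurable A -> measurable B ->
  P (Z @^-1` A `&` Y @^-1` B) = (P (Z @^-1` A) * nu B)%E.

Let mZY : measurable_fun setT (fun w => (Z w, Y w)).
Proof. exact: measurable_fun_pair. Qed.

Let Z_mixin := isMeasurableFun.Build _ _ _ _ _ mZ.
Let Z' : {mfun Omega >-> rT} := HB.pack Z Z_mixin.
Let law := distribution P Z'.

Let lawE (X : set (rT * rT)) : measurable X ->
  (law \x nu)%E X = pushforward P (fun w => (Z w, Y w)) X.
Proof.
move: X.
pose ZY_mixin := isMeasurableFun.Build _ _ _ _ _ mZY.
pose ZY' : {mfun Omega >-> (rT * rT)%type} := HB.pack (fun w => (Z w, Y w)) ZY_mixin.
apply: (product_measure_unique (m' := distribution P ZY')) => A B mA mB.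
rewrite /= /distribution /= /pushforward/= -ZY//.
Qed.

Let mabs : measurable_fun setT (fun x : rT => `|x|%:E).
Proof. by apply: measurable_EFin_fun; exact: normr_measurable. Qed.

(** The hypothesis on [Z] and [Y] identifies their joint law with a product
    measure, on which the integrals separate. The absolute value in [F]
    extends the integrand, nonnegative on the range of [Z], to a nonnegative
    function. *)
Lemma indep_integral_ge0 (phi : rT -> R) : measurable_fun setT phi ->
  (forall x, 0 <= phi x) -> (forall w, 0 <= Z w) ->
  (\int[P]_w (Z w * phi (Y w))%:E =
   (\int[P]_w (Z w)%:E) * \int[nu]_x (phi x)%:E)%E.
Proof.
move=> mphi phi0 Z0.
pose F (z : rT * rT) : \bar R := (`|z.1| * phi z.2)%:E.
have mF : measurable_fun setT F.
  apply: measurable_EFin_fun; apply: measurable_funM.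
    by apply: measurableT_comp => //; exact: measurable_fst.
  by apply: measurableT_comp => //; exact: measurable_snd.
have F0 z : (0 <= F z)%E by rewrite lee_fin mulr_ge0.
have -> : (\int[P]_w (Z w * phi (Y w))%:E =
    \int[pushforward P (fun w => (Z w, Y w))]_z F z)%E.
  rewrite ge0_integral_pushforward//.
  by apply: eq_integral => w _; rewrite /F/= ger0_norm.
transitivity (\int[law \x nu]_z F z)%E.
  by apply: eq_measure_integral => A mA _; first [exact: lawE|exact/esym/lawE].
rewrite fubini_tonelli1// /fubini_F.
under eq_integral => z _.
  under eq_integral do rewrite /F/= EFinM.
  rewrite ge0_integralZl//; last 2 first.
  - exact: measurable_EFin_fun.
  - by move=> x _; rewrite lee_fin.
  over.
rewrite ge0_integralZr//; last first.
  by apply: integral_ge0 => x _; rewrite lee_fin.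
congr (_ * _)%E.
rewrite ge0_integral_distribution//.
by apply: eq_integral => w _ /=; rewrite ger0_norm.
Qed.

Hypothesis nu1 : nu.-integrable setT (fun x => x%:E).
Hypothesis nu0 : (\int[nu]_x x%:E = 0)%E.
Hypothesis Zint : P.-integrable setT (EFin \o Z).

(** Under the product law the inner integral is the mean of [nu], which is
    zero. *)
Lemma indep_integral0 :
  P.-integrable setT (fun w => (Z w * Y w)%:E) /\
  (\int[P]_w (Z w * Y w)%:E = 0)%E.
Proof.
pose F (z : rT * rT) : \bar R := (z.1 * z.2)%:E.
have mF : measurable_fun setT F.
  apply: measurable_EFin_fun; apply: measurable_funM.
    exact: measurable_fst.
  exact: measurable_snd.
have lawint : law.-integrable setT (fun x => x%:E).
  by apply: (integrable_pushforward (phi := Z)) => //; exact: EFin_measurable.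
have Fint : (law \x nu)%E.-integrable setT F.
  apply/integrable12ltyP => //.
  under eq_integral => z _.
    under eq_integral do rewrite /F/= normrM EFinM.
    rewrite ge0_integralZl//.
    over.
  rewrite ge0_integralZr//; last first.
    by apply: integral_ge0 => x _; rewrite lee_fin.
  apply: lte_mul_pinfty.
  - by apply: integral_ge0 => x _; rewrite lee_fin.
  - rewrite ge0_fin_numE; last by apply: integral_ge0 => x _; rewrite lee_fin.
    by move/integrableP : lawint => [].
  - by move/integrableP : nu1 => [].
have mpush : (pushforward P (fun w => (Z w, Y w))).-integrable setT F.
  apply/integrableP; split=> //; move/integrableP : Fint => [_].
  congr (_ < _)%E; apply: eq_measure_integral => A mA _; exact: lawE.
have ZYint : P.-integrable setT (fun w => (Z w * Y w)%:E).
  apply/integrableP; split.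
    by apply: measurable_EFin_fun; apply: measurable_funM.
  move/integrableP : mpush => [_].
  rewrite ge0_integral_pushforward//; exact: measurableT_comp.
split => //.
transitivity (\int[pushforward P (fun w => (Z w, Y w))]_z F z)%E.
  by rewrite integral_pushforward.
transitivity (\int[law \x nu]_z F z)%E.
  by apply: eq_measure_integral => A mA _; first [exact: lawE|exact/esym/lawE].
rewrite -integral12_prod_meas1//.
rewrite integral0_eq// => z _; rewrite /fubini_F/=.
under eq_integral do rewrite /F/= EFinM.
by rewrite integralZl// nu0 mule0.
Qed.

End independence.

(** * The augmented filtration and the Brownian increments *)

Lemma continuous_borel_measurable (R : realType) (V : ptopologicalType)
    d (T : measurableType d) (D : set T) (f : T -> V) (h : V -> R) :
  continuous h -> measurable_fun D (f : T -> borelType V) ->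
  measurable_fun D (h \o f).
Proof.
move=> /continuousP ch mf mD.
apply: (measurability _ (RGenOpens.measurableE R)) => //.
move=> _ [_ [a [b ->]] <-]; rewrite comp_preimage.
by apply: mf => //; apply: sub_sigma_algebra; exact/ch/interval_open.
Qed.

Lemma borel_entry_measurable (R : realType) d (T : measurableType d) (D : set T)
    p q (f : T -> 'M[R]_(p, q)) i j :
  measurable_fun D (f : T -> borelType 'M[R]_(p, q)) ->
  measurable_fun D (fun w => f w i j).
Proof.
by apply: (@continuous_borel_measurable R 'M[R]_(p, q) _ _ _ _ (fun M : 'M[R]_(p, q) => M i j));
  exact: coord_continuous.
Qed.

Section brownian_filtration.
Context {R : realType} {dO : measure_display} {Omega : measurableType dO}.
Context (P : probability Omega R) {d m : nat}.
Variables (T : R) (W : R -> Omega -> 'cV[R]_m) (X0 : Omega -> 'cV[R]_d).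
Hypothesis Pcomplete : measure_is_complete P.
Hypothesis Wbm : brownian_motion P T W.
Hypothesis X0cst : exists x0, X0 = cst x0.
Implicit Types (Z : Omega -> R) (s t r : R) (l : 'I_m).

Local Notation gens t := (filtration_generators P W X0 t).
Local Notation FT t := (g_sigma_algebraType (gens t)).

Definition F_measurable t Z := measurable_fun [set: FT t] (Z : FT t -> R).

Lemma initial_eventsE A : initial_events X0 A -> A = set0 \/ A = setT.
Proof.
have [x0 ->] := X0cst => -[B _ ->].
by rewrite /preimage/=; case: (pselect (B x0)) => Bx0; [right|left];
  apply/seteqP; split.
Qed.

Lemma filtration_sub t : t <= T -> <<s gens t >> `<=` @measurable _ Omega.
Proof.
move=> tT; apply: smallest_sub; first exact: sigma_algebra_measurable.
move=> A [[[s [B [/andP[s0 st] BB ->]]]|/initial_eventsE[->|->]//]|/Pcomplete//].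
have [+ _ _ _] := Wbm => /(_ s); rewrite s0 (le_trans st tT) => /(_ isT).
by move=> /(_ measurableT B BB); rewrite setTI.
Qed.

Lemma filtration_mono s t : s <= t -> <<s gens s >> `<=` <<s gens t >>.
Proof.
move=> st; apply: sub_sigma_algebra2 => A [[[r [B [/andP[r0 rs] BB ->]]]|]|].
- by left; left; exists r, B; split=> //; rewrite r0 (le_trans rs).
- by move=> ?; left; right.
- by move=> ?; right.
Qed.

Lemma F_measurable_sub t Z : t <= T -> F_measurable t Z -> measurable_fun setT Z.
Proof.
move=> tT mZ _ B mB; apply: (filtration_sub tT).
exact: (mZ measurableT B mB).
Qed.

Lemma F_measurable_mono s t Z : s <= t -> F_measurable s Z -> F_measurable t Z.
Proof.
move=> st mZ _ B mB; apply: (filtration_mono st).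
exact: (mZ measurableT B mB).
Qed.

Lemma F_measurable_W r t l : 0 <= r <= t -> F_measurable t (fun w => W r w l 0).
Proof.
move=> rt; apply: (@borel_entry_measurable R _ (FT t)) => _ B BB.
rewrite setTI; apply: sub_sigma_algebra; left; left.
by exists r, B; split.
Qed.

(** Augmenting by null sets and by the constant initial value does not change
    the filtration up to null sets, so the increments stay independent of it. *)
Lemma filtration_noise t A : <<s gens t >> A -> exists A' N,
  [/\ <<s noise_events W t >> A', P.-negligible N & A `\` N = A' `\` N].
Proof.
have neg0 : P.-negligible set0 by exact: negligible_set0.
pose C A := exists A' N,
  [/\ <<s noise_events W t >> A', P.-negligible N & A `\` N = A' `\` N].
suff : <<s gens t >> `<=` C by apply.
apply: smallest_sub; first split.
- by exists set0, set0; split; [exact: sigma_algebra0|exact: neg0|].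
- move=> B [B' [N [nB' nN BN]]]; exists (~` B'), N; split => //.
    by rewrite -setTD; apply: sigma_algebraCD.
  rewrite setTD; apply/seteqP; split => x [xB xN]; split => //.
    by move=> B'x; have : (B' `\` N) x by []; rewrite -BN => -[].
  by move=> Bx; have : (B `\` N) x by []; rewrite BN => -[].
- move=> F FC; have /choice[F' FF'] := FC; have /choice[N NF] := FF'.
  exists (\bigcup_i F' i), (\bigcup_i N i); split.
  + by apply: sigma_algebra_bigcup => i; have [] := NF i.
  + by apply: negligible_bigcup => i; have [] := NF i.
  + apply/seteqP; split => x [[i _ Fx] Nx]; split => //; exists i => //.
      have [_ _ e] := NF i; have : (F i `\` N i) x.
        by split=> // Nix; apply: Nx; exists i.
      by rewrite e => -[].
    have [_ _ e] := NF i; have : (F' i `\` N i) x.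
      by split=> // Nix; apply: Nx; exists i.
    by rewrite -e => -[].
- move=> B [[nB|/initial_eventsE[BE|BE]]|nB].
  + by exists B, set0; split => //; exact: sub_sigma_algebra.
  + by exists set0, set0; split => //; [exact: sigma_algebra0|rewrite BE].
  + exists setT, set0; split => //; last by rewrite BE.
    rewrite -[X in _ X](setD0 setT).
    by apply: sigma_algebraCD; exact: sigma_algebra0.
  + exists set0, B; split => //; first exact: sigma_algebra0.
    by rewrite setDv set0D.
Qed.

Definition incr s t l w := W t w l 0 - W s w l 0.

Let noise_measurable s A : s <= T -> <<s noise_events W s >> A -> measurable A.
Proof.
move=> sT nA; apply: (filtration_sub sT).
by move: nA; apply: sub_sigma_algebra2 => B nB; left; left.
Qed.

Lemma measurable_W t l : 0 <= t <= T -> measurable_fun setT (fun w => W t w l 0).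
Proof.
by move=> /andP[t0 tT]; apply: (F_measurable_sub (lexx T));
  apply: F_measurable_W; rewrite t0.
Qed.

Lemma measurable_incr s t l : 0 <= s -> s <= t -> t <= T ->
  measurable_fun setT (incr s t l).
Proof.
move=> s0 st tT; apply: measurable_funB; apply: measurable_W.
  by rewrite (le_trans s0).
by rewrite s0 (le_trans st).
Qed.

(** Up to a null set an event of the filtration is a noise event, for which
    independence is part of the definition of the Brownian motion; the law of
    a single component is obtained by leaving the other components free. *)
Lemma filtration_indep s t l G (B : set (measurableTypeR R)) :
  0 <= s -> s < t -> t <= T -> <<s gens s >> G -> measurable B ->
  P (G `&` incr s t l @^-1` B) =
  (P G * normal_prob 0 (Num.sqrt (t - s)) B)%E.
Proof.
move=> s0 st tT FG mB; have sT : s <= T by rewrite (le_trans (ltW st)).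
have mG := filtration_sub sT FG.
have [G' [N [nG' nN GG']]] := filtration_noise FG.
have mG' := noise_measurable sT nG'.
have mN : measurable N by exact: Pcomplete.
have N0 : P N = 0%E by exact: measure_negligible.
have mincr : measurable (incr s t l @^-1` B).
  by rewrite -[X in measurable X]setTI; apply: measurable_incr => //; exact: ltW.
have PD A : measurable A -> P A = P (A `\` N).
  move=> mA; have AN0 : P (A `&` N) = 0%E; last first.
    by rewrite -[RHS]adde0 -AN0; exact: measureDI.
  apply/eqP; rewrite -measure_le0 -N0 le_measure ?inE//; exact: measurableI.
rewrite (PD (_ `&` _)); last exact: measurableI.
rewrite setDE setIAC -setDE GG' setDE setIAC -setDE -PD; last exact: measurableI.
rewrite (PD G)// GG' -PD//.
have [_ _ _ /(_ s t G' (fun i => if i == l then B else setT) s0 st tT nG')] := Wbm.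
rewrite (bigD1 l)//= eqxx big1 ?mule1; last first.
  by move=> i /negbTE ->; rewrite probability_setT.
move=> <-; last by move=> i; case: ifP.
congr (P (_ `&` _)); apply/seteqP; split => w /=.
  by move=> Bw i; case: ifP => // /eqP ->.
by move=> /(_ l); rewrite eqxx.
Qed.

Let sqrtB_gt0 s t : s < t -> 0 < Num.sqrt (t - s).
Proof. by move=> st; rewrite sqrtr_gt0 subr_gt0. Qed.

Let sqrt_sqr s t : s < t -> Num.sqrt (t - s) ^+ 2 = t - s.
Proof. by move=> st; rewrite sqr_sqrtr// subr_ge0 ltW. Qed.

Let incr_xx s l : incr s s l = cst 0.
Proof. by apply/funext => w; rewrite /incr subrr. Qed.

Section moments.
Variables (s t : R) (l : 'I_m) (Z : Omega -> R).
Hypotheses (s0 : 0 <= s) (st : s <= t) (tT : t <= T) (FZ : F_measurable s Z).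

Let mZ : measurable_fun setT Z.
Proof. by apply: F_measurable_sub FZ; exact: le_trans tT. Qed.

Let Zindep (A B : set (measurableTypeR R)) : s < t ->
  measurable A -> measurable B ->
  P (Z @^-1` A `&` incr s t l @^-1` B) =
  (P (Z @^-1` A) * normal_prob 0 (Num.sqrt (t - s)) B)%E.
Proof.
move=> lt_st mA mB; apply: filtration_indep => //.
by have := FZ measurableT mA; rewrite setTI.
Qed.

(** [Z] is known at time [s], and the increment after [s] is independent of
    it. *)
Lemma incr_mean0 c : int_le P setT (fun w => `|Z w|) c ->
  P.-integrable setT (fun w => (Z w * incr s t l w)%:E) /\
  (\int[P]_w (Z w * incr s t l w)%:E = 0)%E.
Proof.
move=> Zc; have [lt_st|] := ltP s t; last first.
  move=> ts; rewrite (_ : t = s); last by apply/eqP; rewrite eq_le ts.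
  rewrite incr_xx; under eq_fun do rewrite mulr0.
  split; first exact: integrable0.
  by rewrite integral0_eq// => w _; rewrite mulr0.
apply: (indep_integral0 (nu := normal_prob 0 (Num.sqrt (t - s)))) => //.
- exact: measurable_incr.
- by move=> A B; exact: Zindep.
- by apply: normal_moment1_integrable; exact: sqrtB_gt0.
- by apply: normal_mean0; exact: sqrtB_gt0.
- exact: (int_le_integrable (c := c)).
Qed.

Let incr_moment (phi : R -> R) c v :
  measurable_fun setT (phi : measurableTypeR R -> R) ->
  (forall x, 0 <= phi x) -> (forall w, 0 <= Z w) -> s < t ->
  int_le P setT Z c ->
  int_le (normal_prob 0 (Num.sqrt (t - s))) setT phi v ->
  int_le P setT (fun w => Z w * phi (incr s t l w)) (c * v).
Proof.
move=> mphi phi0 Z0 lt_st Zc phiv; rewrite /int_le.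
rewrite (indep_integral_ge0 (nu := normal_prob 0 (Num.sqrt (t - s))))//.
- rewrite EFinM lee_pmul//; apply: integral_ge0 => x _; by rewrite lee_fin.
- exact: measurable_incr.
- by move=> A B; exact: Zindep.
Qed.

Lemma incr_moment2 c : (forall w, 0 <= Z w) -> int_le P setT Z c ->
  int_le P setT (fun w => Z w * incr s t l w ^+ 2) (c * (65 * (t - s))).
Proof.
move=> Z0 Zc; have [lt_st|] := ltP s t; last first.
  move=> ts; rewrite (_ : t = s); last by apply/eqP; rewrite eq_le ts.
  rewrite incr_xx subrr !mulr0 /int_le integral0_eq// => w _.
  by rewrite expr0n mulr0.
apply: (@incr_moment (fun x => x ^+ 2)) => //.
- by move=> x; exact: sqr_ge0.
- have := normal_moment2 (sqrtB_gt0 lt_st).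
  by rewrite [in X in int_le _ _ _ X]sqrt_sqr.
Qed.

Lemma incr_moment4 c : (forall w, 0 <= Z w) -> int_le P setT Z c ->
  int_le P setT (fun w => Z w * incr s t l w ^+ 4) (c * (64 * (t - s) ^+ 2)).
Proof.
move=> Z0 Zc; have [lt_st|] := ltP s t; last first.
  move=> ts; rewrite (_ : t = s); last by apply/eqP; rewrite eq_le ts.
  rewrite incr_xx /int_le integral0_eq => [|w _]; last by rewrite expr0n mulr0.
  by rewrite subrr expr0n !mulr0.
apply: (@incr_moment (fun x => x ^+ 4)) => //.
- by move=> x; rewrite exprn_even_ge0.
- have := normal_moment4 (sqrtB_gt0 lt_st).
  by rewrite (exprM _ 2 2) [in X in int_le _ _ _ X]sqrt_sqr.
Qed.

End moments.

End brownian_filtration.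

(** * Moments of simple stochastic sums *)

Lemma sqr_sum_le (R : realFieldType) (I : finType) (x : I -> R) :
  (\sum_i x i) ^+ 2 <= #|I|%:R * \sum_i x i ^+ 2.
Proof.
have S1 : \sum_i \sum_(j : I) x i ^+ 2 = #|I|%:R * \sum_i x i ^+ 2.
  by under eq_bigr do rewrite sumr_const; rewrite sumrMnl mulr_natl.
have S2 : \sum_(i : I) \sum_j x j ^+ 2 = #|I|%:R * \sum_i x i ^+ 2.
  by rewrite sumr_const mulr_natl.
suff : 2 * (\sum_i x i) ^+ 2 <=
    \sum_i \sum_(j : I) x i ^+ 2 + \sum_(i : I) \sum_j x j ^+ 2.
  rewrite S1 S2; lra.
rewrite -big_split/= expr2 big_distrlr/= mulr_sumr; apply: ler_sum => i _.
rewrite -big_split/= mulr_sumr; apply: ler_sum => j _.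
have := sqr_ge0 (x i - x j); nra.
Qed.

Lemma pow4_sum_le (R : realFieldType) (I : finType) (x : I -> R) :
  (\sum_i x i) ^+ 4 <= #|I|%:R ^+ 3 * \sum_i x i ^+ 4.
Proof.
rewrite (exprM _ 2 2).
apply: (@le_trans _ _ ((#|I|%:R * \sum_i x i ^+ 2) ^+ 2)).
  by rewrite lerXn2r ?nnegrE ?sqr_ge0// ?sqr_sum_le// mulr_ge0// sumr_ge0// => i _; exact: sqr_ge0.
rewrite exprMn [in leRHS]exprSr -mulrA ler_wpM2l ?sqr_ge0//.
apply: le_trans (sqr_sum_le _) _; rewrite ler_wpM2l//.
by apply: ler_sum => i _; rewrite -exprM.
Qed.

Lemma pow4D_le (R : realFieldType) (x y : R) :
  (x + y) ^+ 4 <= 8 * x ^+ 4 + 8 * y ^+ 4.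
Proof.
have -> : 8 * x ^+ 4 + 8 * y ^+ 4 = (x + y) ^+ 4 +
  (x - y) ^+ 2 * (7 * x ^+ 2 + 10 * x * y + 7 * y ^+ 2) by ring.
rewrite lerDl mulr_ge0 ?sqr_ge0//.
have -> : 7 * x ^+ 2 + 10 * x * y + 7 * y ^+ 2 =
  2 * x ^+ 2 + 5 * (x + y) ^+ 2 + 2 * y ^+ 2 by ring.
by nonneg.
Qed.

Section step_functions.
Context {R : realType}.
Implicit Types (tau : nat -> R) (n N : nat).

(** The points are distinct, so that a function that is constant on each
    interval ]tau i, tau i.+1] can be read off at the right end points. *)
Definition is_grid tau N s :=
  [/\ tau 0%N = 0, tau N = s & forall i, (i < N)%N -> tau i < tau i.+1].

Lemma grid_le tau N s i j : is_grid tau N s -> (i <= j)%N -> (j <= N)%N ->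
  tau i <= tau j.
Proof.
move=> [_ _ gr]; elim: j => [|j ih]; first by rewrite leqn0 => /eqP ->.
rewrite leq_eqVlt => /orP[/eqP ->//|ij jN].
by apply: le_trans (ltW (gr _ jN)); apply: ih => //; exact: ltnW.
Qed.

Lemma grid_ge0 tau N s i : is_grid tau N s -> (i <= N)%N -> 0 <= tau i.
Proof. by move=> gr iN; have [<- _ _] := gr; exact: (grid_le gr). Qed.

Lemma grid_le_end tau N s i : is_grid tau N s -> (i <= N)%N -> tau i <= s.
Proof. by move=> gr iN; have [_ <- _] := gr; exact: (grid_le gr). Qed.

Lemma step_integral tau N s n (G : R -> R) : is_grid tau N s -> (n <= N)%N ->
  (forall r, 0 <= G r) ->
  (forall i r, (i < N)%N -> tau i < r <= tau i.+1 -> G r = G (tau i.+1)) ->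
  measurable_fun (`[0, tau n] : set (measurableTypeR R)) G /\
  (\int[lebesgue_measure]_(r in `[0%R, tau n]) (G r)%:E =
   (\sum_(i < n) (tau i.+1 - tau i) * G (tau i.+1))%:E)%E.
Proof.
move=> gr + G0 Gs; elim: n => [|n ih] nN.
  have [-> _ _] := gr; rewrite set_itv1 big_ord0; split.
    exact: measurable_fun_set1.
  by rewrite integral_set1.
have [mG IG] := ih (ltnW nN); have [_ _ /(_ n nN) lt_n] := gr.
have itvE : `[0, tau n.+1]%classic =
    `[0, tau n]%classic `|` `]tau n, tau n.+1]%classic :> set R.
  rewrite -itv_bndbnd_setU// bnd_simp; last exact: ltW.
  by apply: (grid_ge0 gr); exact: ltnW.
have mG' : measurable_fun (`]tau n, tau n.+1] : set (measurableTypeR R)) G.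
  apply: (@eq_measurable_fun _ _ _ _ _ (cst (G (tau n.+1)))) => //.
  by move=> r; rewrite inE/= in_itv/= => rn; rewrite (Gs n r nN rn).
have mGU : measurable_fun (`[0, tau n.+1] : set (measurableTypeR R)) G.
  by rewrite itvE; apply/measurable_funU.
split=> //; rewrite itvE ge0_integral_setU//=.
- rewrite IG big_ord_recr/= EFinD; congr (_ + _)%E.
  transitivity (\int[lebesgue_measure]_(r in `]tau n, tau n.+1]) (G (tau n.+1))%:E)%E.
    apply: eq_integral => r; rewrite inE/= in_itv/= => rn.
    by rewrite (Gs n r nN rn).
  rewrite integral_cst//= lebesgue_measure_itv/= lte_fin lt_n.
  by rewrite -EFinD -EFinM mulrC.
- by rewrite -itvE; exact: measurable_EFin_fun.
- by move=> r _; rewrite lee_fin.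
- rewrite disj_set2E; apply/eqP/seteqP; split => // r [] /=.
  by rewrite !in_itv/= => /andP[_ rn] /andP[/(le_lt_trans rn)]; rewrite ltxx.
Qed.

End step_functions.

(** One step of the discrete Gronwall argument in [simple_sum_moment4]: [M] is
    the dimension of the noise, [y] the bound reached so far, [V] the moment
    of the integrand and [D] the length of the step. *)
Lemma moment4_rate_step (R : realFieldType) (M y V D T : R) :
  0 <= M -> 0 <= y -> 0 <= V -> 0 <= D -> D <= T -> 0 <= T ->
  y + (8 * M * ((M * y + V) / 2 * (65 * D)) + 3 * M ^+ 3 * (V * (64 * D ^+ 2)))
  <= y * (1 + (260 * M ^+ 2 + 260 * M + 192 * M ^+ 3 * T) * D) +
     (260 * M ^+ 2 + 260 * M + 192 * M ^+ 3 * T) * D * V.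
Proof.
move=> M0 y0 V0 D0 DT T0.
have p1 : 0 <= M ^+ 3 * (D * (V * (T - D))).
  by rewrite -subr_ge0 in DT; nonneg.
have p2 : 0 <= M * (y * D) by nonneg.
have p3 : 0 <= M ^+ 3 * T * (y * D) by nonneg.
have p4 : 0 <= M ^+ 2 * (V * D) by nonneg.
lra.
Qed.

Section simple_integrals.
Context {R : realType} {dO : measure_display} {Omega : measurableType dO}.
Context (P : probability Omega R) {d m : nat}.
Variables (T : R) (W : R -> Omega -> 'cV[R]_m) (X0 : Omega -> 'cV[R]_d).
Hypothesis Pcomplete : measure_is_complete P.
Hypothesis Wbm : brownian_motion P T W.
Hypothesis X0cst : exists x0, X0 = cst x0.
Implicit Types (tau : nat -> R) (n N : nat) (z : 'I_m -> R -> Omega -> R).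

Local Notation E_le := (int_le P setT).

(** The value on ]tau i, tau i.+1] is read at the right end point, but it is
    known at the left one: the integrand is predictable. *)
Definition stepwise tau N z :=
  [/\ forall i l, (i < N)%N -> F_measurable P W X0 (tau i) (z l (tau i.+1)),
     forall i l r w, (i < N)%N -> tau i < r <= tau i.+1 ->
       z l r w = z l (tau i.+1) w &
     exists K, forall i l w, (i < N)%N -> `|z l (tau i.+1) w| <= K].

Definition simple_sum tau n z w :=
  \sum_(i < n) \sum_l z l (tau i.+1) w * incr W (tau i) (tau i.+1) l w.

Section moments.
Variables (tau : nat -> R) (N : nat) (s : R) (z : 'I_m -> R -> Omega -> R).
Hypotheses (gr : is_grid tau N s) (sT : s <= T) (zst : stepwise tau N z).

Let tau_lt i : (i < N)%N -> tau i < tau i.+1.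
Proof. by have [_ _] := gr; exact. Qed.

Let tau_T i : (i <= N)%N -> tau i <= T.
Proof. by move=> iN; rewrite (le_trans _ sT)// (grid_le_end gr). Qed.

Let tau_ge0 i : (i <= N)%N -> 0 <= tau i.
Proof. exact: (grid_ge0 gr). Qed.

Let Fz i l : (i < N)%N -> F_measurable P W X0 (tau i) (z l (tau i.+1)).
Proof. by have [+ _ _] := zst; exact. Qed.

Lemma F_measurable_simple_sum n : (n <= N)%N ->
  F_measurable P W X0 (tau n) (simple_sum tau n z).
Proof.
move=> nN; rewrite /F_measurable /simple_sum.
apply: measurable_sum => i; apply: measurable_sum => l.
have iN : (i < N)%N by rewrite (leq_trans (ltn_ord i)).
apply: measurable_funM.
  apply: (F_measurable_mono (grid_le gr (ltnW (ltn_ord i)) nN)).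
  exact: Fz.
apply: measurable_funB; apply: F_measurable_W.
  by rewrite tau_ge0//= (grid_le gr).
by rewrite tau_ge0 ?(ltnW iN)//= (grid_le gr)// ltnW.
Qed.

Let mz i l : (i < N)%N -> measurable_fun setT (z l (tau i.+1)).
Proof.
by move=> iN; apply: (F_measurable_sub Pcomplete Wbm X0cst (tau_T (ltnW iN))); exact: Fz.
Qed.

Lemma measurable_simple_sum n : (n <= N)%N -> measurable_fun setT (simple_sum tau n z).
Proof.
move=> nN; apply: (F_measurable_sub Pcomplete Wbm X0cst (tau_T nN)).
exact: F_measurable_simple_sum.
Qed.

Let minc i l : (i < N)%N -> measurable_fun setT (incr W (tau i) (tau i.+1) l).
Proof.
move=> iN; apply: (measurable_incr Pcomplete Wbm X0cst).
- by rewrite tau_ge0// ltnW.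
- by rewrite ltW// tau_lt.
- exact: tau_T.
Qed.

Let simple_sumS n w : simple_sum tau n.+1 z w =
  simple_sum tau n z w +
  \sum_l z l (tau n.+1) w * incr W (tau n) (tau n.+1) l w.
Proof. by rewrite /simple_sum big_ord_recr. Qed.

(** Induction on the number of steps. A new increment is centered given the
    past, so its cross term with the sum so far is centered. *)
Lemma simple_sum_moment2 (v : nat -> 'I_m -> R) :
  (forall i l, (i < N)%N -> E_le (fun w => z l (tau i.+1) w ^+ 2) (v i l)) ->
  forall n, (n <= N)%N -> E_le (fun w => simple_sum tau n z w ^+ 2)
    (65 * m%:R * \sum_(i < n) (tau i.+1 - tau i) * \sum_l v i l).
Proof.
move=> zv; elim=> [|n ih] nN.
  rewrite big_ord0 mulr0 /int_le integral0_eq// => w _.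
  by rewrite /simple_sum big_ord0 expr0n.
have {}ih := ih (ltnW nN); have lt_n := tau_lt nN.
have [_ _ [K zK]] := zst.
set M := simple_sum tau n z; set c := fun l => z l (tau n.+1).
set D := fun l => incr W (tau n) (tau n.+1) l.
have FM : F_measurable P W X0 (tau n) M by exact: F_measurable_simple_sum (ltnW nN).
have mM := measurable_simple_sum (ltnW nN).
have mc l : measurable_fun setT (c l) by exact: mz.
have mD l : measurable_fun setT (D l) by exact: minc.
have mcD l : measurable_fun setT (fun w => c l w ^+ 2 * D l w ^+ 2).
  by apply: measurable_funM; exact: measurable_funX.
have cross : mean0 P setT (fun w => \sum_l (2 * M w * c l w) * D l w).
  apply: mean0_sum => // l.
  apply: (incr_mean0 Pcomplete Wbm X0cst l (tau_ge0 (ltnW nN)) (ltW lt_n) (tau_T nN)).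
    apply: measurable_funM; first by apply: measurable_funM.
    exact: Fz.
  apply: (@int_le_mono _ _ _ _ _ _ (fun w => M w ^+ 2 + c l w ^+ 2)).
    move=> w _; rewrite normr_ge0/= ler_norml.
    by have := sqr_ge0 (M w - c l w); have := sqr_ge0 (M w + c l w); nra.
  apply: int_leD ih (zv n l nN) => //.
  - exact: measurable_funX.
  - by apply: measurable_funX; exact: mz.
  - by move=> w _; exact: sqr_ge0.
  - by move=> w _; exact: sqr_ge0.
rewrite big_ord_recr/= mulrDr.
apply: (int_le_mean0 (g := fun w => M w ^+ 2 + m%:R * \sum_l c l w ^+ 2 * D l w ^+ 2) _ _ _ _ cross) => //.
- apply: measurable_funD; first exact: measurable_funX.
  by apply: measurable_funM => //; exact: measurable_sum.
- move=> w _; rewrite addr_ge0 ?sqr_ge0// mulr_ge0// sumr_ge0// => l _.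
  by rewrite mulr_ge0 ?sqr_ge0.
- apply: int_leD => //.
  + exact: measurable_funX.
  + by apply: measurable_funM => //; exact: measurable_sum.
  + by move=> w _; exact: sqr_ge0.
  + move=> w _; rewrite mulr_ge0// sumr_ge0// => l _.
    by rewrite mulr_ge0 ?sqr_ge0.
  + rewrite (_ : 65 * m%:R * _ = m%:R * \sum_l (v n l * (65 * (tau n.+1 - tau n)))); last first.
      by rewrite -mulr_suml; ring.
    apply: int_leZ => //.
    * exact: measurable_sum.
    * by move=> w _; nonneg.
    * apply: int_le_sum => // [l w _|l]; first by rewrite mulr_ge0 ?sqr_ge0.
      apply: (incr_moment2 Pcomplete Wbm X0cst l (tau_ge0 (ltnW nN)) (ltW lt_n) (tau_T nN)).
      - by apply: measurable_funX; exact: Fz.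
      - by move=> w; exact: sqr_ge0.
      - exact: zv.
- move=> w _; rewrite sqr_ge0/= simple_sumS -/M.
  have := sqr_sum_le (fun l => c l w * D l w); rewrite card_ord.
  under [X in _ <= _ * X -> _]eq_bigr do rewrite exprMn.
  have -> : \sum_l 2 * M w * c l w * D l w = 2 * M w * \sum_l c l w * D l w.
    by rewrite mulr_sumr; apply: eq_bigr => l _; rewrite mulrA.
  set Y := \sum_l _ * _; set Q := _ * \sum_l _ => h.
  rewrite -/Y; move: h; move: (M w) Y Q => a y q; nra.
Qed.

(** The rate of the exponential growth in [simple_sum_moment4]. *)
Definition moment4_rate : R :=
  260 * m%:R ^+ 2 + 260 * m%:R + 192 * m%:R ^+ 3 * T.

(** Induction on the number of steps, with M the sum so far and Y the new
    term. In (M + Y)^4 the term 4 M^3 Y is centered, and the others are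
    bounded by M^4, M^2 Y^2 and Y^4. The mean of M^2 Y^2 feeds back the mean
    of M^4 times the length of the step, whence the exponential. *)
Lemma simple_sum_moment4 (v : nat -> 'I_m -> R) :
  (forall i l, (i < N)%N -> E_le (fun w => z l (tau i.+1) w ^+ 4) (v i l)) ->
  forall n, (n <= N)%N -> E_le (fun w => simple_sum tau n z w ^+ 4)
    (expR (moment4_rate * tau n) *
     (moment4_rate * \sum_(i < n) (tau i.+1 - tau i) * \sum_l v i l)).
Proof.
move=> zv; have T0 : 0 <= T.
  by apply: le_trans sT; have [_ <- _] := gr; exact: tau_ge0.
have m0 : 0 <= m%:R :> R by [].
have A0 : 0 <= moment4_rate.
  by rewrite /moment4_rate; nonneg.
elim=> [|n ih] nN.
  rewrite big_ord0 !mulr0 /int_le integral0_eq// => w _.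
  by rewrite /simple_sum big_ord0 expr0n.
have {}ih := ih (ltnW nN); have lt_n := tau_lt nN.
have [_ _ [K zK]] := zst.
set M := simple_sum tau n z; set c := fun l => z l (tau n.+1).
set D := fun l => incr W (tau n) (tau n.+1) l.
set y := (X in int_le _ _ _ X) in ih.
have FM : F_measurable P W X0 (tau n) M by exact: F_measurable_simple_sum (ltnW nN).
have mM : measurable_fun setT M by exact: measurable_simple_sum (ltnW nN).
have mc l : measurable_fun setT (c l) by exact: mz.
have mD l : measurable_fun setT (D l) by exact: minc.
have ge0_4 (x : R) : 0 <= x ^+ 4 by rewrite exprn_even_ge0.
have zv4 l : E_le (fun w => c l w ^+ 4) (v n l) by exact: zv.
have v0 l : 0 <= v n l by apply: (int_le_ge0 _ (zv4 l)) => w _.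
have y0 : 0 <= y by apply: (int_le_ge0 _ ih) => w _.
have mMc : measurable_fun setT (fun w => M w ^+ 4) by exact: measurable_funX.
have mc4 l : measurable_fun setT (fun w => c l w ^+ 4) by exact: measurable_funX.
have cross : mean0 P setT (fun w => \sum_l (4 * M w ^+ 3 * c l w) * D l w).
  apply: mean0_sum => // l.
  apply: (incr_mean0 Pcomplete Wbm X0cst l (tau_ge0 (ltnW nN)) (ltW lt_n) (tau_T nN)).
    apply: measurable_funM; last exact: Fz.
    by apply: measurable_funM => //; exact: measurable_funX.
  apply: (@int_le_mono _ _ _ _ _ _ (fun w => 3 * M w ^+ 4 + c l w ^+ 4)).
    move=> w _; rewrite normr_ge0/= ler_norml; move: (M w) (c l w) => a b.
    (* 4 |a|^3 |b| <= 3 a^4 + b^4 *)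
    have h1 : 3 * a ^+ 4 + b ^+ 4 - 4 * a ^+ 3 * b =
      (a - b) ^+ 2 * ((a + b) ^+ 2 + 2 * a ^+ 2) by ring.
    have h2 : 3 * a ^+ 4 + b ^+ 4 + 4 * a ^+ 3 * b =
      (a + b) ^+ 2 * ((a - b) ^+ 2 + 2 * a ^+ 2) by ring.
    have p1 : 0 <= (a - b) ^+ 2 * ((a + b) ^+ 2 + 2 * a ^+ 2).
      by nonneg.
    have p2 : 0 <= (a + b) ^+ 2 * ((a - b) ^+ 2 + 2 * a ^+ 2).
      by nonneg.
    by apply/andP; split; lra.
  apply: int_leD (int_leZ _ _ _ _ ih) (zv4 l) => //.
  - exact: measurable_funM.
  - by move=> w _; exact: mulr_ge0.
have mMcD l : measurable_fun setT (fun w => (M w ^+ 2 * c l w ^+ 2) * D l w ^+ 2).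
  by apply: measurable_funM; [apply: measurable_funM|]; exact: measurable_funX.
have mcD4 l : measurable_fun setT (fun w => c l w ^+ 4 * D l w ^+ 4).
  by apply: measurable_funM => //; exact: measurable_funX.
have MD0 l w : 0 <= M w ^+ 2 * c l w ^+ 2 * D l w ^+ 2.
  by nonneg.
have cD0 l w : 0 <= c l w ^+ 4 * D l w ^+ 4 by rewrite mulr_ge0.
set Del := tau n.+1 - tau n.
have Del0 : 0 <= Del by rewrite subr_ge0 ltW.
have DelT : Del <= T.
  by rewrite (le_trans _ (tau_T nN))// lerBlDr lerDl tau_ge0// ltnW.
pose V := \sum_l v n l.
have V0 : 0 <= V by rewrite sumr_ge0.
apply: (@int_le_wk _ _ _ _ _ _ (y +
   (8 * m%:R * \sum_l ((y + v n l) / 2 * (65 * Del)) +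
    3 * m%:R ^+ 3 * \sum_l (v n l * (64 * Del ^+ 2))))).
  rewrite big_ord_recr/= -/V -/Del.
  rewrite -!mulr_suml big_split/= sumr_const card_ord -[y *+ m]mulr_natl -/V.
  set B := \sum_(i < n) _ in y y0 ih *.
  have -> : moment4_rate * tau n.+1 = moment4_rate * tau n + moment4_rate * Del.
    by rewrite /Del; ring.
  rewrite expRD.
  set e1 := expR (_ * tau n) in y y0 ih *.
  have e1_ge1 : 1 <= e1.
    by rewrite -[leLHS]expR0 ler_expR mulr_ge0// tau_ge0// ltnW.
  have e2_ge := expR_ge1Dx (moment4_rate * Del); set e2 := expR _ in e2_ge *.
  have AD0 : 0 <= moment4_rate * Del by rewrite mulr_ge0.
  have ADV0 : 0 <= moment4_rate * Del * V by rewrite mulr_ge0.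
  have hy : y * (1 + moment4_rate * Del) <= y * e2 by rewrite ler_wpM2l.
  have hv : moment4_rate * Del * V <= e1 * e2 * (moment4_rate * Del * V).
    rewrite ler_peMl// -[leLHS]mulr1 ler_pM//; lra.
  have -> : e1 * e2 * (moment4_rate * (B + Del * V)) =
    y * e2 + e1 * e2 * (moment4_rate * Del * V) by rewrite /y; ring.
  apply: le_trans (lerD hy hv); exact: moment4_rate_step.
apply: (int_le_mean0 (g := fun w => M w ^+ 4 +
    (8 * m%:R * (\sum_l M w ^+ 2 * c l w ^+ 2 * D l w ^+ 2) +
     3 * m%:R ^+ 3 * \sum_l c l w ^+ 4 * D l w ^+ 4)) _ _ _ _ cross) => //.
- apply: measurable_funD => //.
  by apply: measurable_funD; apply: measurable_funM => //; exact: measurable_sum.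
- by move=> w _; nonneg.
- apply: int_leD => //.
  + by apply: measurable_funD; apply: measurable_funM => //; exact: measurable_sum.
  + by move=> w _; nonneg.
  apply: int_leD => //.
  + by apply: measurable_funM => //; exact: measurable_sum.
  + by apply: measurable_funM => //; exact: measurable_sum.
  + by move=> w _; nonneg.
  + by move=> w _; nonneg.
  + apply: int_leZ => //.
    * exact: measurable_sum.
    * by move=> w _; rewrite sumr_ge0.
    apply: int_le_sum => // l.
    apply: (incr_moment2 Pcomplete Wbm X0cst l (tau_ge0 (ltnW nN)) (ltW lt_n) (tau_T nN)).
    * apply: measurable_funM; first exact: measurable_funX.
      by apply: measurable_funX; exact: Fz.
    * by move=> w; rewrite mulr_ge0 ?sqr_ge0.
    apply: (@int_le_mono _ _ _ _ _ _ (fun w => 2^-1 * (M w ^+ 4 + c l w ^+ 4))).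
      move=> w _; rewrite mulr_ge0 ?sqr_ge0//=; move: (M w) (c l w) => a b.
      by have := sqr_ge0 (a ^+ 2 - b ^+ 2); rewrite (exprM a 2 2) (exprM b 2 2); nra.
    rewrite mulrC; apply: int_leZ => //.
    * exact: measurable_funD.
    * by move=> w _; rewrite addr_ge0.
    by apply: int_leD.
  + apply: int_leZ => //.
    * exact: measurable_sum.
    * by move=> w _; rewrite sumr_ge0.
    apply: int_le_sum => // l.
    apply: (incr_moment4 Pcomplete Wbm X0cst l (tau_ge0 (ltnW nN)) (ltW lt_n) (tau_T nN)) => //.
    by apply: measurable_funX; exact: Fz.
- move=> w _; rewrite ge0_4/= simple_sumS -/M.
  have := sqr_sum_le (fun l => c l w * D l w).
  have := pow4_sum_le (fun l => c l w * D l w); rewrite card_ord.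
  under [X in _ <= _ * X -> _]eq_bigr do rewrite exprMn.
  under [X in _ -> _ <= _ * X -> _]eq_bigr do rewrite exprMn.
  have -> : \sum_l 4 * M w ^+ 3 * c l w * D l w = 4 * M w ^+ 3 * \sum_l c l w * D l w.
    by rewrite mulr_sumr; apply: eq_bigr => l _; rewrite mulrA.
  have -> : \sum_l M w ^+ 2 * c l w ^+ 2 * D l w ^+ 2 =
      M w ^+ 2 * \sum_l c l w ^+ 2 * D l w ^+ 2.
    by rewrite mulr_sumr; apply: eq_bigr => l _; rewrite mulrA.
  set Y := \sum_l _ * _; set Q4 := \sum_l c l w ^+ 4 * _.
  set Q2 := \sum_l c l w ^+ 2 * _ => h4 h2.
  rewrite -/Y; move: h4 h2; move: (M w) Y Q2 Q4 => a b q2 q4 h4 h2.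
  have k2 : 8 * (a ^+ 2 * b ^+ 2) <= 8 * (a ^+ 2 * (m%:R * q2)).
    by rewrite ler_wpM2l// ler_wpM2l// sqr_ge0.
  have k3 : 0 <= 2 * b ^+ 2 * (a - b) ^+ 2 by nonneg.
  have -> : (a + b) ^+ 4 = a ^+ 4 + 4 * a ^+ 3 * b + 8 * (a ^+ 2 * b ^+ 2) +
    3 * b ^+ 4 - 2 * b ^+ 2 * (a - b) ^+ 2 by ring.
  lra.
Qed.

End moments.

End simple_integrals.

(** * Integrals of processes over time and space *)

Section processes.
Context {R : realType} {dO : measure_display} {Omega : measurableType dO}.
Context (P : probability Omega R).
Local Notation rT := (measurableTypeR R).
Local Notation leb := (@lebesgue_measure R).
Implicit Types (h : R -> Omega -> R) (s t c : R).

Definition slab s : set (rT * Omega) := `[0, s]%classic `*` setT.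

(** Joint measurability of a real-valued process over [0, s], in the form used
    for the components of vector-valued processes. *)
Definition joint_measurable s h :=
  measurable_fun (slab s) (fun z : rT * Omega => h z.1 z.2).

Definition process_le s h c :=
  int_le (leb \x P)%E (slab s) (fun z => h z.1 z.2) c.

Lemma measurable_slab s : measurable (slab s).
Proof. by apply: measurableX. Qed.

Lemma joint_measurable_sub s t h : s <= t -> joint_measurable t h ->
  joint_measurable s h.
Proof.
move=> st; apply: measurable_funS; first exact: measurable_slab.
move=> z [/= zs _]; split => //=; move: zs; rewrite !in_itv/= => /andP[-> zs].
exact: le_trans zs st.
Qed.

Section fubini.
Variables (s : R) (h : R -> Omega -> R).
Hypotheses (mh : joint_measurable s h).
Hypothesis h0 : forall r w, 0 <= r <= s -> 0 <= h r w.

Let H := ((fun z : rT * Omega => (h z.1 z.2)%:E) \_ (slab s))%E.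

Let mH : measurable_fun setT H.
Proof.
apply/(measurable_restrictT _ (measurable_slab s)).
exact: measurable_EFin_fun.
Qed.

Let H0 z : (0 <= H z)%E.
Proof.
rewrite /H patchE; case: ifPn => // /set_mem[/=].
by rewrite in_itv/= => zs _; rewrite lee_fin h0.
Qed.

Let Hin (r : R) w : H (r, w) = ((fun r => (h r w)%:E) \_ `[0%R, s]) r.
Proof.
rewrite /H !patchE; congr (if _ then _ else _).
by apply/idP/idP; rewrite !inE/=; [case|move=> rs; split].
Qed.

Let HIn (r : R) : (\int[P]_w H (r, w))%E =
  ((fun r => \int[P]_w (h r w)%:E) \_ `[0%R, s])%E r.
Proof.
rewrite patchE; case: ifPn => rs.
  by apply: eq_integral => w _; rewrite Hin patchE rs.
by rewrite integral0_eq// => w _; rewrite Hin patchE (negbTE rs).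
Qed.

Let slabE : (\int[leb \x P]_(z in slab s) (h z.1 z.2)%:E =
  \int[leb \x P]_z H z)%E.
Proof. exact: integral_mkcond. Qed.

Lemma slab_integral12 : (\int[leb \x P]_(z in slab s) (h z.1 z.2)%:E =
  \int[leb]_(r in `[0%R, s]) \int[P]_w (h r w)%:E)%E.
Proof.
rewrite slabE; transitivity (\int[leb]_r \int[P]_w H (r, w))%E.
  exact: (fubini_tonelli1 H mH H0).
rewrite [RHS]integral_mkcond.
by apply: eq_integral => r _; rewrite HIn.
Qed.

Lemma slab_integral21 : (\int[leb \x P]_(z in slab s) (h z.1 z.2)%:E =
  \int[P]_w \int[leb]_(r in `[0%R, s]) (h r w)%:E)%E.
Proof.
rewrite slabE; transitivity (\int[leb]_r \int[P]_w H (r, w))%E.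
  exact: (fubini_tonelli1 H mH H0).
rewrite (fubini_tonelli H mH H0).
apply: eq_integral => w _; rewrite [RHS]integral_mkcond.
by apply: eq_integral => r _; rewrite Hin.
Qed.

Lemma measurable_inner_integral :
  measurable_fun setT (fun w => \int[leb]_(r in `[0%R, s]) (h r w)%:E)%E.
Proof.
have := @measurable_fun_fubini_tonelli_G _ _ _ _ _ leb H mH H0.
rewrite (_ : fubini_G _ _ = fun w => \int[leb]_(r in `[0%R, s]) (h r w)%:E)%E//.
apply/funext => w; rewrite /fubini_G [RHS]integral_mkcond.
by apply: eq_integral => r _; rewrite Hin.
Qed.

End fubini.

Lemma joint_measurable_section s h w : joint_measurable s h ->
  measurable_fun (`[0, s]%classic : set rT) (h ^~ w).
Proof.
move=> mh; have : measurable_fun (`[0, s]%classic : set rT) (fun r : rT => (r, w)).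
  by apply: measurable_funTS; exact: measurable_pair2.
move=> mp; apply: (@measurable_comp _ _ _ _ _ _ (slab s) (fun z : rT * Omega => h z.1 z.2) _ (fun r : rT => (r, w))) => //.
  exact: measurable_slab.
by move=> _ [r rs <-].
Qed.

Lemma process_le_bound s h c K : 0 <= s -> joint_measurable s h ->
  (forall r w, 0 <= r <= s -> 0 <= h r w <= K) ->
  process_le s h (K * s).
Proof.
move=> s0 mh hK; have [w _] : [set: Omega] !=set0 by exists point.
have K0 : 0 <= K.
  by have := hK 0 w; rewrite lexx s0 => /(_ isT)/andP[]; exact: le_trans.
apply: (@int_le_mono _ _ _ _ _ _ (fun=> K)).
  by move=> z [/=]; rewrite in_itv/= => zs _; exact: hK.
apply: int_le_cst => //; first exact: measurable_slab.
rewrite [X in (X <= _)%E](_ : _ = leb `[0%R, s]%classic * P setT)%E; last first.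
  exact: product_measure1E.
rewrite probability_setT mule1 lebesgue_measure_itv/= lte_fin.
by case: ifP => // _; rewrite -EFinD subr0.
Qed.

(** By Tonelli's theorem the expectation can be taken at each time first. *)
Lemma process_le_fun s h (k : R -> R) c : joint_measurable s h ->
  (forall r w, 0 <= r <= s -> 0 <= h r w) ->
  (forall r, 0 <= r <= s -> int_le P setT (h r) (k r)) ->
  int_le leb (`[0, s]%classic : set rT) k c ->
  process_le s h c.
Proof.
move=> mh h0 hk kc; rewrite /process_le /int_le slab_integral12//.
apply: le_trans kc; apply: le_integral_ge0 => r; rewrite /= in_itv/= => rs.
apply/andP; split; last exact: hk.
by apply: integral_ge0 => w _; rewrite lee_fin h0.
Qed.

Lemma process_le_mono s f g c :
  (forall r w, 0 <= r <= s -> 0 <= f r w <= g r w) ->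
  process_le s g c -> process_le s f c.
Proof.
move=> fg; apply: int_le_mono => -[r w] [/=]; rewrite in_itv/= => rs _.
exact: fg.
Qed.

Lemma process_le_wk s f b c : b <= c -> process_le s f b -> process_le s f c.
Proof. exact: int_le_wk. Qed.

Lemma process_leD s f g a b : joint_measurable s f -> joint_measurable s g ->
  (forall r w, 0 <= r <= s -> 0 <= f r w) ->
  (forall r w, 0 <= r <= s -> 0 <= g r w) ->
  process_le s f a -> process_le s g b ->
  process_le s (fun r w => f r w + g r w) (a + b).
Proof.
move=> mf mg f0 g0; apply: int_leD => //; first exact: measurable_slab.
- by move=> [r w] [/=]; rewrite in_itv/= => rs _; exact: f0.
- by move=> [r w] [/=]; rewrite in_itv/= => rs _; exact: g0.
Qed.

Lemma process_leZ s f k c : joint_measurable s f ->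
  (forall r w, 0 <= r <= s -> 0 <= f r w) -> 0 <= k ->
  process_le s f c -> process_le s (fun r w => k * f r w) (k * c).
Proof.
move=> mf f0 k0; apply: int_leZ => //; first exact: measurable_slab.
by move=> [r w] [/=]; rewrite in_itv/= => rs _; exact: f0.
Qed.

Lemma process_le_sum s (I : finType) (f : I -> R -> Omega -> R) (c : I -> R) :
  (forall i, joint_measurable s (f i)) ->
  (forall i r w, 0 <= r <= s -> 0 <= f i r w) ->
  (forall i, process_le s (f i) (c i)) ->
  process_le s (fun r w => \sum_i f i r w) (\sum_i c i).
Proof.
move=> mf f0 fc.
apply: (@int_le_sum _ _ _ _ _ (measurable_slab s) I (fun i z => f i z.1 z.2)) => //.
by move=> i [r w] [/=]; rewrite in_itv/= => rs _; exact: f0.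
Qed.

End processes.

(** * Moments of simple sums by integrals over time *)

Section simple_estimates.
Context {R : realType} {dO : measure_display} {Omega : measurableType dO}.
Context (P : probability Omega R) {d m : nat}.
Variables (T : R) (W : R -> Omega -> 'cV[R]_m) (X0 : Omega -> 'cV[R]_d).
Hypothesis Pcomplete : measure_is_complete P.
Hypothesis Wbm : brownian_motion P T W.
Hypothesis X0cst : exists x0, X0 = cst x0.
Implicit Types (tau : nat -> R) (n N : nat) (z h : 'I_m -> R -> Omega -> R).

Local Notation E_le := (int_le P setT).
Local Notation leb := (@lebesgue_measure R).
Local Notation stepwise := (stepwise P W X0).

(** For stepwise integrands the sums over the grid in the moment bounds are
    integrals over time, which do not depend on the grid. *)
Lemma grid_process_le tau N s z p c : ~~ odd p -> is_grid tau N s -> s <= T ->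
  stepwise tau N z -> (forall l, joint_measurable s (z l)) ->
  process_le P s (fun r w => \sum_l z l r w ^+ p) c ->
  exists2 v : nat -> 'I_m -> R,
    forall i l, (i < N)%N -> E_le (fun w => z l (tau i.+1) w ^+ p) (v i l) &
    \sum_(i < N) (tau i.+1 - tau i) * \sum_l v i l <= c.
Proof.
move=> podd gr sT zst mz zc.
have mzi i l : (i < N)%N -> measurable_fun setT (z l (tau i.+1)).
  move=> iN; have [Fz _ _] := zst.
  apply: (F_measurable_sub Pcomplete Wbm X0cst _ (Fz i l iN)).
  by apply: le_trans sT; apply: (grid_le_end gr); exact: ltnW.
have [_ zs [K zK]] := zst.
have p0 (x : R) : 0 <= x ^+ p by rewrite exprn_even_ge0.
pose I i l := (\int[P]_w (z l (tau i.+1) w ^+ p)%:E)%E.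
have I0 i l : (0 <= I i l)%E by apply: integral_ge0 => w _; rewrite lee_fin.
have Ifin i l : (i < N)%N -> I i l \is a fin_num.
  move=> iN; rewrite ge0_fin_numE//; apply: le_lt_trans (ltry (K ^+ p * 1)).
  apply: (@int_le_mono _ _ _ P setT _ (fun=> K ^+ p)).
    move=> w _; rewrite p0/= -[leLHS]ger0_norm// normrX lerXn2r ?nnegrE//.
      by apply: le_trans (zK i l w iN).
    exact: zK.
  by apply: int_le_cst => //; exact: probability_le1.
exists (fun i l => fine (I i l)) => [i l iN|].
  by rewrite /int_le fineK// Ifin.
rewrite -lee_fin; apply: le_trans zc.
have mG : joint_measurable s (fun r w => \sum_l z l r w ^+ p).
  by apply: measurable_sum => l; apply: measurable_funX; exact: mz.
rewrite [leRHS](_ : _ = \int[P]_w \int[leb]_(r in `[0%R, s])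
    (\sum_l z l r w ^+ p)%:E)%E; last first.
  apply: (@slab_integral21 _ _ _ P s (fun r w => \sum_l z l r w ^+ p)) => //.
  by move=> r w _; apply: sumr_ge0.
under eq_integral => w _.
  have [_] := step_integral gr (leqnn N) (G := fun r => \sum_l z l r w ^+ p)
    (fun r => sumr_ge0 _ (fun l _ => p0 _))
    (fun i r iN ri => eq_bigr _ (fun l _ => congr1 (@GRing.exp R ^~ p) (zs i l r w iN ri))).
  have [_ -> _] := gr => ->; over.
have D0 i : (i < N)%N -> 0 <= tau i.+1 - tau i.
  by move=> iN; have [_ _ /(_ i iN)] := gr => /ltW; rewrite subr_ge0.
under eq_integral do rewrite -sumEFin.
rewrite ge0_integral_sum//; last 2 first.
- move=> i; apply: measurable_EFin_fun; apply: measurable_funM => //.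
  by apply: measurable_sum => l; apply: measurable_funX; exact: mzi (ltn_ord i).
- by move=> i w _; rewrite lee_fin mulr_ge0 ?D0 ?sumr_ge0.
rewrite -sumEFin; apply: lee_sum => i _.
under [leRHS]eq_integral do rewrite EFinM.
rewrite ge0_integralZl//; last 3 first.
- apply: measurable_EFin_fun.
  by apply: measurable_sum => l; apply: measurable_funX; exact: mzi (ltn_ord i).
- by move=> w _; rewrite lee_fin sumr_ge0.
- by rewrite lee_fin D0.
rewrite EFinM lee_wpmul2l ?lee_fin ?D0//.
under [leRHS]eq_integral do rewrite -sumEFin.
rewrite ge0_integral_sum//.
- by rewrite -sumEFin; apply: lee_sum => l _; rewrite fineK ?Ifin.
- by move=> l; apply: measurable_EFin_fun; apply: measurable_funX; exact: mzi (ltn_ord i).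
- by move=> l w _; rewrite lee_fin.
Qed.

Lemma simple_sum_E2 tau N s z c : is_grid tau N s -> s <= T ->
  stepwise tau N z -> (forall l, joint_measurable s (z l)) ->
  process_le P s (fun r w => \sum_l z l r w ^+ 2) c ->
  E_le (fun w => simple_sum W tau N z w ^+ 2) (65 * m%:R * c).
Proof.
move=> gr sT zst mz zc.
have [v zv vc] := grid_process_le (p := 2) isT gr sT zst mz zc.
have := simple_sum_moment2 Pcomplete Wbm X0cst gr sT zst zv (leqnn N).
by apply: int_le_wk; apply: ler_wpM2l => //; nonneg.
Qed.

Definition moment4_const : R := expR (@moment4_rate R m T * T) * @moment4_rate R m T.

Lemma moment4_rate_ge0 : 0 <= T -> 0 <= @moment4_rate R m T.
Proof. by move=> T0; rewrite /moment4_rate; nonneg. Qed.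

Lemma moment4_const_ge0 : 0 <= T -> 0 <= moment4_const.
Proof.
by move=> /moment4_rate_ge0 h; rewrite /moment4_const; nonneg.
Qed.

Lemma simple_sum_E4 tau N s z c : is_grid tau N s -> s <= T ->
  stepwise tau N z -> (forall l, joint_measurable s (z l)) ->
  process_le P s (fun r w => \sum_l z l r w ^+ 4) c ->
  E_le (fun w => simple_sum W tau N z w ^+ 4) (moment4_const * c).
Proof.
move=> gr sT zst mz zc; have [g0 gN gl] := gr.
have s0 : 0 <= s by rewrite -gN; apply: (grid_ge0 gr).
have T0 : 0 <= T by exact: le_trans sT.
have A0 := moment4_rate_ge0 T0.
have [v zv vc] := grid_process_le (p := 4) isT gr sT zst mz zc.
have := simple_sum_moment4 Pcomplete Wbm X0cst gr sT zst zv (leqnn N).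
have c0 : 0 <= c by apply: (int_le_ge0 _ zc) => x _; nonneg.
apply: int_le_wk; rewrite gN /moment4_const -[leRHS]mulrA.
apply: ler_pM; [nonneg| |by rewrite ler_expR ler_wpM2l|exact: ler_wpM2l].
apply: mulr_ge0 => //; apply: sumr_ge0 => i _; apply: mulr_ge0.
  by rewrite subr_ge0 ltW// gl.
apply: sumr_ge0 => l _; apply: (int_le_ge0 _ (zv i l (ltn_ord i))) => w _; nonneg.
Qed.

End simple_estimates.

(** * Grids through given points, and the Euclidean norm of matrices *)

Section grids.
Context {R : realType}.
Implicit Types (tau : nat -> R) (N : nat) (s p q r : R) (Q : seq R).

Definition grid_through tau N Q :=
  forall q, q \in Q -> exists2 i, (i <= N)%N & tau i = q.

(** Sorting the given points together with the end points. *)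
Lemma grid_exists s Q : 0 <= s -> (forall q, q \in Q -> 0 <= q <= s) ->
  exists tau N, is_grid tau N s /\ grid_through tau N Q.
Proof.
move=> s0 Qs; pose L := sort <=%R (undup (0 :: s :: Q)).
have L_sorted : sorted <%R L by rewrite sort_lt_sorted undup_uniq.
have memL q : (q \in L) = (q \in 0 :: s :: Q) by rewrite mem_sort mem_undup.
have Ls q : q \in L -> 0 <= q <= s.
  by rewrite memL !inE => /orP[/eqP->|/orP[/eqP->|/Qs//]]; rewrite lexx s0.
have L0 : (0 < size L)%N.
  by case: L memL {L_sorted Ls} => // /(_ 0); rewrite !inE eqxx.
have lt_nth i j : (i < j < size L)%N -> nth 0 L i < nth 0 L j.
  move=> /andP[ij jL]; rewrite (sorted_ltn_nth lt_trans)// ?inE//.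
  exact: ltn_trans jL.
have inL q : q \in 0 :: s :: Q -> exists2 i, (i <= (size L).-1)%N & nth 0 L i = q.
  rewrite -memL => qL; exists (index q L); last by rewrite nth_index.
  by rewrite -ltnS prednK// index_mem.
have lastL : ((size L).-1 < size L)%N by rewrite prednK.
exists (nth 0 L), (size L).-1; split; last first.
  by move=> q qQ; apply: inL; rewrite !inE qQ !orbT.
split.
- have [|[|i] iL Li] := inL 0; first by rewrite inE eqxx.
    exact: Li.
  have /andP[h _] := Ls _ (mem_nth 0 L0).
  have : nth 0 L 0 < nth 0 L i.+1 by apply: lt_nth; rewrite /= -(prednK L0) ltnS.
  by rewrite Li => /(le_lt_trans h); rewrite ltxx.
- have [|i iL Li] := inL s; first by rewrite !inE eqxx orbT.
  move: iL; rewrite leq_eqVlt => /orP[/eqP <-//|iL].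
  have : nth 0 L i < nth 0 L (size L).-1 by apply: lt_nth; rewrite iL.
  have /andP[_ h] := Ls _ (mem_nth 0 lastL).
  by rewrite Li => /lt_le_trans => /(_ _ h); rewrite ltxx.
- by move=> i iL; apply: lt_nth; rewrite ltnSn/= -(prednK L0) ltnS.
Qed.

Lemma grid_point_side tau N s k i : is_grid tau N s -> (k <= N)%N ->
  (i < N)%N -> tau k <= tau i \/ tau i.+1 <= tau k.
Proof.
move=> gr kN iN; have [ki|ik] := leqP k i; [left|right]; apply: (grid_le gr) => //.
exact: ltnW.
Qed.

(** The sum telescopes for [f] frozen outside the interval. *)
Lemma telescope_grid tau N s (f : R -> R) k k' : is_grid tau N s ->
  (k <= N)%N -> (k' <= N)%N -> tau k <= tau k' ->
  \sum_(i < N) (\1_`]tau k, tau k'] (tau i.+1) : R) * (f (tau i.+1) - f (tau i))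
  = f (tau k') - f (tau k).
Proof.
move=> gr kN k'N kk'; pose g x := f (Num.min (Num.max x (tau k)) (tau k')).
transitivity (\sum_(i < N) (g (tau i.+1) - g (tau i))).
  apply: eq_bigr => -[i iN] _ /=; rewrite indicE.
  have lti : tau i < tau i.+1 by have [_ _] := gr; exact.
  have [ki|ik] := grid_point_side gr kN iN; last first.
    rewrite memNset /=; last by rewrite in_itv/= ltNge ik.
    rewrite mul0r /g max_r// max_r ?subrr//.
    exact: le_trans (ltW lti) ik.
  have ki1 : tau k <= tau i.+1 by rewrite (le_trans ki) ?ltW.
  have [k'i|ik'] := grid_point_side gr k'N iN; last first.
    rewrite mem_set /=; last by rewrite in_itv/= ik' (le_lt_trans ki).
    rewrite mul1r /g !max_l// min_l// min_l//.
    exact: le_trans (ltW lti) ik'.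
  rewrite memNset /=; last first.
    by rewrite in_itv/= => /andP[_ /(lt_le_trans lti)]; rewrite ltNge k'i.
  rewrite mul0r /g !max_l// min_r; last by rewrite (le_trans k'i) ?ltW.
  by rewrite min_r ?subrr.
rewrite -(big_mkord xpredT (fun i => g (tau i.+1) - g (tau i))) telescope_sumr//.
have [t0 tN _] := gr.
rewrite /g max_l ?(grid_le gr)// min_r ?(grid_le gr)//.
by rewrite max_r ?(grid_le gr)// min_l.
Qed.

End grids.

Lemma enorm_sqr (R : realType) p q (A : 'M[R]_(p, q)) :
  enorm A ^+ 2 = \sum_i \sum_j A i j ^+ 2.
Proof. by rewrite /enorm sqr_sqrtr//; nonneg. Qed.

Lemma enorm_ge0 (R : realType) p q (A : 'M[R]_(p, q)) : 0 <= enorm A.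
Proof. exact: sqrtr_ge0. Qed.

Lemma entry_le_enorm (R : realType) p q (A : 'M[R]_(p, q)) i j :
  `|A i j| <= enorm A.
Proof.
rewrite -[leLHS]sqrtr_sqr /enorm ler_wsqrtr// (bigD1 i)//= (bigD1 j)//=.
by rewrite -addrA lerDl; apply: addr_ge0; nonneg.
Qed.

(** * Elementary integrals and the components of Ito integrals *)

Section elementary_integrals.
Context {R : realType} {dO : measure_display} {Omega : measurableType dO}.
Context (P : probability Omega R) {d m : nat}.
Variables (T : R) (W : R -> Omega -> 'cV[R]_m) (X0 : Omega -> 'cV[R]_d).
Hypothesis Pcomplete : measure_is_complete P.
Hypothesis Wbm : brownian_motion P T W.
Hypothesis X0cst : exists x0, X0 = cst x0.
Implicit Types (tau : nat -> R) (n N : nat) (z h : 'I_m -> R -> Omega -> R).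
Implicit Types (I j : Omega -> R).

Local Notation E_le := (int_le P setT).
Local Notation stepwise := (stepwise P W X0).

(** Quantifying over all grids through finitely many points makes elementary
    integrands with different partitions directly comparable. *)
Definition elementary s z j := exists2 Q : seq R,
  forall q, q \in Q -> 0 <= q <= s &
  forall tau N, is_grid tau N s -> grid_through tau N Q ->
    stepwise tau N z /\ simple_sum W tau N z =1 j.

Lemma simple_sum_lin tau N z1 z2 (a b : R) w :
  simple_sum W tau N (fun l r w => a * z1 l r w + b * z2 l r w) w =
  a * simple_sum W tau N z1 w + b * simple_sum W tau N z2 w.
Proof.
rewrite /simple_sum !mulr_sumr -big_split/=; apply: eq_bigr => i _.
rewrite !mulr_sumr -big_split/=; apply: eq_bigr => l _.
by rewrite !mulrA -mulrDl.
Qed.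

Lemma stepwise_lin tau N z1 z2 (a b : R) : stepwise tau N z1 ->
  stepwise tau N z2 ->
  stepwise tau N (fun l r w => a * z1 l r w + b * z2 l r w).
Proof.
move=> [F1 s1 [K1 b1]] [F2 s2 [K2 b2]]; split.
- move=> i l iN; apply: measurable_funD; apply: measurable_funM => //.
    exact: F1.
  exact: F2.
- by move=> i l r w iN ri; rewrite (s1 i l r w iN ri) (s2 i l r w iN ri).
- exists (`|a| * K1 + `|b| * K2) => i l w iN.
  by rewrite (le_trans (ler_normD _ _))// !normrM lerD// ler_wpM2l ?b1 ?b2.
Qed.

Lemma stepwise_comp tau N z (phi : R -> R) (K : R) : stepwise tau N z ->
  measurable_fun setT phi -> (forall x, `|phi x| <= K) ->
  stepwise tau N (fun l r w => phi (z l r w)).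
Proof.
move=> [F1 s1 _] mphi phiK; split.
- by move=> i l iN; apply: measurableT_comp => //; exact: F1.
- by move=> i l r w iN ri; rewrite (s1 i l r w iN ri).
- by exists K.
Qed.

Lemma elementary_grid s z j : 0 <= s -> elementary s z j ->
  exists tau N, [/\ is_grid tau N s, stepwise tau N z & simple_sum W tau N z = j].
Proof.
move=> s0 [Q Qs el]; have [tau [N [gr tQ]]] := grid_exists s0 Qs.
have [st sj] := el tau N gr tQ; exists tau, N; split => //.
exact/funext.
Qed.

Lemma elementary_measurable s z j : 0 <= s -> s <= T -> elementary s z j ->
  measurable_fun setT j.
Proof.
move=> s0 sT /(elementary_grid s0)[tau [N [gr st <-]]].
exact: (measurable_simple_sum Pcomplete Wbm X0cst gr sT st (leqnn N)).
Qed.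

Lemma elementary_lin s z1 z2 j1 j2 (a b : R) :
  elementary s z1 j1 -> elementary s z2 j2 ->
  elementary s (fun l r w => a * z1 l r w + b * z2 l r w)
    (fun w => a * j1 w + b * j2 w).
Proof.
move=> [Q1 Qs1 e1] [Q2 Qs2 e2]; exists (Q1 ++ Q2).
  by move=> q; rewrite mem_cat => /orP[/Qs1|/Qs2].
move=> tau N gr tQ.
have [st1 i1] : stepwise tau N z1 /\ simple_sum W tau N z1 =1 j1.
  by apply: e1 => // q qQ; apply: tQ; rewrite mem_cat qQ.
have [st2 i2] : stepwise tau N z2 /\ simple_sum W tau N z2 =1 j2.
  by apply: e2 => // q qQ; apply: tQ; rewrite mem_cat qQ orbT.
split; first exact: stepwise_lin.
by move=> w; rewrite simple_sum_lin i1 i2.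
Qed.

Section simple_process_is_elementary.
Variables (s : R) (Z : simple_process (R := R) (Omega := Omega) (d := d) (m := m)).
Hypotheses (s0 : 0 <= s) (sT : s <= T) (Zs : is_simple P W X0 0 s Z).
Variable a : 'I_d.

Let n := sp_size Z.
Let t := sp_time Z.

Let t_le i k : (i <= k)%N -> (k <= n)%N -> t i <= t k.
Proof.
have [_ _ tS _ _] := Zs; elim: k => [|k ih]; first by rewrite leqn0 => /eqP ->.
rewrite leq_eqVlt => /orP[/eqP ->//|ik kn].
by apply: le_trans (tS k kn); apply: ih => //; exact: ltnW.
Qed.

Let t_s k : (k <= n)%N -> 0 <= t k <= s.
Proof.
by move=> kn; have [<- <- _ _ _] := Zs; rewrite !t_le.
Qed.

Let coefE l r w : sp_value Z r w a l =
  \sum_(k < n) (\1_`]t k, t k.+1] r : R) * sp_coef Z k w a l.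
Proof. by rewrite /sp_value summxE; apply: eq_bigr => k _; rewrite mxE. Qed.

Let Fcoef k l : (k < n)%N -> F_measurable P W X0 (t k) (fun w => sp_coef Z k w a l).
Proof.
move=> kn; have [_ _ _ mc _] := Zs.
by apply: (@borel_entry_measurable R _ (g_sigma_algebraType (filtration_generators P W X0 (t k)))); exact: mc.
Qed.

Lemma sp_joint_measurable l : joint_measurable s (fun r w => sp_value Z r w a l).
Proof.
rewrite /joint_measurable; under eq_fun do rewrite coefE.
apply: measurable_sum => k; apply: measurable_funTS; apply: measurable_funM.
  apply: (@measurableT_comp _ _ _ _ _ _ (\1_`]t k, t k.+1] : measurableTypeR R -> R) _ fst).
    exact: measurable_indic.
  exact: measurable_fst.
apply: (@measurableT_comp _ _ _ _ _ _ (fun w => sp_coef Z k w a l) _ snd).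
  apply: (F_measurable_sub Pcomplete Wbm X0cst _ (Fcoef l (ltn_ord k))).
  by apply: le_trans sT; have /andP[] := t_s (ltnW (ltn_ord k)).
exact: measurable_snd.
Qed.

(** On a grid that refines the times of [Z] each step lies in at most one step
    of [Z], and the increments over a step of [Z] telescope. *)
Lemma sp_elementary : elementary s (fun l r w => sp_value Z r w a l)
  (fun w => sp_integral W Z w a 0).
Proof.
have [t0 tn tS mc [C ZC]] := Zs.
exists [seq t k | k <- iota 0 n.+1].
  by move=> q /mapP[k]; rewrite mem_iota /= ltnS => kn ->; exact: t_s.
move=> tau N gr tQ.
have tau_t k : (k <= n)%N -> exists2 i, (i <= N)%N & tau i = t k.
  by move=> kn; apply: tQ; apply/mapP; exists k => //; rewrite mem_iota ltnS.
have tau_lt i : (i < N)%N -> tau i < tau i.+1 by have [_ _] := gr; exact.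
have side k i : (k <= n)%N -> (i < N)%N -> t k <= tau i \/ tau i.+1 <= t k.
  by move=> kn iN; have [k' k'N <-] := tau_t k kn; apply: (grid_point_side gr).
split; first split.
- move=> i l iN; rewrite /F_measurable; under eq_fun do rewrite coefE.
  apply: measurable_sum => -[k kn] /=; rewrite indicE.
  have [tk|_] := boolP (_ \in _); last first.
    by under eq_fun do rewrite mul0r; exact: measurable_cst.
  under eq_fun do rewrite mul1r.
  have [tki|] := side k i (ltnW kn) iN.
    exact: (F_measurable_mono tki (Fcoef l kn)).
  by move: tk; rewrite inE/= in_itv/= => /andP[/lt_geF ->].
- move=> i l r w iN /andP[ri ri1]; rewrite !coefE; apply: eq_bigr => -[k kn] _ /=.
  rewrite !indicE; congr ((_ : bool)%:R * _).
  have -> : (r \in `]t k, t k.+1]%classic) = (t k < r <= t k.+1).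
    by apply/idP/idP; rewrite inE/= in_itv.
  have -> : (tau i.+1 \in `]t k, t k.+1]%classic) = (t k < tau i.+1 <= t k.+1).
    by apply/idP/idP; rewrite inE/= in_itv.
  congr (_ && _).
    have [h|h] := side k i (ltnW kn) iN.
      by rewrite (le_lt_trans h ri) (le_lt_trans h (tau_lt i iN)).
    by rewrite !ltNge h (le_trans ri1 h).
  have [h|h] := side k.+1 i kn iN; last by rewrite h (le_trans ri1 h).
  by rewrite !leNgt (le_lt_trans h ri) (le_lt_trans h (tau_lt i iN)).
- exists (\sum_(k < n) C) => i l w iN; rewrite coefE.
  apply: le_trans (ler_norm_sum _ _ _) _; apply: ler_sum => -[k kn] _ /=.
  have hC : `|sp_coef Z k w a l| <= C.
    exact: le_trans (entry_le_enorm _ _ _) (ZC k w kn).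
  rewrite indicE normrM; case: (_ \in _); rewrite ?normr1 ?mul1r//.
  by rewrite normr0 mul0r (le_trans _ hC).
move=> w; rewrite /simple_sum /sp_integral summxE.
under eq_bigr => i _.
  under eq_bigr => l _ do rewrite coefE mulr_suml.
  over.
under eq_bigr => i _ do rewrite exchange_big/=.
rewrite exchange_big/=; apply: eq_bigr => -[k kn] _ /=.
rewrite exchange_big/= mxE; apply: eq_bigr => l _; rewrite !mxE.
have [i0 i0N e0] := tau_t k (ltnW kn); have [i1 i1N e1] := tau_t k.+1 kn.
have le01 : tau i0 <= tau i1 by rewrite e0 e1; exact: tS.
have := telescope_grid (fun r => W r w l 0) gr i0N i1N le01.
rewrite /= e0 e1 => TG.
transitivity (sp_coef Z k w a l * (W (t k.+1) w l 0 - W (t k) w l 0)); last by [].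
rewrite -TG mulr_sumr; apply: eq_bigr => i _.
by rewrite /incr mulrAC mulrC.
Qed.

End simple_process_is_elementary.

Definition sqdist (z h : 'I_m -> R -> Omega -> R) r w :=
  \sum_l (z l r w - h l r w) ^+ 2.

(** One component of an Ito integral over [0, s]. Approximations up to each
    error [e] are stable under linear combinations without any matching of
    sequences or partitions. *)
Definition ito_pair s h I :=
  [/\ forall l, joint_measurable s (h l), measurable_fun setT I &
      forall e, 0 < e -> exists z j, [/\ elementary s z j,
        forall l, joint_measurable s (z l),
        measurable_fun setT j,
        process_le P s (sqdist z h) e &
        E_le (fun w => (j w - I w) ^+ 2) e]].

Lemma measurable_sqdist s z h : (forall l, joint_measurable s (z l)) ->
  (forall l, joint_measurable s (h l)) -> joint_measurable s (sqdist z h).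
Proof.
move=> mz mh; apply: measurable_sum => l; apply: measurable_funX.
by apply: measurable_funB; [exact: mz|exact: mh].
Qed.

Lemma ito_pair_lin s h1 h2 I1 I2 (a b : R) :
  ito_pair s h1 I1 -> ito_pair s h2 I2 ->
  ito_pair s (fun l r w => a * h1 l r w + b * h2 l r w)
    (fun w => a * I1 w + b * I2 w).
Proof.
move=> [mh1 mI1 H1] [mh2 mI2 H2]; split.
- move=> l; apply: measurable_funD; apply: measurable_funM => //.
    exact: mh1.
  exact: mh2.
- by apply: measurable_funD; apply: measurable_funM.
move=> e e0; pose K := 2 * a ^+ 2 + 2 * b ^+ 2 + 1.
have K0 : 0 < K by rewrite ltr_wpDl//; nonneg.
have eK0 : 0 < e / K by rewrite divr_gt0.
have [z1 [j1 [el1 mz1 mj1 zh1 jI1]]] := H1 _ eK0.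
have [z2 [j2 [el2 mz2 mj2 zh2 jI2]]] := H2 _ eK0.
have ab (x y : R) : 0 <= (a * x + b * y) ^+ 2 <= (2 * a ^+ 2) * x ^+ 2 + (2 * b ^+ 2) * y ^+ 2.
  by rewrite sqr_ge0/=; have := sqr_ge0 (a * x - b * y); nra.
have Ke : 2 * a ^+ 2 * (e / K) + 2 * b ^+ 2 * (e / K) <= e.
  have : K * (e / K) = e by field; rewrite gt_eqF.
  by move: eK0; rewrite /K; move: (e / _) => x x0; lra.
exists (fun l r w => a * z1 l r w + b * z2 l r w), (fun w => a * j1 w + b * j2 w).
split.
- exact: elementary_lin.
- move=> l; apply: measurable_funD; apply: measurable_funM => //.
    exact: mz1.
  exact: mz2.
- by apply: measurable_funD; apply: measurable_funM.
- have ms1 := measurable_sqdist mz1 mh1; have ms2 := measurable_sqdist mz2 mh2.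
  have sq0 z h r w : 0 <= sqdist z h r w by rewrite /sqdist; nonneg.
  apply: (process_le_wk Ke).
  apply: (int_le_lin2 (measurable_slab s) ms1 ms2); [|by move=> *; exact: sq0|nonneg|nonneg| |exact: zh1|exact: zh2].
    by move=> *; exact: sq0.
  move=> [r w] _ /=; rewrite sq0 /sqdist !mulr_sumr -big_split/=.
  apply: ler_sum => l _.
  have := ab (z1 l r w - h1 l r w) (z2 l r w - h2 l r w).
  rewrite (_ : a * (z1 l r w - h1 l r w) + _ = a * z1 l r w + b * z2 l r w - (a * h1 l r w + b * h2 l r w)); last by ring.
  by case/andP.
- have m1 : measurable_fun setT (fun w => (j1 w - I1 w) ^+ 2).
    by apply: measurable_funX; exact: measurable_funB.
  have m2 : measurable_fun setT (fun w => (j2 w - I2 w) ^+ 2).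
    by apply: measurable_funX; exact: measurable_funB.
  apply: (int_le_wk Ke).
  apply: (int_le_lin2 measurableT m1 m2); [|by move=> *; nonneg|nonneg|nonneg| |exact: jI1|exact: jI2].
    by move=> *; nonneg.
  move=> w _; have := ab (j1 w - I1 w) (j2 w - I2 w).
  by rewrite (_ : a * (j1 w - I1 w) + _ = a * j1 w + b * j2 w - (a * I1 w + b * I2 w)) //; ring.
Qed.

End elementary_integrals.

(** * Second and fourth moments of Ito integrals *)

Section clamp.
Context {R : realType}.
Implicit Types x y K : R.

Definition clamp K x := Num.max (- K) (Num.min x K).

Lemma norm_clamp_le K x : 0 <= K -> `|clamp K x| <= K.
Proof.
move=> K0; rewrite /clamp ler_norml le_max lexx/= ge_max ge_min lexx orbT andbT.
by rewrite lerNl (le_trans _ K0)// oppr_le0.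
Qed.

Lemma measurable_clamp K : measurable_fun setT (clamp K).
Proof. by apply: measurable_maxr => //; exact: measurable_minr. Qed.

Let clampE K x : 0 <= K ->
  clamp K x = if x <= - K then - K else if x <= K then x else K.
Proof.
move=> K0; rewrite /clamp; case: ifPn => [xK|].
  by rewrite min_l ?max_l//; lra.
rewrite -ltNge => xK; case: ifPn => [xK'|]; first by rewrite min_l// max_r// ltW.
rewrite -ltNge => xK'; rewrite min_r ?(ltW xK')// max_r//; lra.
Qed.

(** Truncation is the projection on [- K, K]. *)
Lemma sqr_subr_clamp K x y : `|y| <= K -> (x - clamp K x) ^+ 2 <= (x - y) ^+ 2.
Proof.
move=> yK; have K0 : 0 <= K by exact: le_trans yK.
move: yK; rewrite ler_norml => /andP[y1 y2].
rewrite clampE//; case: (lerP x (- K)) => xK.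
  have p1 : 0 <= (y + K) * (- K - x) by apply: mulr_ge0; lra.
  by have := sqr_ge0 (y + K); lra.
case: (lerP x K) => xK'; first by rewrite subrr expr0n sqr_ge0.
have p1 : 0 <= (K - y) * (x - K) by apply: mulr_ge0; lra.
by have := sqr_ge0 (K - y); lra.
Qed.

(** Both arguments lie in [- K, K], and truncation is a contraction that fixes
    [y]. *)
Lemma pow4_clampB K x y : `|y| <= K ->
  (clamp K x - y) ^+ 4 <= 4 * K ^+ 2 * (x - y) ^+ 2.
Proof.
move=> yK; have K0 : 0 <= K by exact: le_trans yK.
have cK := norm_clamp_le x K0.
have h1 : (clamp K x - y) ^+ 2 <= (x - y) ^+ 2.
  move: yK; rewrite ler_norml => /andP[y1 y2].
  rewrite clampE//; case: (lerP x (- K)) => xK.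
    have p1 : 0 <= (y + K) * (- K - x) by apply: mulr_ge0; lra.
    by have := sqr_ge0 (x + K); lra.
  case: (lerP x K) => xK' //.
  have p1 : 0 <= (K - y) * (x - K) by apply: mulr_ge0; lra.
  by have := sqr_ge0 (x - K); lra.
have h2 : (clamp K x - y) ^+ 2 <= 4 * K ^+ 2.
  by move: cK yK; rewrite !ler_norml => /andP[? ?] /andP[? ?]; nra.
by rewrite (exprM _ 2 2) expr2 ler_pM ?sqr_ge0.
Qed.

End clamp.

Section ito_moments.
Context {R : realType} {dO : measure_display} {Omega : measurableType dO}.
Context (P : probability Omega R) {d m : nat}.
Variables (T : R) (W : R -> Omega -> 'cV[R]_m) (X0 : Omega -> 'cV[R]_d).
Hypothesis Pcomplete : measure_is_complete P.
Hypothesis Wbm : brownian_motion P T W.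
Hypothesis X0cst : exists x0, X0 = cst x0.
Implicit Types (z h : 'I_m -> R -> Omega -> R) (I j : Omega -> R).

Local Notation E_le := (int_le P setT).
Local Notation ito_pair := (ito_pair P W X0).

Let cvg0_eventually (u : nat -> \bar R) e : 0 < e -> u n @[n --> \oo] --> 0%E ->
  \forall n \near \oo, (u n <= e%:E)%E.
Proof.
move=> e0 /fine_cvgP[ufin /cvgr_lt/(_ e e0) ue].
by near=> n; rewrite -(@fineK _ (u n)) ?lee_fin ?ltW//; near: n.
Unshelve. all: by end_near. Qed.

Lemma ito_integral_pair s (Hs : R -> Omega -> 'M[R]_(d, m)) (I : Omega -> 'cV[R]_d)
    (a : 'I_d) : 0 <= s -> s <= T -> ito_integral P W X0 0 s Hs I ->
  ito_pair s (fun l r w => Hs r w a l) (fun w => I w a 0).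
Proof.
move=> s0 sT [_ jH mI [Z [Zs Z1 Z2]]].
have mH l : joint_measurable s (fun r w => Hs r w a l).
  exact: borel_entry_measurable.
have mIa : measurable_fun setT (fun w => I w a 0) by exact: borel_entry_measurable.
split => // e e0.
have [n [n1 n2]] : exists n,
    (\int[P]_w \int[lebesgue_measure]_(r in `[0%R, s])
      ((enorm (sp_value (Z n) r w - Hs r w)) ^+ 2)%:E <= e%:E)%E /\
    (\int[P]_w ((enorm (sp_integral W (Z n) w - I w)) ^+ 2)%:E <= e%:E)%E.
  near \oo => n; exists n; split; near: n; exact: cvg0_eventually.
have mz l := sp_joint_measurable Pcomplete Wbm X0cst sT (Zs n) a l.
have el := sp_elementary (Zs n) a.
exists (fun l r w => sp_value (Z n) r w a l), (fun w => sp_integral W (Z n) w a 0).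
split => //.
- exact: (elementary_measurable Pcomplete Wbm X0cst s0 sT el).
- rewrite /process_le /int_le slab_integral21; last 2 first.
  + exact: measurable_sqdist.
  + by move=> r w _; rewrite /sqdist; nonneg.
  apply: le_trans n1; apply: le_integral_ge0 => w _; apply/andP; split.
    by apply: integral_ge0 => r _; rewrite lee_fin /sqdist; nonneg.
  apply: le_integral_ge0 => r _; rewrite !lee_fin /sqdist; apply/andP; split.
    by nonneg.
  rewrite enorm_sqr [leRHS](bigD1 a)//= -[leLHS]addr0 lerD//; last by nonneg.
  by apply: ler_sum => l _; rewrite !mxE.
- apply: le_trans n2; apply: le_integral_ge0 => w _; rewrite !lee_fin sqr_ge0/=.
  rewrite enorm_sqr (bigD1 a)//= (bigD1 ord0)//= !mxE -addrA lerDl.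
  by apply: addr_ge0; nonneg.
Unshelve. all: by end_near. Qed.

Section moment_bounds.
Variables (s : R) (h : 'I_m -> R -> Omega -> R) (I : Omega -> R).
Hypotheses (s0 : 0 <= s) (sT : s <= T) (hI : ito_pair s h I).

Let T0 : 0 <= T. Proof. exact: le_trans sT. Qed.

(** The bound 65 m of simple sums passes to the limit; comparing the integrand
    and the integral with their approximations costs a factor 2 each. *)
Lemma ito_moment2 c : process_le P s (fun r w => \sum_l h l r w ^+ 2) c ->
  E_le (fun w => I w ^+ 2) (260 * m%:R * c).
Proof.
move=> hc; have [mh mI HI] := hI.
apply: (@int_le_lim _ _ _ _ _ _ _ (260 * m%:R + 2)); first by apply: ltr_wpDl; nonneg.
move=> e e0; have [z [j [el mz mj zh jI]]] := HI e e0.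
have [tau [N [gr st jE]]] := elementary_grid s0 el.
have mh2 : joint_measurable s (fun r w => \sum_l h l r w ^+ 2).
  by apply: measurable_sum => l; apply: measurable_funX; exact: mh.
have zc : process_le P s (fun r w => \sum_l z l r w ^+ 2) (2 * c + 2 * e).
  have msq : joint_measurable s (sqdist z h) by exact: measurable_sqdist.
  apply: (int_le_lin2 (measurable_slab s) mh2 msq); [|by move=> *; rewrite /sqdist; nonneg|by []|by []| |exact: hc|exact: zh].
    by move=> *; nonneg.
  move=> [r w] _ /=; apply/andP; split; first by nonneg.
  rewrite /sqdist !mulr_sumr -big_split/=; apply: ler_sum => l _.
  by have := sqr_ge0 (z l r w - 2 * h l r w); nra.
have := simple_sum_E2 Pcomplete Wbm X0cst gr sT st mz zc; rewrite jE => j2.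
rewrite (_ : 260 * _ * c + _ = 2 * (65 * m%:R * (2 * c + 2 * e)) + 2 * e); last by ring.
have mj2 : measurable_fun setT (fun w => j w ^+ 2) by exact: measurable_funX.
have mjI : measurable_fun setT (fun w => (j w - I w) ^+ 2).
  by apply: measurable_funX; exact: measurable_funB.
apply: (int_le_lin2 measurableT mj2 mjI); [|by move=> *; nonneg|by []|by []| |exact: j2|exact: jI].
  by move=> *; nonneg.
by move=> w _; rewrite sqr_ge0/=; have := sqr_ge0 (2 * j w - I w); nra.
Qed.

Section moment4.
Variables (K c : R).
Hypothesis hK : forall l r w, 0 <= r <= s -> `|h l r w| <= K.
Hypothesis hc : process_le P s (fun r w => \sum_l h l r w ^+ 4) c.

Let C4 := @moment4_const R m T.

Let C40 : 0 <= C4. Proof. exact: moment4_const_ge0. Qed.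

(** The fourth moment passes to the limit along elementary integrands that are
    truncated at the bound of [h]; L^2 convergence of their integrals suffices
    once [I] itself is truncated at an arbitrary level. *)
Let ito_truncated_moment4 (y : R) : 0 <= K -> 0 <= y ->
  E_le (fun w => Num.min `|I w| y ^+ 4) (64 * C4 * c).
Proof.
move=> K0 y0; have [mh mI HI] := hI.
pose k := 256 * C4 * K ^+ 2 + 8 * y ^+ 2 * (2 + 2 * (65 * m%:R)) + 1.
have k0 : 0 < k by apply: ltr_wpDl ltr01; nonneg.
apply: (int_le_lim k0) => e e0; have [z [j [el mz mj zh jI]]] := HI e e0.
have [tau [N [gr st jE]]] := elementary_grid s0 el.
pose z' l r w := clamp K (z l r w).
have st' : stepwise P W X0 tau N z'.
  by apply: (stepwise_comp st (measurable_clamp K)) => x; exact: norm_clamp_le.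
have mz' l : joint_measurable s (z' l).
  by apply: measurableT_comp; [exact: measurable_clamp|exact: mz].
pose j' w := simple_sum W tau N z' w.
have mj' : measurable_fun setT j'.
  exact: (measurable_simple_sum Pcomplete Wbm X0cst gr sT st' (leqnn N)).
have mh4 : joint_measurable s (fun r w => \sum_l h l r w ^+ 4).
  by apply: measurable_sum => l; apply: measurable_funX; exact: mh.
have sq0 r w : 0 <= sqdist z h r w by rewrite /sqdist; nonneg.
have msq := measurable_sqdist mz mh.
have z'c : process_le P s (fun r w => \sum_l z' l r w ^+ 4)
    (8 * c + 32 * K ^+ 2 * e).
  apply: (int_le_lin2 (measurable_slab s) mh4 msq); [|by move=> *; exact: sq0|by []|nonneg| |exact: hc|exact: zh].
    by move=> *; nonneg.
  move=> [r w] [/=]; rewrite in_itv/= => rs _; apply/andP; split; first by nonneg.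
  rewrite /sqdist !mulr_sumr -big_split/=; apply: ler_sum => l _.
  have := pow4_clampB (z l r w) (hK l w rs); rewrite -/(z' l r w) => h4.
  have := pow4D_le (h l r w) (z' l r w - h l r w).
  rewrite [_ + (_ - _)]addrC subrK => /le_trans; apply; rewrite lerD2l.
  have -> : 32 * K ^+ 2 * (z l r w - h l r w) ^+ 2 =
    8 * (4 * K ^+ 2 * (z l r w - h l r w) ^+ 2) by ring.
  exact: ler_wpM2l.
have zz'c : process_le P s (fun r w => \sum_l (1 * z l r w + (- 1) * z' l r w) ^+ 2) e.
  apply: process_le_mono zh => r w rs; apply/andP; split; first by nonneg.
  apply: ler_sum => l _; rewrite mul1r mulN1r.
  exact: sqr_subr_clamp (hK l w rs).
have mzz' l : joint_measurable s (fun r w => 1 * z l r w + (- 1) * z' l r w).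
  apply: measurable_funD; apply: measurable_funM => //; [exact: mz|exact: mz'].
have j'4 := simple_sum_E4 Pcomplete Wbm X0cst gr sT st' mz' z'c.
have := simple_sum_E2 Pcomplete Wbm X0cst gr sT (stepwise_lin 1 (-1) st st') mzz' zz'c.
rewrite (_ : (fun w => _) = (fun w => (j w - j' w) ^+ 2)); last first.
  by apply/funext => w; rewrite simple_sum_lin jE mul1r mulN1r.
move=> jj'2.
have mjI : measurable_fun setT (fun w => (j w - I w) ^+ 2).
  by apply: measurable_funX; exact: measurable_funB.
have mjj' : measurable_fun setT (fun w => (j w - j' w) ^+ 2).
  by apply: measurable_funX; exact: measurable_funB.
have mj'4 : measurable_fun setT (fun w => j' w ^+ 4) by exact: measurable_funX.
pose F w := 2 * (j w - I w) ^+ 2 + 2 * (j w - j' w) ^+ 2.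
have mF : measurable_fun setT F by apply: measurable_funD; exact: measurable_funM.
have F0 w : 0 <= F w by rewrite /F; nonneg.
have FE : E_le F (2 * e + 2 * (65 * m%:R * e)).
  apply: (int_le_lin2 measurableT mjI mjj'); [|by move=> *; nonneg|by []|by []| |exact: jI|exact: jj'2].
    by move=> *; nonneg.
  by move=> w _; rewrite F0 /=.
apply: (@int_le_wk _ _ _ _ _ _ (8 * (C4 * (8 * c + 32 * K ^+ 2 * e)) +
    8 * y ^+ 2 * (2 * e + 2 * (65 * m%:R * e)))).
  by rewrite /k; lra.
apply: (int_le_lin2 measurableT mj'4 mF); [|by move=> *; exact: F0|by []|nonneg| |exact: j'4|exact: FE].
  by move=> *; nonneg.
move=> w _; apply/andP; split; first by nonneg.
pose v := Num.min `|I w - j' w| y.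
have v0 : 0 <= v by rewrite le_min normr_ge0.
have u0 : 0 <= Num.min `|I w| y by rewrite le_min normr_ge0.
have uv : Num.min `|I w| y <= `|j' w| + v.
  rewrite /v; case: (leP `|I w - j' w| y) => _.
    rewrite ge_min -[in X in X <= _](subrK (j' w) (I w)) addrC.
    by rewrite (le_trans (ler_normD _ _))// lerD.
  by rewrite ge_min [X in _ || X]ler_wpDl ?orbT.
have vI : v ^+ 2 <= (I w - j' w) ^+ 2.
  rewrite -[leRHS]real_normK ?num_real// lerXn2r ?nnegrE ?normr_ge0//.
  by rewrite /v ge_min lexx.
have vy : v ^+ 2 <= y ^+ 2.
  by rewrite lerXn2r ?nnegrE// /v ge_min lexx orbT.
apply: (@le_trans _ _ (8 * `|j' w| ^+ 4 + 8 * v ^+ 4)).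
  by apply: le_trans (pow4D_le _ _); rewrite lerXn2r ?nnegrE// addr_ge0.
rewrite (exprM _ 2 2) real_normK ?num_real// -exprM lerD2l -mulrA.
apply: ler_wpM2l => //; rewrite (exprM v 2 2) expr2.
apply: ler_pM; [nonneg|nonneg|by []|].
apply: (le_trans vI).
by rewrite /F; have := sqr_ge0 ((j w - I w) + (j w - j' w)); nra.
Qed.

(** The truncation of [I] is removed by monotone convergence. *)
Lemma ito_moment4 : 0 <= K -> E_le (fun w => I w ^+ 4) (64 * C4 * c).
Proof.
move=> K0; have [_ mI _] := hI.
pose F n w := (Num.min `|I w| n%:R ^+ 4)%:E.
have mF n : measurable_fun setT (F n).
  apply: measurable_EFin_fun; apply: measurable_funX; apply: measurable_minr => //.
  exact: measurableT_comp.
have FI w : (I w ^+ 4)%:E = limn (F ^~ w).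
  apply/esym/cvg_lim => //; apply: cvg_near_cst.
  exists (Num.truncn `|I w|).+1 => // n /= In; rewrite /F min_l; last first.
    by rewrite ltW// (lt_le_trans (truncnS_gt _))// ler_nat.
  by rewrite (exprM _ 2 2) real_normK ?num_real// -exprM.
rewrite /int_le; under eq_integral do rewrite FI.
rewrite monotone_convergence//.
- apply: lime_le; last by apply: nearW => n; exact: ito_truncated_moment4.
  apply: ereal_nondecreasing_is_cvgn => n n' nn'; apply: le_integral_ge0 => w _.
  rewrite !lee_fin; apply/andP; split; first by nonneg.
  by rewrite lerXn2r ?nnegrE ?le_min ?normr_ge0 ?ler0n// ge_min lexx/= ge_min ler_nat nn' orbT.
- by move=> n w _; rewrite lee_fin; nonneg.
- move=> w _ n n' nn'; rewrite lee_fin.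
  by rewrite lerXn2r ?nnegrE ?le_min ?normr_ge0 ?ler0n// ge_min lexx/= ge_min ler_nat nn' orbT.
Qed.

End moment4.

End moment_bounds.

End ito_moments.

(** * A mean value theorem in several variables *)

Section mean_value.
Context {R : realType} {n : nat}.
Implicit Types (G : 'cV[R]_n -> R) (x y v e : 'cV[R]_n).

Lemma is_derive_line G y v (t : R) : derivable G (y + t *: v) v ->
  is_derive t 1 (fun t => G (y + t *: v)) ('D_v G (y + t *: v)).
Proof.
move=> dG.
have E : (fun h : R => h^-1 *: (((fun t => G (y + t *: v)) \o shift t) (h *: (1 : R)) - G (y + t *: v)))
    = (fun h : R => h^-1 *: ((G \o shift (y + t *: v)) (h *: v) - G (y + t *: v))).
  apply/funext => h /=; congr (_ *: (G _ - _)).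
  by rewrite [h *: 1]mulr1 scalerDl addrCA addrC.
by split; rewrite /derivable /derive E.
Qed.

Lemma coord_mvt G y v (D : R) :
  (forall t, `|t| <= `|D| -> derivable G (y + t *: v) v) ->
  exists2 t, `|t| <= `|D| & G (y + D *: v) - G y = 'D_v G (y + t *: v) * D.
Proof.
move=> dG; pose g t := G (y + t *: v).
have dg (t : R) : `|t| <= `|D| -> is_derive t 1 g ('D_v G (y + t *: v)).
  by move=> tD; apply: is_derive_line; exact: dG.
have cont (a b : R) : (forall t : R, t \in `[a, b] -> `|t| <= `|D|) ->
    {within `[a, b], continuous g}.
  move=> ab; apply: derivable_within_continuous => t tab.
  by have [] := dg _ (ab _ tab).
have g0 : G y = g 0 by rewrite /g scale0r addr0.
have [D0|D0] := leP 0 D.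
- have sub t : t \in `[0, D] -> `|t| <= `|D|.
    by rewrite in_itv/= => /andP[t0 tD]; rewrite !ger0_norm.
  have [|t tD e] := @MVT_segment R g (fun t => 'D_v G (y + t *: v)) 0 D D0 _ (cont _ _ sub).
    by move=> t tD; apply: dg; apply: sub; exact: subset_itv_oo_cc.
  by exists t; [exact: sub|rewrite g0 -[G _]/(g D) e subr0].
- have sub t : t \in `[D, 0] -> `|t| <= `|D|.
    by rewrite in_itv/= => /andP[tD t0]; rewrite !ler0_norm ?lerN2// ltW.
  have [|t tD e] := @MVT_segment R g (fun t => 'D_v G (y + t *: v)) D 0 (ltW D0) _ (cont _ _ sub).
    by move=> t tD; apply: dg; apply: sub; exact: subset_itv_oo_cc.
  by exists t; [exact: sub|rewrite g0 -[G _]/(g D) -opprB e sub0r mulrN opprK].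
Qed.

(** Telescoping over the coordinates: partial derivatives suffice, and the
    intermediate points stay in the box spanned by [e]. *)
Lemma box_mvt G x e :
  (forall y c, (forall c', `|y c' 0 - x c' 0| <= `|e c' 0|) ->
     derivable G y (basis_vec c)) ->
  exists xi : 'I_n -> 'cV[R]_n,
    (forall c c', `|xi c c' 0 - x c' 0| <= `|e c' 0|) /\
    G (x + e) - G x = \sum_c 'D_(basis_vec c) G (xi c) * e c 0.
Proof.
move=> dG; pose p (k : nat) : 'cV[R]_n := \col_c (x c 0 + (c < k)%:R * e c 0).
have p0 : p 0%N = x by apply/colP => c; rewrite mxE ltn0 mul0r addr0.
have pn : p n = x + e by apply/colP => c; rewrite !mxE ltn_ord mul1r.
have pS (c : 'I_n) t c' : (p c + t *: basis_vec c) c' 0 =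
    x c' 0 + (c' < c)%:R * e c' 0 + (c' == c)%:R * t.
  by rewrite !mxE eqxx andbT [t * _]mulrC.
have pS' (c : 'I_n) : p c.+1 = p c + e c 0 *: basis_vec c.
  apply/colP => c'; rewrite pS mxE ltnS leq_eqVlt.
  have [->|cc'] := eqVneq c' c; first by rewrite eqxx ltnn !mul1r mul0r addr0.
  by rewrite -[X in X || _]/(c' == c) (negbTE cc') mul0r addr0.
have step (c : 'I_n) : exists xi : 'cV[R]_n,
    (forall c', `|xi c' 0 - x c' 0| <= `|e c' 0|) /\
    G (p c.+1) - G (p c) = 'D_(basis_vec c) G xi * e c 0.
  have box t : `|t| <= `|e c 0| ->
      forall c', `|(p c + t *: basis_vec c) c' 0 - x c' 0| <= `|e c' 0|.
    move=> te c'; rewrite pS [X in `|X|](_ : _ =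
      (c' < c)%:R * e c' 0 + (c' == c)%:R * t); last by ring.
    have [->|cc'] := eqVneq c' c; first by rewrite ltnn mul0r add0r mul1r.
    by rewrite mul0r addr0; case: (_ < _)%N; rewrite ?mul1r// mul0r normr0.
  have [|t te E] := @coord_mvt G (p c) (basis_vec c) (e c 0).
    by move=> t te; apply: dG; exact: box.
  by exists (p c + t *: basis_vec c); split; [exact: box|rewrite pS'].
have [xi xiP] := choice step; exists xi; split; first by move=> c; have [] := xiP c.
transitivity (\sum_(0 <= i < n) (G (p i.+1) - G (p i))).
  by rewrite (telescope_sumr (fun i => G (p i)))// p0 pn.
rewrite big_mkord.
by apply: eq_bigr => c _; have [_ ->] := xiP c.
Qed.

End mean_value.

Section norms.
Context {R : realType}.

(** The norm that the coordinatewise mean value theorem produces. *)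
Definition norm1 {n} (x : 'cV[R]_n) : R := \sum_c `|x c 0|.

Lemma norm1_ge0 n (x : 'cV[R]_n) : 0 <= norm1 x.
Proof. by rewrite /norm1; nonneg. Qed.

Lemma enorm0 p q : enorm (0 : 'M[R]_(p, q)) = 0.
Proof.
rewrite /enorm big1 ?sqrtr0// => i _; rewrite big1// => j _.
by rewrite mxE expr0n.
Qed.

Lemma enorm_le_norm1 n (x : 'cV[R]_n) : enorm x <= norm1 x.
Proof.
rewrite -[leRHS]ger0_norm ?norm1_ge0// -sqrtr_sqr /enorm ler_wsqrtr//.
under eq_bigr do rewrite big_ord1.
rewrite /norm1 expr2 big_distrlr/=; apply: ler_sum => c _.
rewrite (bigD1 c)//= -expr2 real_normK ?num_real// lerDl.
by nonneg.
Qed.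

Lemma famnorm_entry p q (I : finType) (A : I -> 'M[R]_(p, q)) i a b' :
  `|A i a b'| <= famnorm A.
Proof.
apply: le_trans (entry_le_enorm _ _ _) _.
rewrite -[leLHS]ger0_norm ?enorm_ge0// -sqrtr_sqr /famnorm ler_wsqrtr//.
by rewrite (bigD1 i)//= lerDl; nonneg.
Qed.

Lemma norm1_le n (x y : 'cV[R]_n) : (forall c, `|x c 0| <= `|y c 0|) ->
  norm1 x <= norm1 y.
Proof. by move=> xy; apply: ler_sum. Qed.

End norms.

(** * First- and second-order expansions of the coefficients *)

Section regular_coefficients.
Context {R : realType} {d k p q : nat}.
Variables (T : R) (U : set 'cV[R]_k) (C0 : R) (rho : R -> R).
Variable phi : R -> 'cV[R]_d -> 'cV[R]_k -> 'M[R]_(p, q).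
Hypotheses (C00 : 0 < C0) (rho_mod : modulus_of_continuity rho).
Hypothesis phi_C2 : forall t u, 0 <= t <= T -> U u -> classC2 (fun x => phi t x u).
Hypothesis phi_x : x_regular T U C0 rho phi.
Hypothesis phi_u : u_regular T U C0 rho phi.
Variables (t : R) (a : 'I_p) (b : 'I_q).
Hypothesis tT : 0 <= t <= T.

Local Notation psi x u := (phi t x u a b).
Local Notation dpsi x u c := (grad (fun z => phi t z u) x c a b).

Let rho0 : rho 0 = 0. Proof. by have [_ ->] := rho_mod. Qed.

Lemma coef_bound x u : U u -> `|psi x u| <= C0.
Proof.
move=> Uu; have [phiu [_ h]] := phi_u; have [+ _] := h t x x u u tT Uu Uu.
apply: le_trans; apply: (le_trans (entry_le_enorm _ a b)).
by rewrite lerDl sqrtr_ge0.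
Qed.

Let lip_x x x' u : U u -> `|psi x u - psi x' u| <= C0 * norm1 (x - x').
Proof.
move=> Uu; have [+ _ _ _] := phi_x x x' tT Uu Uu.
rewrite subrr enorm0 rho0 addr0 => h.
have := entry_le_enorm (phi t x u - phi t x' u) a b; rewrite !mxE => /le_trans; apply.
by apply: le_trans h _; apply: ler_wpM2l; [exact: ltW|exact: enorm_le_norm1].
Qed.

Let lip_dx x x' u c : U u -> `|dpsi x u c - dpsi x' u c| <= C0 * norm1 (x - x').
Proof.
move=> Uu; have [_ _ + _] := phi_x x x' tT Uu Uu.
rewrite subrr enorm0 rho0 addr0 => h.
set A := (fun i => _) in h; have := famnorm_entry A c a b.
rewrite /A !mxE => /le_trans; apply.
by apply: le_trans h _; apply: ler_wpM2l; [exact: ltW|exact: enorm_le_norm1].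
Qed.

Let modulus_dx x u u' c : U u -> U u' ->
  `|dpsi x u c - dpsi x u' c| <= rho (enorm (u - u')).
Proof.
move=> Uu Uu'; have [_ _ + _] := phi_x x x tT Uu Uu'.
rewrite subrr enorm0 mulr0 add0r => h.
set A := (fun i => _) in h; have := famnorm_entry A c a b.
by rewrite /A !mxE => /le_trans; apply.
Qed.

Let taylor x D u : U u ->
  `|psi (x + D) u - psi x u - \sum_c dpsi x u c * D c 0| <= C0 * norm1 D ^+ 2.
Proof.
move=> Uu; have [C1 _] := phi_C2 tT Uu.
have der y c : derivable (fun z => phi t z u) y (basis_vec c) by have [] := C1 c.
have derE y c : 'D_(basis_vec c) (fun z => psi z u) y = dpsi y u c.
  by rewrite /grad derive_mx// mxE.
have [|xi [xib ->]] := @box_mvt R d (fun z => psi z u) x D.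
  by move=> y c _; exact: (derivable_mxP _ _ _).1.
rewrite -sumrB expr2 mulrA [X in _ <= _ * X]/norm1 mulr_sumr.
apply: le_trans (ler_norm_sum _ _ _) _; apply: ler_sum => c _.
rewrite derE -mulrBl normrM ler_wpM2r//.
apply: le_trans (lip_dx _ _ _ Uu) _; apply: ler_wpM2l; first exact: ltW.
by apply: norm1_le => c'; rewrite !mxE.
Qed.

(** The increment over a unit step is at most [C0], and so is the Taylor
    remainder. *)
Let dpsi_bound x u c : U u -> `|dpsi x u c| <= 2 * C0.
Proof.
move=> Uu; pose D : 'cV[R]_d := basis_vec c.
have D1 : norm1 D = 1.
  rewrite /norm1 (bigD1 c)//= big1 ?addr0; first by rewrite mxE !eqxx normr1.
  by move=> c' /negbTE cc'; rewrite mxE cc' normr0.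
have := taylor x D Uu; have := lip_x (x + D) x Uu.
rewrite addrAC subrr add0r D1 expr1n mulr1 => h1.
rewrite (bigD1 c)//= big1; last first.
  by move=> c' /negbTE cc'; rewrite [D _ _]mxE cc' mulr0.
rewrite [D _ _]mxE !eqxx mulr1 addr0 => h2.
have := ler_normB (psi (x + D) u - psi x u) (psi (x + D) u - psi x u - dpsi x u c).
rewrite opprB addrC subrK => /le_trans; apply; lra.
Qed.

(** A shift [e] of the control value [u] in [U]: unless it is trivial, the box
    around [u] spanned by [e] lies in the interior of [U], where the derivatives
    with respect to the control are available. *)
Definition inner_shift (u e : 'cV[R]_k) :=
  U u /\ (e = 0 \/
    forall v : 'cV[R]_k, (forall c, `|v c 0 - u c 0| <= `|e c 0|) -> (U°) v).

Lemma inner_shiftN u e : inner_shift u e -> inner_shift u (- e).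
Proof.
move=> [Uu [->|h]]; split => //; first by left; rewrite oppr0.
by right=> v ve; apply: h => c; rewrite (le_trans (ve c))// mxE normrN.
Qed.

Lemma inner_shift_edge u e : inner_shift u e -> U (u + e).
Proof.
move=> [Uu [->|h]]; first by rewrite addr0.
apply: interior_subset; apply: h => c.
by rewrite mxE addrAC subrr add0r.
Qed.

Let lip_u x u e : inner_shift u e -> `|psi x (u + e) - psi x u| <= C0 * norm1 e.
Proof.
move=> [Uu [->|box]]; first by rewrite addr0 subrr normr0 mulr_ge0 ?norm1_ge0 ?ltW.
have [phiu [C1 h]] := phi_u.
have [|xi [xib ->]] := @box_mvt R k (fun v => psi x v) u e.
  move=> y c yb; apply: (derivable_mxP _ _ _).1.
  by have [+ _ _] := C1 t x tT c; apply; exact: box.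
rewrite /norm1 mulr_sumr; apply: le_trans (ler_norm_sum _ _ _) _.
apply: ler_sum => c _; rewrite normrM ler_wpM2r//.
have Ux : (U°) (xi c) by apply: box => c'; exact: xib.
have [der gr _] := C1 t x tT c.
have := derive_mx (der _ Ux); rewrite -/(grad _ _ _) gr// => /matrixP/(_ a b).
rewrite mxE => <-.
have Ux' := interior_subset Ux; have [+ _] := h t x x _ _ tT Ux' Ux'.
apply: le_trans; apply: (le_trans (famnorm_entry _ c a b)).
by rewrite lerDr enorm_ge0.
Qed.

(** The derivative in the control is only continuous, so the opposite
    increments cancel up to the modulus of continuity times the size of the
    shift. *)
Let second_u x u e eta : inner_shift u e ->
  (forall r, 0 <= r <= norm1 e -> rho r <= eta) ->
  `|psi x (u + e) + psi x (u - e) - 2 * psi x u| <= 2 * eta * norm1 e.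
Proof.
have [->|e0] := eqVneq e 0.
  move=> _ eta_rho; rewrite subr0 addr0 (_ : _ - _ = 0); last by ring.
  have N0 : norm1 (0 : 'cV[R]_k) = 0.
    by rewrite /norm1 big1// => c _; rewrite mxE normr0.
  by rewrite normr0 N0 mulr0.
move=> [Uu [/eqP|box0]]; first by rewrite (negbTE e0).
move=> eta_rho; have [phiu [C1 h]] := phi_u.
have half (e' : 'cV[R]_k) : (forall v : 'cV[R]_k, (forall c, `|v c 0 - u c 0| <= `|e' c 0|) -> (U°) v) ->
    norm1 e' <= norm1 e ->
    `|psi x (u + e') - psi x u - \sum_c phiu t x u c a b * e' c 0| <= eta * norm1 e'.
  move=> box' e'e.
  have [|xi [xib ->]] := @box_mvt R k (fun v => psi x v) u e'.
    move=> y c yb; apply: (derivable_mxP _ _ _).1.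
    by have [+ _ _] := C1 t x tT c; apply; exact: box'.
  rewrite -sumrB [X in _ <= _ * X]/norm1 mulr_sumr.
  apply: le_trans (ler_norm_sum _ _ _) _; apply: ler_sum => c _.
  rewrite -mulrBl normrM ler_wpM2r//.
  have Ux : (U°) (xi c) by apply: box' => c'; exact: xib.
  have [der gr _] := C1 t x tT c.
  have := derive_mx (der _ Ux); rewrite -/(grad _ _ _) gr// => /matrixP/(_ a b).
  rewrite mxE => <-; have [_ hh] := h t x x _ _ tT (interior_subset Ux) Uu.
  set A := (fun i => _) in hh; have := famnorm_entry A c a b.
  rewrite /A !mxE => /le_trans; apply; apply: le_trans hh _; apply: eta_rho.
  rewrite subrr enorm0 add0r enorm_ge0/= (le_trans (enorm_le_norm1 _))//.
  by rewrite (le_trans _ e'e)//; apply: norm1_le => c'; rewrite !mxE.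
have NN : norm1 (- e) = norm1 e.
  by rewrite /norm1; apply: eq_bigr => c _; rewrite mxE normrN.
have h1 := half e box0 (lexx _).
have box0N (v : 'cV[R]_k) : (forall c, `|v c 0 - u c 0| <= `|(- e) c 0|) -> (U°) v.
  by move=> ve; apply: box0 => c; rewrite (le_trans (ve c))// mxE normrN.
have := half (- e) box0N; rewrite NN => /(_ (lexx _)).
have -> : \sum_c phiu t x u c a b * (- e) c 0 = - \sum_c phiu t x u c a b * e c 0.
  by rewrite -sumrN; apply: eq_bigr => c _; rewrite mxE mulrN.
move: h1; move: (\sum_c _) => S; rewrite -mulrA; move: (eta * _) => E.
rewrite !ler_norml => /andP[h1 h1'] /andP[h2 h2'].
by apply/andP; split; lra.
Qed.

Lemma coef_lip x D u e : inner_shift u e ->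
  `|psi (x + D) (u + e) - psi x u| <= C0 * (norm1 D + norm1 e).
Proof.
move=> box; have Uu := inner_shift_edge box.
have := lip_x (x + D) x Uu; rewrite addrAC subrr add0r => h1.
have h2 := lip_u x box.
rewrite -(subrK (psi x (u + e)) (psi (x + D) (u + e))) -addrA.
by rewrite (le_trans (ler_normD _ _))// mulrDr lerD.
Qed.

(** The first-order terms at (x, u) combine into the derivative along [D1 +
    D2]; moving the derivative in the state from [u] to the shifted controls
    costs the terms with [eta]. *)
Lemma coef_second x D1 D2 u e eta : inner_shift u e ->
  (forall r, 0 <= r <= norm1 e -> rho r <= eta) ->
  `|psi (x + D1) (u + e) + psi (x + D2) (u - e) - 2 * psi x u| <=
  2 * C0 * norm1 (D1 + D2) + eta * (norm1 D1 + norm1 D2) +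
  C0 * (norm1 D1 ^+ 2 + norm1 D2 ^+ 2) + 2 * eta * norm1 e.
Proof.
move=> box eta_rho.
have [Uu _] := box.
have U1 := inner_shift_edge box; have U2 := inner_shift_edge (inner_shiftN box).
have h3 := second_u x box eta_rho.
have lin e' D : norm1 e' <= norm1 e -> U (u + e') ->
    `|psi (x + D) (u + e') - psi x (u + e') - \sum_c dpsi x u c * D c 0| <=
    C0 * norm1 D ^+ 2 + eta * norm1 D.
  move=> e'e U'; have h := taylor x D U'.
  have : `|\sum_c dpsi x (u + e') c * D c 0 - \sum_c dpsi x u c * D c 0| <= eta * norm1 D.
    rewrite -sumrB /norm1 mulr_sumr.
    apply: le_trans (ler_norm_sum _ _ _) _; apply: ler_sum => c _.
    rewrite -mulrBl normrM ler_wpM2r//.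
    apply: le_trans (modulus_dx _ _ U' Uu) _; apply: eta_rho.
    rewrite enorm_ge0/= addrAC subrr add0r.
    exact: le_trans (enorm_le_norm1 _) e'e.
  move=> h'; have := lerD h h'; apply: le_trans; apply: le_trans (ler_normD _ _).
  by rewrite subrKA.
have NN : norm1 (- e) = norm1 e.
  by rewrite /norm1; apply: eq_bigr => c _; rewrite mxE normrN.
have l1 := lin e D1 (lexx _) U1.
have l2 : `|psi (x + D2) (u - e) - psi x (u - e) - \sum_c dpsi x u c * D2 c 0| <=
    C0 * norm1 D2 ^+ 2 + eta * norm1 D2.
  by apply: lin => //; rewrite NN.
have l3 : `|\sum_c dpsi x u c * D1 c 0 + \sum_c dpsi x u c * D2 c 0| <= 2 * C0 * norm1 (D1 + D2).
  rewrite -big_split/= /norm1 mulr_sumr.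
  apply: le_trans (ler_norm_sum _ _ _) _; apply: ler_sum => c _.
  by rewrite -mulrDr normrM mxE ler_wpM2r// dpsi_bound.
move: l1 l2 l3 h3; move: (\sum_c _) (\sum_c _) => S1 S2.
rewrite !ler_norml => /andP[l1 l1'] /andP[l2 l2'] /andP[l3 l3'] /andP[h h'].
by apply/andP; split; lra.
Qed.

End regular_coefficients.

(** * Borel measurability from coordinates *)

Section borel_measurability.
Context {R : realType} {d : measure_display} {S : measurableType d}.
Variables (D : set S).
Hypothesis mD : measurable D.

(** Each open set is the union of those sets of a countable basis that it
    contains. *)
Lemma borel_measurable_basis (V : pointedType) (opens : set (set V))
    (B : nat -> nat -> set V) (f : S -> V) :
  (forall x A, opens A -> A x -> exists n k, B n k x /\ B n k `<=` A) ->
  (forall n k, measurable (D `&` f @^-1` B n k)) ->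
  measurable_fun D (f : S -> g_sigma_algebraType opens).
Proof.
move=> Bbasis mf.
apply: (@measurability _ _ S (g_sigma_algebraType opens) D f opens) => // _ [A oA <-].
pose F n k := if `[< B n k `<=` A >] then D `&` f @^-1` B n k else set0.
rewrite (_ : _ `&` _ = \bigcup_n \bigcup_k F n k); last first.
  apply/seteqP; split => [x [Dx Ax]|x [n _ [k _]]]; last first.
    by rewrite /F; case: asboolP => // kA [Dx xb]; split => //; exact: kA.
  have [n [k [xB BA]]] : exists n k, B n k (f x) /\ B n k `<=` A.
    exact: Bbasis.
  by exists n => //; exists k => //; rewrite /F; case: asboolP.
apply: bigcupT_measurable => n; apply: bigcupT_measurable => k.
by rewrite /F; case: asboolP.
Qed.

Let ball_basis (V : pseudoMetricType R) (q : nat -> V) x (A : set V) :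
  (forall x e, 0 < e -> exists n, ball (q n) e x) -> open A -> A x ->
  exists n k, ball (q n) k.+1%:R^-1 x /\ ball (q n) k.+1%:R^-1 `<=` A.
Proof.
move=> qdense oA Ax; have /nbhs_ballP[e /= e0 eA] : nbhs x A.
  exact: open_nbhs_nbhs.
have [k ke] : exists k, k.+1%:R^-1 + k.+1%:R^-1 <= e :> R.
  exists (Num.truncn (2 / e)); have := truncnS_gt (2 / e).
  set k1 := (Num.truncn _).+1%:R; rewrite ltr_pdivrMr// => ke.
  have k10 : 0 < k1 by rewrite ltr0n.
  have : k1^-1 * 2 <= k1^-1 * (k1 * e).
    by apply: ler_wpM2l; [rewrite invr_ge0 ltW|exact: ltW].
  by rewrite mulrA mulVf ?gt_eqF// mul1r; move: (k1^-1) => k1V; lra.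
have k0 : 0 < k.+1%:R^-1 :> R by rewrite invr_gt0.
have [n nb] := qdense x _ k0; exists n, k; split => // y yb.
apply: eA; apply: (le_ball ke).
by apply: (ball_triangle _ yb); exact: ball_sym.
Qed.

Let rat_dense (x e : R) : 0 < e -> exists q : rat, `|ratr q - x| < e.
Proof.
move=> e0; have lt : x - e < x + e by lra.
have [q] := rat_in_itvoo lt.
by rewrite in_itv/= => /andP[q1 q2]; exists q; rewrite ltr_norml; lra.
Qed.

Let mx_dense p q (x : 'M[R]_(p, q)) e : 0 < e ->
  exists A : 'M[rat]_(p, q), forall i j, `|ratr (A i j) - x i j| < e.
Proof.
move=> e0; have [A AP] := choice (fun ij : 'I_p * 'I_q => rat_dense (x ij.1 ij.2) e0).
by exists (\matrix_(i, j) A (i, j)) => i j; rewrite mxE; exact: (AP (i, j)).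
Qed.

Let measurable_entry_ball (f : S -> R) x e : measurable_fun D f ->
  measurable (D `&` [set w | `|x - f w| < e]).
Proof.
move=> mf; rewrite (_ : [set _ | _] = (fun w => `|x - f w|) @^-1` `]-oo, e[).
  have mg : measurable_fun D (fun w => `|x - f w|).
    by apply: measurableT_comp => //; exact: measurable_funB.
  exact: mg.
by apply/seteqP; split => w /=; rewrite in_itv.
Qed.

Let measurable_mx_ball p q (f : S -> 'M[R]_(p, q)) x e : 0 < e ->
  (forall i j, measurable_fun D (fun w => f w i j)) ->
  measurable (D `&` f @^-1` ball x e).
Proof.
move=> e0 mf.
rewrite (_ : _ `&` _ = D `&` \bigcap_(ij in [set: 'I_p * 'I_q])
    (D `&` [set w | `|x ij.1 ij.2 - f w ij.1 ij.2| < e])); last first.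
  apply/seteqP; split => [w [Dw [_ h]]|w [Dw h]]; split => //.
    by move=> ij _; split => //; exact: h.
  by split => // i j; have [_] := h (i, j) I.
apply: measurableI => //; apply: fin_bigcap_measurable => //.
by move=> ij _; exact: measurable_entry_ball.
Qed.

(** The balls of radius 1 / (k + 1) around matrices with rational entries form
    a countable basis. *)
Lemma borel_measurable_mx p q (f : S -> 'M[R]_(p, q)) :
  (forall i j, measurable_fun D (fun w => f w i j)) ->
  measurable_fun D (f : S -> borelType 'M[R]_(p, q)).
Proof.
pose r n : 'M[R]_(p, q) := map_mx ratr (odflt 0 (@unpickle 'M[rat]_(p, q) n)).
move=> mf; apply: (borel_measurable_basis (B := fun n k => ball (r n) k.+1%:R^-1)).
  move=> x A oA Ax; apply: ball_basis oA Ax => {A x}x e e0; have [A Ax] := mx_dense x e0; exists (pickle A).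
  by rewrite /r pickleK /=; split => // i j; rewrite mxE; exact: Ax.
by move=> n k; apply: measurable_mx_ball => //; rewrite invr_gt0.
Qed.

(** The Borel sets of a product are not by definition generated by rectangles:
    rational balls of the product provide the countable basis. *)
Lemma borel_measurable_pair p (g : S -> R) (f : S -> 'cV[R]_p) :
  measurable_fun D g -> (forall i, measurable_fun D (fun w => f w i 0)) ->
  measurable_fun D (fun w => (g w, f w) : borelType (R * 'cV[R]_p)%type).
Proof.
move=> mg mf; pose r n := odflt (0, 0) (@unpickle (rat * 'cV[rat]_p)%type n).
pose rr n : R * 'cV[R]_p := (ratr (r n).1, map_mx ratr (r n).2).
apply: (borel_measurable_basis (B := fun n k => ball (rr n) k.+1%:R^-1)).
  move=> x A oA Ax; apply: ball_basis oA Ax => {A x}[[x y]] e e0; have [A Ay] := mx_dense y e0; have [c cx] := rat_dense x e0.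
  exists (pickle (c, A)); rewrite /rr /r pickleK /=; split => //=.
  by split => // i j; rewrite mxE; exact: Ay.
move=> n k; have e0 : 0 < k.+1%:R^-1 :> R by rewrite invr_gt0.
set e := k.+1%:R^-1 in e0 *; rewrite (_ : _ `&` _ =
  (D `&` [set w | `|ratr (r n).1 - g w| < e]) `&`
  (D `&` f @^-1` ball (map_mx ratr (r n).2 : 'cV[R]_p) e)); last first.
  by apply/seteqP; split => [w [Dw [h1 h2]]|w [[Dw h1] [_ h2]]].
apply: measurableI; first exact: measurable_entry_ball.
by apply: measurable_mx_ball => // i j; rewrite ord1.
Qed.

Lemma borel_measurable_triple p p' (g : S -> R) (f : S -> 'cV[R]_p)
    (h : S -> 'cV[R]_p') :
  measurable_fun D g -> (forall i, measurable_fun D (fun w => f w i 0)) ->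
  (forall i, measurable_fun D (fun w => h w i 0)) ->
  measurable_fun D (fun w => (g w, f w, h w) :
    borelType (R * 'cV[R]_p * 'cV[R]_p')%type).
Proof.
move=> mg mf mh.
pose r n := odflt (0, 0, 0) (@unpickle (rat * 'cV[rat]_p * 'cV[rat]_p')%type n).
pose rr n : R * 'cV[R]_p * 'cV[R]_p' :=
  (ratr (r n).1.1, map_mx ratr (r n).1.2, map_mx ratr (r n).2).
apply: (borel_measurable_basis (B := fun n k => ball (rr n) k.+1%:R^-1)).
  move=> x A oA Ax; apply: ball_basis oA Ax => {A x}[[[x y] z]] e e0; have [A Ay] := mx_dense y e0.
  have [B Bz] := mx_dense z e0; have [c cx] := rat_dense x e0.
  exists (pickle (c, A, B)); rewrite /rr /r pickleK /=; split => /=.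
    by split => //=; split => // i j; rewrite mxE; exact: Ay.
  by split => // i j; rewrite mxE; exact: Bz.
move=> n k; have e0 : 0 < k.+1%:R^-1 :> R by rewrite invr_gt0.
set e := k.+1%:R^-1 in e0 *; rewrite (_ : _ `&` _ =
  (D `&` [set w | `|ratr (r n).1.1 - g w| < e]) `&`
  (D `&` f @^-1` ball (map_mx ratr (r n).1.2 : 'cV[R]_p) e) `&`
  (D `&` h @^-1` ball (map_mx ratr (r n).2 : 'cV[R]_p') e)); last first.
  by apply/seteqP; split => [w [Dw [[h1 h2] h3]]|w [[[Dw h1] [_ h2]] [_ h3]]].
apply: measurableI; first apply: measurableI.
- exact: measurable_entry_ball.
- by apply: measurable_mx_ball => // i j; rewrite ord1.
- by apply: measurable_mx_ball => // i j; rewrite ord1.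
Qed.

End borel_measurability.

(** * Joint measurability of continuous processes *)

Section caratheodory.
Context {R : realType} {d : measure_display} {Omega : measurableType d}.
Variables (T : R) (f : R -> Omega -> R).
Hypothesis T0 : 0 < T.
Hypothesis mf : forall r, 0 <= r <= T -> measurable_fun setT (f r).
Hypothesis cf : forall w, {within `[0, T], continuous (f ^~ w)}.

Let idx n (r : R) : nat := Num.truncn (r * n.+1%:R).
Let node n (i : nat) : R := i%:R / n.+1%:R.

Let idx_itv n i : [set r : R | 0 <= r /\ idx n r = i] =
  `[node n i, node n i.+1[%classic.
Proof.
have n0 : 0 < n.+1%:R :> R by rewrite ltr0n.
have E (r : R) : (r \in `[node n i, node n i.+1[) = (i%:R <= r * n.+1%:R < i.+1%:R).
  by rewrite in_itv/= /node ler_pdivrMr// ltr_pdivlMr.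
apply/seteqP; split => r /=; rewrite E /idx.
  move=> [r0 <-]; apply: truncn_itv; exact: mulr_ge0.
move=> h; split; last exact/truncn_def.
by rewrite -(pmulr_lge0 _ n0); have /andP[+ _] := h; exact: le_trans.
Qed.

Let node_near n r : 0 <= r -> node n (idx n r) <= r /\ r - node n (idx n r) <= n.+1%:R^-1.
Proof.
have n0 : 0 < n.+1%:R :> R by rewrite ltr0n.
move=> r0; have : [set r | 0 <= r /\ idx n r = idx n r] r by [].
have := idx_itv n (idx n r); move=> /seteqP[h _].
move=> _; have := h r (conj r0 erefl); rewrite /= in_itv/= => /andP[h1 h2].
split => //; rewrite lerBlDr (le_trans (ltW h2))// /node -natr1 mulrDl addrC.
by rewrite mul1r.
Qed.

(** A process with continuous paths is the pointwise limit of processes that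
    are constant in time on the intervals of a grid. *)
Lemma continuous_joint_measurable : joint_measurable T f.
Proof.
pose F n (z : measurableTypeR R * Omega) := f (node n (idx n z.1)) z.2.
apply: (@measurable_fun_cvg _ _ _ _ F).
  move=> n _ B mB.
  pose G i := if node n i <= T then
      (slab T `&` ((`[node n i, node n i.+1[%classic : set (measurableTypeR R)) `*` (f (node n i) @^-1` B)))
    else set0.
  rewrite (_ : _ `&` _ = \bigcup_i G i); last first.
    apply/seteqP; split => [[r w] [[/= rT _] Bw]|[r w] [i _]].
      move: (rT); rewrite in_itv/= => /andP[r0 rT'].
      exists (idx n r) => //; rewrite /G.
      have [h1 h2] := node_near n r0; rewrite (le_trans h1 rT').
      have ri : `[node n (idx n r), node n (idx n r).+1[%classic r.
        by rewrite -idx_itv.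
      by split; split.
    rewrite /G; case: ifP => // _ [rT [/= ri Bw]]; split => //.
    rewrite /F/= /preimage/=.
    have : [set r : R | 0 <= r /\ idx n r = i] r by rewrite idx_itv.
    by case=> _ ->.
  apply: bigcupT_measurable => i; rewrite /G; case: ifPn => // iT.
  apply: measurableI; first exact: measurable_slab.
  apply: measurableX => //; rewrite -[X in measurable X]setTI; apply: mf => //.
  by rewrite iT andbT /node divr_ge0.
move=> [r w] [/= rT _]; rewrite /F/=.
move: (rT); rewrite in_itv/= => /andP[r0 rT'].
have /subspace_continuousP/(_ r) := @cf w; rewrite /= in_itv/= r0 rT' => /(_ isT).
apply: cvg_comp.
move=> A [e /= e0 eA].
have [N Ne] : exists N, forall n, (N <= n)%N -> n.+1%:R^-1 < e :> R.
  exists (Num.truncn e^-1) => n Nn; rewrite invf_plt ?posrE ?ltr0n//.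
  by rewrite (lt_le_trans (truncnS_gt _))// ler_nat ltnS.
exists N => // n /= Nn; have [h1 h2] := node_near n r0.
apply: eA => /=.
  by rewrite ger0_norm ?subr_ge0// (le_lt_trans h2)// Ne.
by rewrite in_itv/= (le_trans h1)// andbT /node divr_ge0.
Qed.

End caratheodory.

(** * Measurability along a controlled state *)

Section domains.
Context {R : realType} {d k : nat}.
Variables (T : R) (U : set 'cV[R]_k).
Hypothesis Uclosed : closed U.

Lemma measurable_domain_txu : measurable (domain_txu (d := d) T U).
Proof.
rewrite -(setCK (domain_txu _ _)); apply: measurableC; apply: sub_sigma_algebra.
apply: closed_openC.
have -> : domain_txu (d := d) T U =
  (fun z : R * 'cV[R]_d * 'cV[R]_k => z.1.1) @^-1` `[0, T] `&`
  (fun z : R * 'cV[R]_d * 'cV[R]_k => z.2) @^-1` U.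
  by apply/seteqP; split => z /=; rewrite in_itv.
apply: closedI; apply: closed_comp => //; last 2 first.
- exact: itv_closed.
- by move=> z _; exact: cvg_snd.
- move=> z _; apply: (@continuous_comp _ _ _ fst fst); exact: cvg_fst.
Qed.

Lemma measurable_domain_tx : measurable (domain_tx (d := d) T).
Proof.
rewrite -(setCK (domain_tx _)); apply: measurableC; apply: sub_sigma_algebra.
apply: closed_openC.
have -> : domain_tx (d := d) T = (fun z : R * 'cV[R]_d => z.1) @^-1` `[0, T].
  by apply/seteqP; split => z /=; rewrite in_itv.
apply: closed_comp; last exact: itv_closed.
by move=> z _; exact: cvg_fst.
Qed.

End domains.

Section state_processes.
Context {R : realType} {dO : measure_display} {Omega : measurableType dO}.
Context (P : probability Omega R) {d k m : nat}.
Variables (T : R) (W : R -> Omega -> 'cV[R]_m) (X0 : Omega -> 'cV[R]_d).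
Variable U : set 'cV[R]_k.
Variable b : R -> 'cV[R]_d -> 'cV[R]_k -> 'cV[R]_d.
Variable sigma : R -> 'cV[R]_d -> 'cV[R]_k -> 'M[R]_(d, m).
Variable f : R -> 'cV[R]_d -> R.
Variable g : 'cV[R]_d -> R.
Hypothesis T0 : 0 < T.
Hypothesis Pcomplete : measure_is_complete P.
Hypothesis Wbm : brownian_motion P T W.
Hypothesis X0cst : exists x0, X0 = cst x0.
Hypothesis Uclosed : closed U.
Hypothesis mcoef : measurable_coefficients T U b sigma f g.
Variables (u : R -> Omega -> 'cV[R]_k) (X : R -> Omega -> 'cV[R]_d).
Hypothesis uadm : admissible P T W X0 U 0 u.
Hypothesis Xstate : state_process P T W X0 b sigma 0 X0 u X.

Lemma adapted_measurable n (Y : R -> Omega -> 'cV[R]_n) r i :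
  adapted P W X0 0 T Y -> 0 <= r <= T -> measurable_fun setT (fun w => Y r w i 0).
Proof.
move=> aY rT; have /andP[_ rT'] := rT.
apply: (F_measurable_sub Pcomplete Wbm X0cst rT').
by apply: (@borel_entry_measurable R _ (g_sigma_algebraType (filtration_generators P W X0 r))); exact: aY.
Qed.

Lemma state_measurable r i : 0 <= r <= T -> measurable_fun setT (fun w => X r w i 0).
Proof. by apply: adapted_measurable; have [] := Xstate. Qed.

Lemma state_joint_measurable i : joint_measurable T (fun r w => X r w i 0).
Proof.
apply: continuous_joint_measurable => //; first by move=> r; exact: state_measurable.
move=> w; have [_ /(_ w) cX _ _] := Xstate.
move=> r; apply: (@continuous_comp _ _ _ (X ^~ w : subspace `[0, T] -> _) (fun M : 'cV[R]_d => M i 0)).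
  exact: cX.
exact: coord_continuous.
Qed.

Lemma control_joint_measurable i : joint_measurable T (fun r w => u r w i 0).
Proof. by have [_ _ ju _] := uadm; exact: borel_entry_measurable. Qed.

Let time_measurable : measurable_fun (slab T) (fun z : measurableTypeR R * Omega => z.1 : R).
Proof. by apply: measurable_funTS; exact: measurable_fst. Qed.

Let in_domain z : slab (Omega := Omega) T z ->
  domain_txu T U (z.1, X z.1 z.2, u z.1 z.2).
Proof.
move=> [/=]; rewrite in_itv/= => zT _; split => //=.
by have [Uu _ _ _] := uadm; exact: Uu.
Qed.

Lemma coefficient_joint_measurable p q
    (phi : R -> 'cV[R]_d -> 'cV[R]_k -> 'M[R]_(p, q)) a c :
  measurable_fun (domain_txu T U)
    (fun z => phi z.1.1 z.1.2 z.2 : borelType 'M[R]_(p, q)) ->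
  joint_measurable T (fun r w => phi r (X r w) (u r w) a c).
Proof.
move=> mphi.
apply: (@borel_entry_measurable R _ _ _ _ _
  (fun z : measurableTypeR R * Omega => phi z.1 (X z.1 z.2) (u z.1 z.2))).
apply: (@measurable_comp _ _ _ _ _ _ (domain_txu T U)
  (fun z => phi z.1.1 z.1.2 z.2 : borelType 'M[R]_(p, q)) _
  (fun z : measurableTypeR R * Omega => (z.1, X z.1 z.2, u z.1 z.2))) => //.
- exact: measurable_domain_txu.
- by move=> _ [z zs <-]; exact: in_domain.
- apply: borel_measurable_triple => //; first exact: measurable_slab.
    exact: state_joint_measurable.
  exact: control_joint_measurable.
Qed.

Lemma drift_joint_measurable a :
  joint_measurable T (fun r w => b r (X r w) (u r w) a 0).
Proof. by have [mb _ _ _] := mcoef; exact: coefficient_joint_measurable. Qed.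

Lemma running_cost_joint_measurable : joint_measurable T (fun r w => f r (X r w)).
Proof.
have [_ _ mf _] := mcoef.
apply: (@continuous_borel_measurable R R _ _ _
  (fun z : measurableTypeR R * Omega => f z.1 (X z.1 z.2)) idfun).
  by move=> x; exact: cvg_id.
apply: (@measurable_comp _ _ _ _ _ _ (domain_tx T)
  (fun z => f z.1 z.2 : borelType R) _
  (fun z : measurableTypeR R * Omega => (z.1, X z.1 z.2))) => //.
- exact: measurable_domain_tx.
- by move=> _ [z zs <-]; have [] := in_domain zs.
- apply: borel_measurable_pair => //; first exact: measurable_slab.
  exact: state_joint_measurable.
Qed.

Lemma terminal_cost_measurable : measurable_fun setT (fun w => g (X T w)).
Proof.
have [_ _ _ mg] := mcoef.
apply: (@continuous_borel_measurable R R _ _ _ (fun w => g (X T w)) idfun).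
  by move=> x; exact: cvg_id.
apply: (@measurableT_comp _ _ _ _ _ _ (g : borelType 'cV[R]_d -> borelType R) _
  (X T : Omega -> borelType 'cV[R]_d)) => //.
apply: borel_measurable_mx => // i j; rewrite ord1.
by apply: state_measurable; rewrite ltW/=.
Qed.

Lemma state_decomposition s a : 0 <= s <= T ->
  exists2 I : Omega -> R,
    ito_pair P W X0 s (fun l r w => sigma r (X r w) (u r w) a l) I &
    {ae P, forall w, X s w a 0 = X0 w a 0 +
      \int[lebesgue_measure]_(r in `[0, s]) (b r (X r w) (u r w) a 0) + I w}.
Proof.
move=> sT; have /andP[s0 sT'] := sT; have [_ _ _ /(_ s sT)[I II XI]] := Xstate.
exists (fun w => I w a 0).
  exact: (ito_integral_pair Pcomplete Wbm X0cst a s0 sT' II).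
by apply: filterS XI => w ->; rewrite /drift_integral !mxE.
Qed.

End state_processes.

(** * Integrals in time of bounded processes *)

Section exponential_weight.
Context {R : realType}.
Local Notation leb := (@lebesgue_measure R).

Lemma int_le_expR (lam s : R) : 0 < lam -> 0 <= s ->
  int_le leb (`[0, s]%classic : set (measurableTypeR R))
    (fun r => expR (lam * r)) (expR (lam * s) / lam).
Proof.
move=> lam0; rewrite le_eqVlt => /orP[/eqP <-|s0]; rewrite /int_le.
  by rewrite set_itv1 integral_set1 lee_fin divr_ge0 ?expR_ge0 ?ltW.
pose F r := lam^-1 * expR (lam * r).
have dg (x : R) : is_derive x 1 (fun r : R => lam * r) lam.
  rewrite -[X in is_derive _ _ _ X]mulr1; exact: (@is_deriveZ _ _ _ id lam x 1 1).
have dE (x : R) : is_derive x 1 (fun r : R => expR (lam * r)) (lam * expR (lam * x)).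
  by rewrite mulrC; exact: (@is_derive1_comp _ expR (fun r => lam * r)).
have dF (x : R) : is_derive x 1 F (expR (lam * x)).
  have -> : expR (lam * x) = lam^-1 *: (lam * expR (lam * x)).
    by rewrite /GRing.scale/= mulrA mulVf ?mul1r ?gt_eqF.
  exact: (@is_deriveZ _ _ _ (fun r => expR (lam * r)) lam^-1 x 1).
have cF (x : R) : {for x, continuous F}.
  apply: differentiable_continuous; apply/derivable1_diffP; exact: ex_derive.
have cE (x : R) : {for x, continuous (fun r => expR (lam * r))}.
  apply: differentiable_continuous; apply/derivable1_diffP; exact: ex_derive.
rewrite (@continuous_FTC2 _ _ F)//.
- rewrite -EFinB lee_fin /F [leRHS]mulrC lerBlDr lerDl.
  by rewrite mulr_ge0 ?expR_ge0// invr_ge0 ltW.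
- by apply: continuous_subspaceT => x; exact: cE.
- split.
  + by move=> x _; exact: ex_derive.
  + by apply/cvg_at_right_filter; exact: cF.
  + by apply/cvg_at_left_filter; exact: cF.
- by move=> x _; rewrite derive1E; have [_ ->] := dF x.
Qed.

End exponential_weight.

Section time_integrals.
Context {R : realType} {dO : measure_display} {Omega : measurableType dO}.
Context (P : probability Omega R).
Local Notation leb := (@lebesgue_measure R).
Implicit Types (h : R -> Omega -> R) (s c K : R).
Local Notation E_le := (int_le P setT).

Lemma slab_measure s : 0 <= s -> (leb \x P)%E (slab s) = s%:E.
Proof.
move=> s0; rewrite [LHS](_ : _ = leb `[0%R, s]%classic * P setT)%E; last first.
  exact: product_measure1E.
rewrite [P _]probability_setT mule1 /= lebesgue_measure_itv/= lte_fin.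
by move: s0; rewrite le_eqVlt => /orP[/eqP <-|->]; rewrite ?ltxx// -EFinD subr0.
Qed.

Lemma slab_measure_le s : 0 <= s -> ((leb \x P)%E (slab s) <= s%:E)%E.
Proof. by move=> s0; rewrite slab_measure. Qed.

Definition tint s h w := \int[leb]_(r in `[0, s]) h r w.

Lemma bounded_section_integrable s h K w : 0 <= s -> joint_measurable s h ->
  (forall r w, 0 <= r <= s -> `|h r w| <= K) ->
  leb.-integrable `[0, s] (EFin \o h ^~ w).
Proof.
move=> s0 mh hK.
apply: (@int_le_integrable _ _ _ _ _ _ (K * s)); first exact: joint_measurable_section.
apply: (@int_le_mono _ _ _ _ _ _ (fun=> K)).
  by move=> r /=; rewrite in_itv/= => rs; rewrite normr_ge0 hK.
have K0 : 0 <= K by rewrite (le_trans (normr_ge0 _) (hK 0 w _))// lexx.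
apply: int_le_cst => //.
by rewrite /= lebesgue_measure_itv/= lte_fin; case: ifP => // _; rewrite -EFinD subr0.
Qed.

Lemma fine_leb_itv s : 0 <= s -> fine (leb `[0, s]%classic) = s.
Proof.
rewrite lebesgue_measure_itv/= lte_fin le_eqVlt => /orP[/eqP <-|->].
  by rewrite ltxx.
by rewrite /= subr0.
Qed.

(** Integrate (h - c)^2 >= 0, where c is the average of [h] in time. *)
Lemma sqr_tint_le s h K w : 0 <= s -> joint_measurable s h ->
  (forall r w, 0 <= r <= s -> `|h r w| <= K) ->
  tint s h w ^+ 2 <= s * tint s (fun r w => h r w ^+ 2) w.
Proof.
move=> s0 mh hK; have hint := bounded_section_integrable w s0 mh hK.
have h2int : leb.-integrable `[0, s] (EFin \o (fun r => h r w ^+ 2)).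
  apply: (@bounded_section_integrable s (fun r w => h r w ^+ 2) (K ^+ 2) w) => //.
    exact: measurable_funX.
  move=> r w' rs; rewrite normrX lerXn2r ?nnegrE ?normr_ge0 ?hK//.
  exact: le_trans (hK r w' rs).
have [->|sn0] := eqVneq s 0.
  rewrite mul0r /tint set_itv1 Rintegral_set1 expr0n//.
have sgt0 : 0 < s by rewrite lt_def sn0.
pose c := tint s h w / s.
have cst_int (e : R) : leb.-integrable `[0, s] (EFin \o (fun=> e)).
  apply: (@bounded_section_integrable s (fun _ _ => e) `|e| w) => //.
  exact: measurable_cst.
have h1int : leb.-integrable `[0, s] (EFin \o (fun r => 2 * c * h r w)).
  rewrite (_ : _ \o _ = fun r => ((2 * c)%:E * (h r w)%:E)%E).
    exact: integrableZl.
  by apply/funext => r /=; rewrite EFinM.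
have : \int[leb]_(r in `[0, s]) (2 * c * h r w - c ^+ 2) <=
    tint s (fun r w => h r w ^+ 2) w.
  apply: le_Rintegral => //.
    rewrite (_ : _ \o _ = (EFin \o (fun r => (2 * c * h r w)%R)) \- (EFin \o (fun=> (c ^+ 2)%R)))%E.
      exact: integrableB.
    by apply/funext => r /=; rewrite EFinB.
  by move=> r _; have := sqr_ge0 (h r w - c); nra.
rewrite RintegralB// RintegralZl// Rintegral_cst// fine_leb_itv//.
rewrite -/(tint s h w) => h0.
have tE : tint s h w = s * c by rewrite /c mulrC divfK.
rewrite tE in h0 *.
have := ler_wpM2l s0 h0; nra.
Qed.

Lemma pow4_tint_le s h K w : 0 <= s -> joint_measurable s h ->
  (forall r w, 0 <= r <= s -> `|h r w| <= K) ->
  tint s h w ^+ 4 <= s ^+ 3 * tint s (fun r w => h r w ^+ 4) w.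
Proof.
move=> s0 mh hK; rewrite (exprM _ 2 2).
have K0 : 0 <= K by rewrite (le_trans (normr_ge0 _) (hK 0 w _))// lexx.
apply: (@le_trans _ _ ((s * tint s (fun r w => h r w ^+ 2) w) ^+ 2)).
  rewrite lerXn2r ?nnegrE ?sqr_ge0//; last exact: sqr_tint_le hK.
  by rewrite mulr_ge0// /tint Rintegral_ge0// => r _; exact: sqr_ge0.
rewrite exprMn [in leRHS]exprSr -mulrA ler_wpM2l ?sqr_ge0//.
have mh2 : joint_measurable s (fun r w => h r w ^+ 2) by exact: measurable_funX.
have <- : (fun r w => (h r w ^+ 2) ^+ 2) = (fun r w => h r w ^+ 4).
  by apply/funext => r; apply/funext => w'; rewrite -exprM.
apply: (sqr_tint_le w s0 mh2 (K := K ^+ 2)) => r w' rs.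
by rewrite normrX lerXn2r ?nnegrE ?normr_ge0 ?hK.
Qed.

Section expectation.
Variables (s K : R) (h : R -> Omega -> R).
Hypotheses (s0 : 0 <= s) (mh : joint_measurable s h).
Hypothesis h0 : forall r w, 0 <= r <= s -> 0 <= h r w <= K.

Let h00 r w : 0 <= r <= s -> 0 <= h r w.
Proof. by move=> rs; have /andP[] := h0 w rs. Qed.

Let hK r w : 0 <= r <= s -> `|h r w| <= K.
Proof. by move=> rs; have /andP[? ?] := h0 w rs; rewrite ger0_norm. Qed.

Lemma tint_ge0 w : 0 <= tint s h w.
Proof.
by rewrite /tint Rintegral_ge0// => r; rewrite /= in_itv/=; exact: h00.
Qed.

Lemma measurable_tint_ge0 : measurable_fun setT (tint s h).
Proof.
apply: (@measurableT_comp _ _ _ _ _ _ fine) => //.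
exact: measurable_inner_integral.
Qed.

Lemma tintE w : (tint s h w)%:E = (\int[leb]_(r in `[0%R, s]) (h r w)%:E)%E.
Proof.
rewrite /tint /Rintegral fineK//; apply: integrable_fin_num => //.
exact: (bounded_section_integrable w s0 mh hK).
Qed.

Lemma tint_E_le c : process_le P s h c -> E_le (tint s h) c.
Proof.
rewrite /process_le /int_le slab_integral21//.
by under [X in _ -> (X <= _)%E]eq_integral do rewrite tintE.
Qed.

End expectation.

Section signed.
Variables (s K : R) (h : R -> Omega -> R).
Hypotheses (s0 : 0 <= s) (mh : joint_measurable s h).
Hypothesis hK : forall r w, 0 <= r <= s -> `|h r w| <= K.

Let h' r w := h r w + K.

Let mh' : joint_measurable s h'.
Proof. exact: measurable_funD. Qed.

Let h'0 r w : 0 <= r <= s -> 0 <= h' r w <= 2 * K.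
Proof. by move=> /hK => /(_ w); rewrite ler_norml /h' => /andP[? ?]; lra. Qed.

Let hint w := bounded_section_integrable w s0 mh hK.

Let Kint (w : Omega) : leb.-integrable `[0, s] (EFin \o (fun=> K)).
Proof.
by apply: (@bounded_section_integrable s (fun _ _ => K) `|K| w) => //;
  exact: measurable_cst.
Qed.

Let tint_shift (w : Omega) : tint s h' w = tint s h w + K * s.
Proof.
rewrite /tint RintegralD//; first by rewrite Rintegral_cst// fine_leb_itv.
exact: Kint.
Qed.

Lemma tint_EFin w : (tint s h w)%:E = (\int[leb]_(r in `[0%R, s]) (h r w)%:E)%E.
Proof. by rewrite /tint /Rintegral fineK//; apply: integrable_fin_num => //; exact: hint. Qed.

Lemma measurable_tint : measurable_fun setT (tint s h).
Proof.
rewrite (_ : tint s h = fun w => tint s h' w - K * s); last first.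
  by apply/funext => w; rewrite tint_shift addrK.
apply: measurable_funB => //.
exact: (measurable_tint_ge0 mh' (K := 2 * K)).
Qed.

Lemma norm_tint_le w : `|tint s h w| <= K * s.
Proof.
have := tint_ge0 h'0 w; rewrite tint_shift => h1.
have : tint s h' w <= 2 * K * s.
  rewrite -[X in _ <= _ * X](fine_leb_itv s0) -Rintegral_cst//.
  apply: le_Rintegral => //.
  - apply: (bounded_section_integrable w s0 mh' (K := 2 * K)) => r w' /h'0 => /(_ w') /andP[? ?].
    by rewrite ger0_norm.
  - apply: (@bounded_section_integrable s (fun _ _ => 2 * K) `|2 * K| w) => //.
    exact: measurable_cst.
  - by move=> r /=; rewrite in_itv/= => /h'0 => /(_ w) /andP[].
by rewrite tint_shift ler_norml => h2; apply/andP; split; lra.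
Qed.

(** Tonelli's theorem for the nonnegative process [h + K]. *)
Lemma expectation_tint : \int[P]_w tint s h w = \int[(leb \x P)%E]_(z in slab s) h z.1 z.2.
Proof.
have [w0 _] : [set: Omega] !=set0 by exists point.
have K0 : 0 <= K by rewrite (le_trans (normr_ge0 _) (hK w0 (r := 0) _))// lexx.
have msl := @measurable_slab R dO Omega s.
have cstD c : (leb \x P)%E.-integrable (slab s) (EFin \o (fun=> c)).
  apply: (@int_le_integrable _ _ _ _ _ _ (`|c| * s)) => //.
  by apply: int_le_cst => //; exact: slab_measure_le.
have hD : (leb \x P)%E.-integrable (slab s) (EFin \o (fun z : measurableTypeR R * Omega => h z.1 z.2)).
  apply: (@integrable_le _ _ _ _ _ _ _ (fun=> K)) => //.
  by move=> [r w] [/=]; rewrite in_itv/= => rs _; exact: hK.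
have KP c : P.-integrable setT (EFin \o (fun=> c)).
  apply: (@int_le_integrable _ _ _ _ _ _ (`|c| * 1)) => //.
  by apply: int_le_cst => //; exact: probability_le1.
have tP : P.-integrable setT (EFin \o tint s h).
  apply: (@integrable_le _ _ _ _ _ _ _ (fun=> K * s)) => //; first exact: measurable_tint.
  by move=> w _; exact: norm_tint_le.
have e1 : \int[P]_w tint s h' w = \int[P]_w tint s h w + K * s.
  under eq_Rintegral do rewrite tint_shift.
  rewrite RintegralD// Rintegral_cst// [fine _](_ : _ = 1) ?mulr1//.
  exact: (congr1 fine (probability_setT P)).
have e2 : \int[(leb \x P)%E]_(z in slab s) h' z.1 z.2 =
    \int[(leb \x P)%E]_(z in slab s) h z.1 z.2 + K * s.
  by rewrite RintegralD// Rintegral_cst// [fine _](_ : _ = s)//; exact: (congr1 fine (slab_measure s0)).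
apply: (addIr (K * s)); rewrite -e1 -e2 /Rintegral; congr fine.
rewrite (slab_integral21 P mh'); last by move=> r w /h'0 => /(_ w)/andP[].
by apply: eq_integral => w _; rewrite (tintE s0 mh' h'0).
Qed.

End signed.

End time_integrals.

(** * Gronwall's inequality and moments of Ito processes *)

Section gronwall.
Context {R : realType} {dO : measure_display} {Omega : measurableType dO}.
Context (P : probability Omega R) {d : nat}.
Local Notation E_le := (int_le P setT).
Variables (T A B K0 : R) (V : 'I_d -> R -> Omega -> R).
Hypotheses (A0 : 0 <= A) (B0 : 0 <= B).
Hypothesis mV : forall a, joint_measurable T (V a).
Hypothesis V0 : forall a r w, 0 <= V a r w.
Hypothesis VK : forall a (s : R), 0 <= s <= T -> E_le (V a s) K0.
Hypothesis V_feedback : forall a (s c : R), 0 <= s <= T ->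
  process_le P s (fun r w => \sum_c V c r w) c -> E_le (V a s) (A * c + B).

Let lam := 2 * (A * d%:R) + 1.

Let lam0 : 0 < lam.
Proof. by rewrite ltr_wpDl//; nonneg. Qed.

(** The weight makes the time integral cost a factor 1 / lam, and lam is
    chosen so that the coefficient of the feedback becomes at most 1 / 2. *)
Let contraction (k : R) : 0 <= k ->
  (forall a (s : R), 0 <= s <= T -> E_le (V a s) (k * expR (lam * s))) ->
  forall a (s : R), 0 <= s <= T -> E_le (V a s) ((k / 2 + B) * expR (lam * s)).
Proof.
move=> k0 Vk a s sT; have /andP[s0 sT'] := sT.
have h : process_le P s (fun r w => \sum_c V c r w)
    (\sum_(c < d) k * (expR (lam * s) / lam)).
  apply: process_le_sum => //; first by move=> c; exact: joint_measurable_sub (mV c).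
  move=> c; apply: (@process_le_fun _ _ _ _ _ _ (fun r => k * expR (lam * r))) => //.
  - exact: joint_measurable_sub (mV c).
  - by move=> r /andP[r0 rs]; apply: Vk; rewrite r0 (le_trans rs).
  - apply: int_leZ => //; last exact: int_le_expR.
    apply: measurable_funTS.
    by apply: (measurableT_comp (f := expR)) => //; exact: measurable_funM.
apply: int_le_wk (V_feedback a sT h).
rewrite sumr_const card_ord -[_ *+ d]mulr_natl.
have e1 : 1 <= expR (lam * s).
  by rewrite -expR0 ler_expR mulr_ge0// ltW.
have -> : A * (d%:R * (k * (expR (lam * s) / lam))) =
    (A * d%:R / lam) * (k * expR (lam * s)) by ring.
have al : A * d%:R / lam <= 2^-1.
  by rewrite ler_pdivrMr// /lam; lra.
have ke : 0 <= k * expR (lam * s) by nonneg.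
have := ler_wpM2r ke al; have := ler_wpM2l B0 e1; lra.
Qed.

(** Each use of the inequality replaces a bound k by k / 2 + B, so iterating
    brings any a priori bound down to the fixed point 2 B. *)
Lemma gronwall a s : 0 <= s <= T -> E_le (V a s) (2 * B * expR (lam * T)).
Proof.
move=> sT; have /andP[s0 sT'] := sT.
have K00 : 0 <= K0 by apply: int_le_ge0 (VK a sT) => w _; exact: V0.
have it n : forall a (s : R), 0 <= s <= T ->
    E_le (V a s) ((K0 / 2 ^+ n + 2 * B) * expR (lam * s)).
  elim: n => [|n IHn] a' s' sT2; last first.
    apply: int_le_wk (contraction _ IHn a' sT2).
      rewrite le_eqVlt; apply/orP; left; apply/eqP; rewrite exprS invfM.
      by field; rewrite expf_neq0.
    by apply: addr_ge0; [rewrite divr_ge0// exprn_ge0|nonneg].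
  apply: int_le_wk (VK a' sT2); rewrite expr0 divr1.
  have e1 : 1 <= expR (lam * s').
    by case/andP: sT2 => ? _; rewrite -expR0 ler_expR mulr_ge0// ltW.
  have KB : 0 <= K0 + 2 * B by nonneg.
  apply: le_trans (ler_wpM2l KB e1); rewrite mulr1 lerDl; nonneg.
apply: (@int_le_lim _ _ _ _ _ _ _ (expR (lam * T))); first exact: expR_gt0.
move=> e e0; pose n := (Num.trunc (K0 / e)).+1.
apply: int_le_wk (it n a s sT).
have -> : 2 * B * expR (lam * T) + expR (lam * T) * e = (e + 2 * B) * expR (lam * T).
  by ring.
apply: ler_pM; first by apply: addr_ge0; [rewrite divr_ge0// exprn_ge0|nonneg].
- exact: expR_ge0.
- rewrite lerD2r ler_pdivrMr ?exprn_gt0// mulrC -ler_pdivrMr//.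
  apply: (@le_trans _ _ n%:R); first by apply: ltW; exact: truncnS_gt.
  by rewrite -natrX ler_nat; apply: ltnW; exact: ltn_expl.
- by rewrite ler_expR ler_pM2l.
Qed.

End gronwall.

Section dynamics.
Context {R : realType} {dO : measure_display} {Omega : measurableType dO}.
Context (P : probability Omega R) {d m : nat}.
Variables (T : R) (W : R -> Omega -> 'cV[R]_m) (X0 : Omega -> 'cV[R]_d).
Hypothesis Pcomplete : measure_is_complete P.
Hypothesis Wbm : brownian_motion P T W.
Hypothesis X0cst : exists x0, X0 = cst x0.
Hypothesis T0 : 0 <= T.
Local Notation ito_pair := (ito_pair P W X0).
Local Notation E_le := (int_le P setT).

(** A component of a state, or of a linear combination of states, with its
    drift [be] and its diffusion [ga]. The bound [K] gives the fourth moments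
    and the a priori bounds for [gronwall]. *)
Definition ito_process (K : R) (D be : R -> Omega -> R) (ga : 'I_m -> R -> Omega -> R) :=
  [/\ joint_measurable T D, joint_measurable T be,
      forall s : R, 0 <= s <= T -> measurable_fun setT (D s),
      forall (r : R) w, 0 <= r <= T -> `|be r w| <= K /\ forall l, `|ga l r w| <= K &
      forall s : R, 0 <= s <= T -> exists2 I, ito_pair s ga I &
        {ae P, forall w, D s w = tint s be w + I w}].

Lemma ito_process_lin K1 D1 be1 ga1 K2 D2 be2 ga2 (x y : R) :
  ito_process K1 D1 be1 ga1 -> ito_process K2 D2 be2 ga2 ->
  ito_process (`|x| * K1 + `|y| * K2)
    (fun s w => x * D1 s w + y * D2 s w)
    (fun s w => x * be1 s w + y * be2 s w)
    (fun l s w => x * ga1 l s w + y * ga2 l s w).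
Proof.
move=> [mD1 mb1 m1 K1b I1] [mD2 mb2 m2 K2b I2].
have nle (v1 v2 : R) : `|v1| <= K1 -> `|v2| <= K2 -> `|x * v1 + y * v2| <= `|x| * K1 + `|y| * K2.
  by move=> h1 h2; rewrite (le_trans (ler_normD _ _))// !normrM lerD// ler_wpM2l.
split.
- by apply: measurable_funD; apply: measurable_funM.
- by apply: measurable_funD; apply: measurable_funM.
- move=> s sT; apply: measurable_funD; apply: measurable_funM => //.
    exact: m1.
  exact: m2.
- move=> r w rT; have [b1 g1] := K1b r w rT; have [b2 g2] := K2b r w rT.
  by split => [|l]; apply: nle.
- move=> s sT; have [J1 h1 e1] := I1 s sT; have [J2 h2 e2] := I2 s sT.
  have /andP[s0 sT'] := sT.
  exists (fun w => x * J1 w + y * J2 w); first exact: ito_pair_lin.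
  have int (K : R) (be : R -> Omega -> R) : joint_measurable T be ->
      (forall (r : R) w, 0 <= r <= T -> `|be r w| <= K) ->
      forall w, (@lebesgue_measure R).-integrable `[0, s] (EFin \o be ^~ w).
    move=> mb bK w; apply: (bounded_section_integrable w s0 (joint_measurable_sub sT' mb) (K := K)).
    by move=> r w' /andP[r0 rs]; apply: bK; rewrite r0 (le_trans rs).
  have i1 := int K1 be1 mb1 (fun r w h => (K1b r w h).1).
  have i2 := int K2 be2 mb2 (fun r w h => (K2b r w h).1).
  have sc (z : R) (be : R -> Omega -> R) w : (@lebesgue_measure R).-integrable `[0, s] (EFin \o be ^~ w) ->
      (@lebesgue_measure R).-integrable `[0, s] (EFin \o (fun r => z * be r w)).
    move=> hb; rewrite (_ : _ \o _ = fun r => (z%:E * (be r w)%:E)%E).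
      exact: integrableZl.
    by apply/funext => r /=; rewrite EFinM.
  apply: filterS2 e1 e2 => w -> ->.
  rewrite /tint RintegralD//; [|exact: sc|exact: sc].
  by rewrite !RintegralZl//; ring.
Qed.

Lemma ito_processD K1 D1 be1 ga1 K2 D2 be2 ga2 :
  ito_process K1 D1 be1 ga1 -> ito_process K2 D2 be2 ga2 ->
  ito_process (K1 + K2) (fun s w => D1 s w + D2 s w)
    (fun s w => be1 s w + be2 s w) (fun l s w => ga1 l s w + ga2 l s w).
Proof.
move=> h1 h2; have := ito_process_lin 1 1 h1 h2; rewrite normr1 !mul1r.
by under eq_fun do under eq_fun do rewrite !mul1r;
  under [X in ito_process _ _ X]eq_fun do under eq_fun do rewrite !mul1r;
  under [X in ito_process _ _ _ X]eq_fun do under eq_fun do under eq_fun do rewrite !mul1r.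
Qed.

Lemma ito_processB K1 D1 be1 ga1 K2 D2 be2 ga2 :
  ito_process K1 D1 be1 ga1 -> ito_process K2 D2 be2 ga2 ->
  ito_process (K1 + K2) (fun s w => D1 s w - D2 s w)
    (fun s w => be1 s w - be2 s w) (fun l s w => ga1 l s w - ga2 l s w).
Proof.
move=> h1 h2; have := ito_process_lin 1 (- 1) h1 h2.
rewrite normrN normr1 !mul1r.
by under eq_fun do under eq_fun do rewrite mul1r mulN1r;
  under [X in ito_process _ _ X]eq_fun do under eq_fun do rewrite mul1r mulN1r;
  under [X in ito_process _ _ _ X]eq_fun do under eq_fun do under eq_fun do rewrite mul1r mulN1r.
Qed.

Section moments.
Variables (K : R) (D be : R -> Omega -> R) (ga : 'I_m -> R -> Omega -> R).
Hypothesis Dito : ito_process K D be ga.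
Variables (s c1 c2 : R).
Hypothesis sT : 0 <= s <= T.

Let s0 : 0 <= s. Proof. by case/andP: sT. Qed.
Let sT' : s <= T. Proof. by case/andP: sT. Qed.

Let mb : joint_measurable s be.
Proof. by have [_ mb _ _ _] := Dito; exact: joint_measurable_sub mb. Qed.

Let beK r w : 0 <= r <= s -> `|be r w| <= K.
Proof.
move=> /andP[r0 rs]; have [_ _ _ h _] := Dito.
by apply: (h r w _).1; rewrite r0 (le_trans rs).
Qed.

Let gaK l r w : 0 <= r <= s -> `|ga l r w| <= K.
Proof.
move=> /andP[r0 rs]; have [_ _ _ h _] := Dito.
by apply: (h r w _).2; rewrite r0 (le_trans rs).
Qed.

Let K0 : 0 <= K.
Proof.
have [w _] : [set: Omega] !=set0 by exists point.
by apply: le_trans (normr_ge0 _) (beK w (r := 0) _); rewrite lexx.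
Qed.

Let powK n (x : R) : `|x| <= K -> ~~ odd n -> 0 <= x ^+ n <= K ^+ n.
Proof.
move=> xK n_even; rewrite exprn_even_ge0//= -[x ^+ n]ger0_norm ?exprn_even_ge0//.
by rewrite normrX lerXn2r ?nnegrE.
Qed.

Let mDs : measurable_fun setT (D s).
Proof. by have [_ _ mD _ _] := Dito; exact: mD. Qed.

Let mbn n : joint_measurable s (fun r w => be r w ^+ n).
Proof. exact: measurable_funX. Qed.

Let mtint n : ~~ odd n -> measurable_fun setT (tint s (fun r w => be r w ^+ n)).
Proof.
by move=> hn; apply: (measurable_tint_ge0 (K := K ^+ n)) => // r w /beK/powK; apply.
Qed.

Let tint0 n : ~~ odd n -> forall w, 0 <= tint s (fun r w => be r w ^+ n) w.
Proof.
by move=> hn w; apply: (tint_ge0 (K := K ^+ n)) => // r w' /beK/powK; apply.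
Qed.

Let tintE_le n c : ~~ odd n -> process_le P s (fun r w => be r w ^+ n) c ->
  E_le (tint s (fun r w => be r w ^+ n)) c.
Proof.
by move=> hn; apply: (tint_E_le (K := K ^+ n)) => // r w /beK/powK; apply.
Qed.

Lemma ito_process_moment2 :
  process_le P s (fun r w => be r w ^+ 2) c1 ->
  process_le P s (fun r w => \sum_l ga l r w ^+ 2) c2 ->
  E_le (fun w => D s w ^+ 2) (2 * (T * c1) + 2 * (260 * m%:R * c2)).
Proof.
move=> hb hg; have [_ _ _ _ /(_ s sT)[I hI DI]] := Dito; have [_ mI _] := hI.
have hI2 := ito_moment2 Pcomplete Wbm X0cst s0 sT' hI hg.
have mt := mtint (n := 2) isT; have t0 := tint0 (n := 2) isT.
have mI2 : measurable_fun setT (fun w => I w ^+ 2) by exact: measurable_funX.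
have T20 : 0 <= 2 * T by nonneg.
rewrite [2 * (T * c1)]mulrA.
apply: (@int_le_mono_ae _ _ _ _ _ _ _ (fun w => 2 * T * tint s (fun r w => be r w ^+ 2) w + 2 * I w ^+ 2)) => //.
- exact: measurable_funX.
- by apply: measurable_funD; exact: measurable_funM.
- by move=> w _; nonneg.
- by move=> w _; have := t0 w => ?; nonneg.
- apply: filterS DI => w -> _.
  have := sqr_tint_le w s0 mb beK; have := sqr_ge0 (tint s be w - I w).
  by have := ler_wpM2r (t0 w) sT'; nra.
- apply: (int_le_lin2 measurableT mt mI2); [|by move=> *; nonneg|by []|by []| |exact: tintE_le|exact: hI2].
    by move=> w _; exact: t0.
  by move=> w _; rewrite lexx andbT; have := t0 w => ?; nonneg.
Qed.

Lemma ito_process_moment4 :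
  process_le P s (fun r w => be r w ^+ 4) c1 ->
  process_le P s (fun r w => \sum_l ga l r w ^+ 4) c2 ->
  E_le (fun w => D s w ^+ 4)
    (8 * (T ^+ 3 * c1) + 8 * (64 * moment4_const (R := R) (m := m) T * c2)).
Proof.
move=> hb hg; have [_ _ _ _ /(_ s sT)[I hI DI]] := Dito; have [_ mI _] := hI.
have hI2 := ito_moment4 Pcomplete Wbm X0cst s0 sT' hI gaK hg K0.
have T3 : 0 <= 8 * T ^+ 3 by rewrite mulr_ge0// exprn_ge0.
have mt := mtint (n := 4) isT; have t0 := tint0 (n := 4) isT.
have mI4 : measurable_fun setT (fun w => I w ^+ 4) by exact: measurable_funX.
rewrite [8 * (T ^+ 3 * c1)]mulrA.
apply: (@int_le_mono_ae _ _ _ _ _ _ _ (fun w => 8 * T ^+ 3 * tint s (fun r w => be r w ^+ 4) w + 8 * I w ^+ 4)) => //.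
- exact: measurable_funX.
- by apply: measurable_funD; exact: measurable_funM.
- by move=> w _; nonneg.
- by move=> w _; have := t0 w => ?; nonneg.
- apply: filterS DI => w -> _.
  apply: le_trans (pow4D_le _ _) _; rewrite lerD2r -mulrA ler_wpM2l//.
  apply: le_trans (pow4_tint_le w s0 mb beK) _.
  by rewrite ler_wpM2r ?t0// lerXn2r ?nnegrE.
- apply: (int_le_lin2 measurableT mt mI4); [|by move=> *; nonneg|by []|by []| |exact: tintE_le|exact: hI2].
    by move=> w _; exact: t0.
  by move=> w _; rewrite lexx andbT; have := t0 w => ?; nonneg.
Qed.

End moments.

Lemma ito_process_bounded2 K : exists K0, forall D be ga, ito_process K D be ga ->
  forall s : R, 0 <= s <= T -> E_le (fun w => D s w ^+ 2) K0.
Proof.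
exists (2 * (T * (K ^+ 2 * T)) + 2 * (260 * m%:R * (m%:R * K ^+ 2 * T))).
move=> D be ga Dito s sT; have /andP[s0 sT'] := sT.
have [_ mb _ bK Ds] := Dito; have [I [mg _ _] _] := Ds s sT.
have [w0 _] : [set: Omega] !=set0 by exists point.
have K2 (x : R) : `|x| <= K -> 0 <= x ^+ 2 <= K ^+ 2.
  by move=> xK; rewrite sqr_ge0 -real_normK ?num_real// lerXn2r ?nnegrE// (le_trans _ xK).
have rT (r : R) : 0 <= r <= s -> 0 <= r <= T.
  by move=> /andP[-> rs]; exact: le_trans rs sT'.
apply: (ito_process_moment2 Dito sT).
- apply: (@process_le_wk _ _ _ _ _ _ (K ^+ 2 * s)); first by rewrite ler_wpM2l ?sqr_ge0.
  apply: process_le_bound => //.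
    by apply: measurable_funX; exact: joint_measurable_sub mb.
  by move=> r w /rT rT'; apply: K2; have [] := bK r w rT'.
- apply: (@process_le_wk _ _ _ _ _ _ (m%:R * K ^+ 2 * s)); first by rewrite ler_wpM2l//; nonneg.
  apply: process_le_bound => //.
    by apply: measurable_sum => l; apply: measurable_funX; exact: mg.
  move=> r w /rT rT'; apply/andP; split; first by nonneg.
  apply: (@le_trans _ _ (\sum_(l < m) K ^+ 2)); last by rewrite sumr_const card_ord mulr_natl.
  by apply: ler_sum => l _; have [_ /(_ l)/K2/andP[]] := bK r w rT'.
Qed.

Lemma ito_process_bounded4 K : exists K0, forall D be ga, ito_process K D be ga ->
  forall s : R, 0 <= s <= T -> E_le (fun w => D s w ^+ 4) K0.
Proof.
exists (8 * (T ^+ 3 * (K ^+ 4 * T)) +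
  8 * (64 * moment4_const (R := R) (m := m) T * (m%:R * K ^+ 4 * T))).
move=> D be ga Dito s sT; have /andP[s0 sT'] := sT.
have [_ mb _ bK Ds] := Dito; have [I [mg _ _] _] := Ds s sT.
have K4 (x : R) : `|x| <= K -> 0 <= x ^+ 4 <= K ^+ 4.
  move=> xK; rewrite exprn_even_ge0//= -[x ^+ 4]ger0_norm ?exprn_even_ge0// normrX.
  by rewrite lerXn2r ?nnegrE// (le_trans _ xK).
have K40 : 0 <= K ^+ 4 by rewrite exprn_even_ge0.
have rT (r : R) : 0 <= r <= s -> 0 <= r <= T.
  by move=> /andP[-> rs]; exact: le_trans rs sT'.
apply: (ito_process_moment4 Dito sT).
- apply: (@process_le_wk _ _ _ _ _ _ (K ^+ 4 * s)); first by rewrite ler_wpM2l.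
  apply: process_le_bound => //.
    by apply: measurable_funX; exact: joint_measurable_sub mb.
  by move=> r w /rT rT'; apply: K4; have [] := bK r w rT'.
- apply: (@process_le_wk _ _ _ _ _ _ (m%:R * K ^+ 4 * s)); first by rewrite ler_wpM2l//; nonneg.
  apply: process_le_bound => //.
    by apply: measurable_sum => l; apply: measurable_funX; exact: mg.
  move=> r w /rT rT'; apply/andP; split; first by nonneg.
  apply: (@le_trans _ _ (\sum_(l < m) K ^+ 4)); last by rewrite sumr_const card_ord mulr_natl.
  by apply: ler_sum => l _; have [_ /(_ l)/K4/andP[]] := bK r w rT'.
Qed.

End dynamics.

(** * Pointwise bounds on first- and second-order errors *)

Ltac le_ring := rewrite le_eqVlt; apply/orP; left; apply/eqP; ring.

Section affine_bounds.
Context d (T : measurableType d) (R : realType) (mu : {measure set T -> \bar R}).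
Variable D : set T.
Hypothesis mD : measurable D.

Lemma int_le_affine (f F1 F2 : T -> R) (p1 p2 q c1 c2 v : R) :
  measurable_fun D F1 -> measurable_fun D F2 ->
  (forall x, D x -> 0 <= F1 x) -> (forall x, D x -> 0 <= F2 x) ->
  0 <= p1 -> 0 <= p2 -> 0 <= q -> (mu D <= v%:E)%E ->
  (forall x, D x -> 0 <= f x <= p1 * F1 x + p2 * F2 x + q) ->
  int_le mu D F1 c1 -> int_le mu D F2 c2 ->
  int_le mu D f (p1 * c1 + p2 * c2 + q * v).
Proof.
move=> mF1 mF2 F10 F20 p10 p20 q0 Dv fF F1c F2c; rewrite -[q * v]mul1r.
have -> : p1 * c1 + p2 * c2 = 1 * (p1 * c1 + p2 * c2) by rewrite mul1r.
pose F x := p1 * F1 x + p2 * F2 x.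
have mF : measurable_fun D F by apply: measurable_funD; exact: measurable_funM.
have F0 x : D x -> 0 <= F x by move=> Dx; rewrite addr_ge0// mulr_ge0 ?F10 ?F20.
apply: (int_le_lin2 mD mF (F2 := fun=> q)) => //; last exact: int_le_cst.
  by move=> x Dx; rewrite !mul1r; exact: fF.
by apply: (int_le_lin2 mD mF1 mF2) => // x Dx; rewrite F0 /=.
Qed.

End affine_bounds.

Section pointwise_bounds.
Context {R : realType} {d k : nat}.
Implicit Types (z : 'cV[R]_d) (e : 'cV[R]_k).

Lemma norm1_sqr_le z : norm1 z ^+ 2 <= d%:R * \sum_c z c 0 ^+ 2.
Proof.
have := sqr_sum_le (fun c : 'I_d => `|z c 0|); rewrite card_ord.
by under [X in _ <= _ * X -> _]eq_bigr do rewrite real_normK ?num_real//.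
Qed.

Lemma norm1_pow4_le z : norm1 z ^+ 4 <= d%:R ^+ 3 * \sum_c z c 0 ^+ 4.
Proof.
have := pow4_sum_le (fun c : 'I_d => `|z c 0|); rewrite card_ord.
by under [X in _ <= _ * X -> _]eq_bigr do rewrite -normrX ger0_norm ?exprn_even_ge0//.
Qed.

Lemma pow4_lip_le (C0 v del : R) z e : 0 <= C0 ->
  `|v| <= C0 * (norm1 z + norm1 e) -> norm1 e <= del ->
  v ^+ 4 <= C0 ^+ 4 * 8 * d%:R ^+ 3 * (\sum_c z c 0 ^+ 4) + C0 ^+ 4 * 8 * del ^+ 4.
Proof.
move=> C00 vz ed; rewrite -[v ^+ 4]ger0_norm ?exprn_even_ge0// normrX.
have e0 := norm1_ge0 e; have z0 := norm1_ge0 z.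
have del0 := le_trans e0 ed.
apply: (@le_trans _ _ ((C0 * (norm1 z + norm1 e)) ^+ 4)).
  by rewrite lerXn2r ?nnegrE//; nonneg.
have h : (norm1 z + norm1 e) ^+ 4 <= 8 * (d%:R ^+ 3 * \sum_c z c 0 ^+ 4) + 8 * del ^+ 4.
  apply: le_trans (pow4D_le _ _) _; rewrite lerD ?ler_wpM2l ?norm1_pow4_le//.
  by rewrite lerXn2r ?nnegrE.
have C4 : 0 <= C0 ^+ 4 by rewrite exprn_ge0.
by rewrite exprMn; apply: le_trans (ler_wpM2l C4 h) _; rewrite mulrDr !mulrA.
Qed.

Lemma sqr_scale_le (x del : R) : 0 < del -> x ^+ 2 <= x ^+ 4 / del ^+ 2 + del ^+ 2.
Proof.
move=> d0; have d2 : 0 < del ^+ 2 by rewrite exprn_gt0.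
rewrite -(ler_pM2r d2) mulrDl divfK ?gt_eqF//.
have -> : x ^+ 4 = (x ^+ 2) ^+ 2 by rewrite -exprM.
move: (x ^+ 2) (del ^+ 2) => a b; have := sqr_ge0 (a - b); have := sqr_ge0 a; have := sqr_ge0 b; nra.
Qed.

Lemma abs_scale_le (x del : R) : 0 < del -> `|x| <= x ^+ 4 / del ^+ 3 + del.
Proof.
move=> d0; have d3 : 0 < del ^+ 3 by rewrite exprn_gt0.
have -> : x ^+ 4 = `|x| ^+ 4 by rewrite -normrX ger0_norm// exprn_even_ge0.
move: (normr_ge0 x); move: `|x| => {x} x x0.
have [xd|dx] := leP x del.
  by apply: (le_trans xd); rewrite lerDr divr_ge0// ?exprn_ge0// ltW.
rewrite (@le_trans _ _ (x ^+ 4 / del ^+ 3))//; last by rewrite lerDl ltW.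
rewrite ler_pdivlMr// [x ^+ 4]exprS ler_wpM2l//.
by rewrite lerXn2r ?nnegrE//; exact: ltW.
Qed.

(** For [v] bounded as in [coef_second], in terms of the moments under control:
    squares of the second difference [z], fourth powers of the first
    differences [z1] and [z2]. These are of size [del], which fixes the
    weights. *)
Lemma sqr_second_le (C0 eta del v : R) z z1 z2 e : 0 <= C0 -> 0 <= eta -> 0 < del ->
  norm1 e <= del ->
  `|v| <= 2 * C0 * norm1 z + eta * (norm1 z1 + norm1 z2) +
    C0 * (norm1 z1 ^+ 2 + norm1 z2 ^+ 2) + 2 * eta * norm1 e ->
  v ^+ 2 <= 16 * C0 ^+ 2 * d%:R * (\sum_c z c 0 ^+ 2) +
    (8 * eta ^+ 2 / del ^+ 2 + 8 * C0 ^+ 2) * d%:R ^+ 3 *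
      (\sum_c (z1 c 0 ^+ 4 + z2 c 0 ^+ 4)) + 32 * (eta ^+ 2 * del ^+ 2).
Proof.
move=> C00 eta0 del0 ed vle.
have n0 := norm1_ge0 z; have n1 := norm1_ge0 z1; have n2 := norm1_ge0 z2.
have ne := norm1_ge0 e.
have d2 : 0 < del ^+ 2 by rewrite exprn_gt0.
have h := norm1_sqr_le z.
have q : norm1 z1 ^+ 4 + norm1 z2 ^+ 4 <= d%:R ^+ 3 * \sum_c (z1 c 0 ^+ 4 + z2 c 0 ^+ 4).
  by rewrite big_split/= mulrDr lerD// norm1_pow4_le.
have k0 : 0 <= 8 * eta ^+ 2 / del ^+ 2 + 8 * C0 ^+ 2 by nonneg; exact: ltW.
have q' := ler_wpM2l k0 q.
have h' : 16 * C0 ^+ 2 * norm1 z ^+ 2 <= 16 * C0 ^+ 2 * (d%:R * \sum_c z c 0 ^+ 2).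
  by rewrite ler_wpM2l//; nonneg.
have s1 := sqr_scale_le (norm1 z1) del0; have s2 := sqr_scale_le (norm1 z2) del0.
have e2 : norm1 e ^+ 2 <= del ^+ 2 by rewrite lerXn2r ?nnegrE// ltW.
apply: (@le_trans _ _ (16 * C0 ^+ 2 * norm1 z ^+ 2 +
  (8 * eta ^+ 2 / del ^+ 2 + 8 * C0 ^+ 2) * (norm1 z1 ^+ 4 + norm1 z2 ^+ 4) +
  32 * (eta ^+ 2 * del ^+ 2))); last by rewrite lerD2r -!mulrA in h' q' *; rewrite !mulrA in h' q' *; exact: lerD.
have v2 : v ^+ 2 <= (2 * C0 * norm1 z + eta * (norm1 z1 + norm1 z2) +
    C0 * (norm1 z1 ^+ 2 + norm1 z2 ^+ 2) + 2 * eta * norm1 e) ^+ 2.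
  rewrite -[v ^+ 2]ger0_norm ?sqr_ge0// normrX lerXn2r ?nnegrE//.
  exact: le_trans (normr_ge0 _) vle.
apply: (le_trans v2); clear v2 vle h h' q q' k0.
move: (norm1 z) (norm1 z1) (norm1 z2) (norm1 e) n0 n1 n2 ne ed s1 s2 e2 => x a b c.
move=> x0 a0 b0 c0 cd s1 s2 e2.
have sq4 (p q r s : R) : (p + q + r + s) ^+ 2 <= 4 * (p ^+ 2 + q ^+ 2 + r ^+ 2 + s ^+ 2).
  have := sqr_ge0 (p - q); have := sqr_ge0 (p - r); have := sqr_ge0 (p - s).
  have := sqr_ge0 (q - r); have := sqr_ge0 (q - s); have := sqr_ge0 (r - s); nra.
apply: (le_trans (sq4 _ _ _ _)).
have a1 : (eta * (a + b)) ^+ 2 <= 2 * eta ^+ 2 * (a ^+ 2 + b ^+ 2).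
  have h : (a + b) ^+ 2 <= 2 * (a ^+ 2 + b ^+ 2) by have := sqr_ge0 (a - b); nra.
  by have := ler_wpM2l (sqr_ge0 eta) h; rewrite exprMn => /le_trans; apply; le_ring.
have a2 : eta ^+ 2 * (a ^+ 2 + b ^+ 2) <=
    eta ^+ 2 / del ^+ 2 * (a ^+ 4 + b ^+ 4) + 2 * (eta ^+ 2 * del ^+ 2).
  have -> : eta ^+ 2 / del ^+ 2 * (a ^+ 4 + b ^+ 4) + 2 * (eta ^+ 2 * del ^+ 2) =
    eta ^+ 2 * ((a ^+ 4 / del ^+ 2 + del ^+ 2) + (b ^+ 4 / del ^+ 2 + del ^+ 2)) by ring.
  by rewrite ler_wpM2l ?sqr_ge0// lerD.
have a3 : (C0 * (a ^+ 2 + b ^+ 2)) ^+ 2 <= 2 * C0 ^+ 2 * (a ^+ 4 + b ^+ 4).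
  have h : (a ^+ 2 + b ^+ 2) ^+ 2 <= 2 * (a ^+ 4 + b ^+ 4).
    rewrite (exprM a 2 2) (exprM b 2 2).
    move: (a ^+ 2) (b ^+ 2) => a' b'; have := sqr_ge0 (a' - b'); nra.
  by have := ler_wpM2l (sqr_ge0 C0) h; rewrite exprMn => /le_trans; apply; le_ring.
have a4 : (2 * eta * c) ^+ 2 <= 4 * (eta ^+ 2 * del ^+ 2).
  rewrite !exprMn -mulrA (_ : 2 ^+ 2 = 4 :> R); last by ring.
  by rewrite ler_wpM2l// ler_wpM2l ?sqr_ge0.
apply: (@le_trans _ _ (4 * ((2 * C0 * x) ^+ 2 + 2 * eta ^+ 2 * (a ^+ 2 + b ^+ 2) +
  2 * C0 ^+ 2 * (a ^+ 4 + b ^+ 4) + 4 * (eta ^+ 2 * del ^+ 2)))).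
  by rewrite ler_wpM2l// lerD// lerD// lerD.
have -> : 4 * ((2 * C0 * x) ^+ 2 + 2 * eta ^+ 2 * (a ^+ 2 + b ^+ 2) +
    2 * C0 ^+ 2 * (a ^+ 4 + b ^+ 4) + 4 * (eta ^+ 2 * del ^+ 2)) =
  8 * (eta ^+ 2 * (a ^+ 2 + b ^+ 2)) + (16 * C0 ^+ 2 * x ^+ 2 +
    8 * C0 ^+ 2 * (a ^+ 4 + b ^+ 4) + 16 * (eta ^+ 2 * del ^+ 2)) by ring.
have h8 : 0 <= 8 :> R by exact: ler0n.
apply: (le_trans (lerD (ler_wpM2l h8 a2) (lexx _))); le_ring.
Qed.

(** The bound of [coef_second] itself, for costs: [z] is of size [eta * del], and
    [z1] and [z2] are of size [del], so each term is traded for the controlled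
    power at that scale. *)
Lemma abs_second_le (C0 eta del : R) z z1 z2 e : 0 <= C0 -> 0 < del -> del <= eta ->
  norm1 e <= del ->
  2 * C0 * norm1 z + eta * (norm1 z1 + norm1 z2) +
    C0 * (norm1 z1 ^+ 2 + norm1 z2 ^+ 2) + 2 * eta * norm1 e <=
  (2 * C0 / (eta * del)) * (\sum_c z c 0 ^+ 2) +
    (eta / del ^+ 3 + C0 * d%:R ^+ 3 / del ^+ 2) *
      (\sum_c (z1 c 0 ^+ 4 + z2 c 0 ^+ 4)) +
    (2 * C0 * d%:R + 2 * d%:R + 2 * C0 + 2) * (eta * del).
Proof.
move=> C00 del0 de ed; have eta0 := lt_le_trans del0 de.
have ed0 : 0 < eta * del by rewrite mulr_gt0.
have S1 : norm1 z <= (\sum_c z c 0 ^+ 2) / (eta * del) + d%:R * (eta * del).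
  rewrite mulr_suml mulr_natl -[d in X in _ <= _ + X]card_ord -sumr_const -big_split/=.
  apply: ler_sum => c _; move: (eta * del) ed0 => y y0.
  rewrite -(ler_pM2r y0) mulrDl divfK ?gt_eqF// -(real_normK (num_real (z c 0))).
  by have := sqr_ge0 (`|z c 0| - y); have := sqr_ge0 y; have := sqr_ge0 (`|z c 0|); nra.
have S2 : norm1 z1 + norm1 z2 <=
    (\sum_c (z1 c 0 ^+ 4 + z2 c 0 ^+ 4)) / del ^+ 3 + 2 * d%:R * del.
  have -> : 2 * d%:R * del = \sum_(c < d) (2 * del).
    by rewrite sumr_const card_ord -mulr_natr; ring.
  rewrite mulr_suml -!big_split/=; apply: ler_sum => c _.
  have := lerD (abs_scale_le (z1 c 0) del0) (abs_scale_le (z2 c 0) del0).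
  move/le_trans; apply; rewrite mulrDl; lra.
have S3 : norm1 z1 ^+ 2 + norm1 z2 ^+ 2 <=
    d%:R ^+ 3 * (\sum_c (z1 c 0 ^+ 4 + z2 c 0 ^+ 4)) / del ^+ 2 + 2 * del ^+ 2.
  have := lerD (sqr_scale_le (norm1 z1) del0) (sqr_scale_le (norm1 z2) del0).
  move/le_trans; apply; rewrite addrACA -mulrDl; apply: lerD; last lra.
  rewrite ler_wpM2r ?invr_ge0 ?sqr_ge0//.
  by rewrite big_split/= mulrDr lerD// norm1_pow4_le.
have dd : del ^+ 2 <= eta * del by rewrite expr2 ler_pM2r.
have T1 : 2 * C0 * norm1 z <=
  (2 * C0 / (eta * del)) * (\sum_c z c 0 ^+ 2) + 2 * C0 * d%:R * (eta * del).
  have C20 : 0 <= 2 * C0 by nonneg.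
  apply: le_trans (ler_wpM2l C20 S1) _; le_ring.
have T2 : eta * (norm1 z1 + norm1 z2) <=
  eta / del ^+ 3 * (\sum_c (z1 c 0 ^+ 4 + z2 c 0 ^+ 4)) + 2 * d%:R * (eta * del).
  apply: le_trans (ler_wpM2l (ltW eta0) S2) _; le_ring.
have T3 : C0 * (norm1 z1 ^+ 2 + norm1 z2 ^+ 2) <=
  C0 * d%:R ^+ 3 / del ^+ 2 * (\sum_c (z1 c 0 ^+ 4 + z2 c 0 ^+ 4)) + 2 * C0 * (eta * del).
  apply: le_trans (ler_wpM2l C00 S3) _.
  have := ler_wpM2l C00 dd.
  have -> : C0 * (d%:R ^+ 3 * (\sum_c (z1 c 0 ^+ 4 + z2 c 0 ^+ 4)) / del ^+ 2 + 2 * del ^+ 2) =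
    C0 * d%:R ^+ 3 / del ^+ 2 * (\sum_c (z1 c 0 ^+ 4 + z2 c 0 ^+ 4)) + 2 * (C0 * del ^+ 2) by ring.
  rewrite -[2 * C0 * _]mulrA; lra.
have T4 : 2 * eta * norm1 e <= 2 * (eta * del).
  by rewrite -mulrA ler_wpM2l// ler_wpM2l// ltW.
apply: (le_trans (lerD (lerD (lerD T1 T2) T3) T4)); le_ring.
Qed.

End pointwise_bounds.

(** * Expansion of the state in the control *)

Section state_expansion.
Context {R : realType} {dO : measure_display} {Omega : measurableType dO}.
Context (P : probability Omega R) {d k m : nat}.
Variables (T : R) (W : R -> Omega -> 'cV[R]_m) (X0 : Omega -> 'cV[R]_d).
Variable U : set 'cV[R]_k.
Variable b : R -> 'cV[R]_d -> 'cV[R]_k -> 'cV[R]_d.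
Variable sigma : R -> 'cV[R]_d -> 'cV[R]_k -> 'M[R]_(d, m).
Variable f : R -> 'cV[R]_d -> R.
Variable g : 'cV[R]_d -> R.
Variables (C0 : R) (rho : R -> R).
Hypothesis T0 : 0 < T.
Hypothesis Pcomplete : measure_is_complete P.
Hypothesis Wbm : brownian_motion P T W.
Hypothesis X0cst : exists x0, X0 = cst x0.
Hypothesis Uclosed : closed U.
Hypothesis mcoef : measurable_coefficients T U b sigma f g.
Hypotheses (C00 : 0 < C0) (rho_mod : modulus_of_continuity rho).
Hypothesis b_C2 : forall t u, 0 <= t <= T -> U u -> classC2 (fun x => b t x u).
Hypothesis s_C2 : forall t u, 0 <= t <= T -> U u -> classC2 (fun x => sigma t x u).
Hypotheses (b_x : x_regular T U C0 rho b) (s_x : x_regular T U C0 rho sigma).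
Hypotheses (b_u : u_regular T U C0 rho b) (s_u : u_regular T U C0 rho sigma).
Local Notation admissible := (admissible P T W X0 U 0).
Local Notation state := (state_process P T W X0 b sigma 0 X0).
Local Notation E_le := (int_le P setT).

Lemma state_ito_process v Y a : admissible v -> state v Y ->
  ito_process P T W X0 C0 (fun s w => Y s w a 0 - X0 w a 0)
    (fun r w => b r (Y r w) (v r w) a 0)
    (fun l r w => sigma r (Y r w) (v r w) a l).
Proof.
move=> vadm Ystate; have [Uv _ _ _] := vadm; have [x0 X0E] := X0cst.
split.
- rewrite X0E; apply: measurable_funB => //.
  exact: (state_joint_measurable Pcomplete Wbm X0cst Ystate a).
- exact: (drift_joint_measurable Pcomplete Wbm X0cst Uclosed mcoef vadm Ystate).
- move=> s sT; rewrite X0E; apply: measurable_funB => //.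
  exact: (state_measurable Pcomplete Wbm X0cst Ystate).
- move=> r w rT; split => [|l].
    exact: (coef_bound b_u a 0 rT _ (Uv r w rT)).
  exact: (coef_bound s_u a l rT _ (Uv r w rT)).
- move=> s sT; have [I hI XI] := state_decomposition Pcomplete Wbm X0cst Ystate a sT.
  exists I => //; apply: filterS XI => w ->; rewrite /tint; ring.
Qed.

Variables (u : R -> Omega -> 'cV[R]_k) (X : R -> Omega -> 'cV[R]_d).
Hypothesis uadm : admissible u.
Hypothesis Xstate : state u X.

Definition small_shift (e : R -> Omega -> 'cV[R]_k) del :=
  forall r w, 0 <= r <= T -> inner_shift U (u r w) (e r w) /\ norm1 (e r w) <= del.

Definition shifted (e : R -> Omega -> 'cV[R]_k) r w := u r w + e r w.

Lemma small_shiftN e del : small_shift e del -> small_shift (fun r w => - e r w) del.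
Proof.
move=> es r w rT; have [h hd] := es r w rT; split; first exact: inner_shiftN.
by rewrite /norm1; under eq_bigr do rewrite mxE normrN.
Qed.

Let C2 := C0 + C0.

Lemma state_difference_ito e Y a : admissible (shifted e) -> state (shifted e) Y ->
  ito_process P T W X0 C2 (fun s w => (Y s w - X s w) a 0)
    (fun r w => b r (Y r w) (shifted e r w) a 0 - b r (X r w) (u r w) a 0)
    (fun l r w => sigma r (Y r w) (shifted e r w) a l - sigma r (X r w) (u r w) a l).
Proof.
move=> eadm Ystate.
have := ito_processB (state_ito_process a eadm Ystate)
  (state_ito_process a uadm Xstate).
rewrite (_ : (fun s w => _ - _ - _) = (fun s w => (Y s w - X s w) a 0))//.
by apply/funext => s; apply/funext => w; rewrite !mxE; ring.
Qed.

Lemma process_le_affine s (h F1 F2 : R -> Omega -> R) (p1 p2 q c1 c2 : R) :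
  0 <= s -> joint_measurable s F1 -> joint_measurable s F2 ->
  (forall r w, 0 <= F1 r w) -> (forall r w, 0 <= F2 r w) ->
  0 <= p1 -> 0 <= p2 -> 0 <= q ->
  (forall r w, 0 <= r <= s -> 0 <= h r w <= p1 * F1 r w + p2 * F2 r w + q) ->
  process_le P s F1 c1 -> process_le P s F2 c2 ->
  process_le P s h (p1 * c1 + p2 * c2 + q * s).
Proof.
move=> s0 mF1 mF2 F10 F20 p10 p20 q0 hF.
apply: int_le_affine => //; first exact: measurable_slab.
  exact: slab_measure_le.
by move=> [r w] [/=]; rewrite in_itv/= => rs _; exact: hF.
Qed.

(** The coefficients of the difference are Lipschitz in the state and in the
    shift, so its fourth moment satisfies the inequality of [gronwall] with a
    source of order [del ^+ 4]. *)
Lemma state_difference4 : exists2 K, 0 <= K & forall e del Y, 0 <= del ->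
  small_shift e del -> admissible (shifted e) -> state (shifted e) Y ->
  forall a (s : R), 0 <= s <= T ->
  E_le (fun w => (Y s w - X s w) a 0 ^+ 4) (K * del ^+ 4).
Proof.
have [K0 hK0] := ito_process_bounded4 Pcomplete Wbm X0cst (ltW T0) C2.
pose M := 8 * T ^+ 3 + 8 * (64 * moment4_const (R := R) (m := m) T) * m%:R.
have M0 : 0 <= M.
  rewrite /M; have := moment4_const_ge0 (m := m) (ltW T0); have := ltW T0.
  by move=> T0' C40; nonneg.
pose p := C0 ^+ 4 * 8 * d%:R ^+ 3; pose q := C0 ^+ 4 * 8.
have q0 : 0 <= q by rewrite /q; nonneg.
have p0 : 0 <= p by rewrite /p; nonneg.
have p1 : 0 <= m%:R * p by nonneg.
pose B := M * (q * T); have B0 : 0 <= B by rewrite /B; nonneg; exact: ltW.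
exists (2 * B * expR ((2 * (M * p * d%:R) + 1) * T)); first by nonneg.
move=> e del Y del0 es eadm Ystate a s sT.
have d4 : 0 <= del ^+ 4 by nonneg.
have -> : 2 * B * expR ((2 * (M * p * d%:R) + 1) * T) * del ^+ 4 =
  2 * (B * del ^+ 4) * expR ((2 * (M * p * d%:R) + 1) * T) by ring.
have dito a' := state_difference_ito a' eadm Ystate.
pose V (a : 'I_d) r w := (Y r w - X r w) a 0 ^+ 4.
have mV a' : joint_measurable T (V a').
  by have [mD _ _ _ _] := dito a'; exact: measurable_funX.
have V0 a' r w : 0 <= V a' r w by rewrite /V; nonneg.
apply: (@gronwall _ _ _ _ _ T (M * p) (B * del ^+ 4) K0 V) => //.
- by nonneg.
- by nonneg.
- by move=> a' r rT; exact: (hK0 _ _ _ (dito a')).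
move=> {a s sT} a s c sT hc; have /andP[s0 sT'] := sT.
have msV : joint_measurable s (fun r w => \sum_c V c r w).
  by apply: measurable_sum => c'; exact: joint_measurable_sub (mV c').
have sV0 r w : 0 <= \sum_c V c r w by nonneg.
have rT r : 0 <= r <= s -> 0 <= r <= T.
  by move=> /andP[-> rs]; exact: le_trans rs sT'.
have pt p' q' (phi : R -> 'cV[R]_d -> 'cV[R]_k -> 'M[R]_(p', q')) i j r w :
    x_regular T U C0 rho phi -> u_regular T U C0 rho phi -> 0 <= r <= s ->
    (phi r (Y r w) (shifted e r w) i j - phi r (X r w) (u r w) i j) ^+ 4 <=
    p * (\sum_c V c r w) + q * del ^+ 4.
  move=> phi_x phi_u /rT rT'; have [is_e ed] := es r w rT'.
  apply: pow4_lip_le (ltW C00) _ ed.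
  have := coef_lip C00 rho_mod phi_x phi_u i j rT' (X r w) (Y r w - X r w) is_e.
  by rewrite [X r w + _]addrC subrK.
have hb := @process_le_affine s (fun r w => (b r (Y r w) (shifted e r w) a 0 -
    b r (X r w) (u r w) a 0) ^+ 4) _ _ p 0 (q * del ^+ 4) c c s0 msV msV sV0 sV0 p0 (lexx 0).
have hg := @process_le_affine s (fun r w => \sum_l (sigma r (Y r w) (shifted e r w) a l -
    sigma r (X r w) (u r w) a l) ^+ 4) _ _ (m%:R * p) 0 (m%:R * (q * del ^+ 4)) c c
    s0 msV msV sV0 sV0 p1 (lexx 0).
have := ito_process_moment4 Pcomplete Wbm X0cst (ltW T0) (dito a) sT (hb _ _ hc hc) (hg _ _ hc hc).
move=> h; apply: int_le_wk (h _ _ _ _).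
- rewrite (_ : 8 * _ + 8 * _ = M * p * c + M * (q * s) * del ^+ 4); last by rewrite /M; ring.
  by rewrite lerD2l ler_wpM2r// /B !ler_wpM2l.
- by nonneg.
- by move=> r w rs; rewrite mul0r addr0 pt// andbT; nonneg.
- by nonneg.
- move=> r w rs; rewrite mul0r addr0 -mulrA -mulrDr; apply/andP; split; first by nonneg.
  apply: (@le_trans _ _ (\sum_(l < m) (p * (\sum_c V c r w) + q * del ^+ 4))).
    by apply: ler_sum => l _; exact: pt.
  by rewrite sumr_const card_ord -[_ *+ m]mulr_natl.
Qed.

Section opposite_shifts.
Variables (e : R -> Omega -> 'cV[R]_k) (del eta : R) (Y1 Y2 : R -> Omega -> 'cV[R]_d).

(** The states for the controls u + e and u - e; the modulus of continuity is
    at most [eta] up to the size [del] of the shift. *)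
Definition opposite_shifts :=
  [/\ 0 < del, del <= eta, (forall r, 0 <= r <= del -> rho r <= eta) &
      small_shift e del] /\
  [/\ admissible (shifted e), admissible (shifted (fun r w => - e r w)),
      state (shifted e) Y1 & state (shifted (fun r w => - e r w)) Y2].

Definition quartic_error r w :=
  \sum_c ((Y1 r w - X r w) c 0 ^+ 4 + (Y2 r w - X r w) c 0 ^+ 4).

Definition second_difference r w := Y1 r w - X r w + (Y2 r w - X r w).

End opposite_shifts.

Lemma coef_second_shifts p q (phi : R -> 'cV[R]_d -> 'cV[R]_k -> 'M[R]_(p, q))
    e del eta Y1 Y2 i j r w :
  (forall t u, 0 <= t <= T -> U u -> classC2 (fun x => phi t x u)) ->
  x_regular T U C0 rho phi -> u_regular T U C0 rho phi ->
  opposite_shifts e del eta Y1 Y2 -> 0 <= r <= T ->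
  let v := phi r (Y1 r w) (shifted e r w) i j - phi r (X r w) (u r w) i j +
    (phi r (Y2 r w) (shifted (fun r w => - e r w) r w) i j - phi r (X r w) (u r w) i j) in
  `|v| <= 2 * C0 * norm1 (second_difference Y1 Y2 r w) +
    eta * (norm1 (Y1 r w - X r w) + norm1 (Y2 r w - X r w)) +
    C0 * (norm1 (Y1 r w - X r w) ^+ 2 + norm1 (Y2 r w - X r w) ^+ 2) +
    2 * eta * norm1 (e r w).
Proof.
move=> phi_C2 phi_x phi_u [[del0 de rho_eta es] _] rT /=.
have [is_e ed] := es r w rT.
have := coef_second C00 rho_mod phi_C2 phi_x phi_u i j rT (X r w)
  (Y1 r w - X r w) (Y2 r w - X r w) is_e (eta := eta).
rewrite ![X r w + _]addrC !subrK.
rewrite (_ : _ + _ - 2 * _ = phi r (Y1 r w) (shifted e r w) i j - phi r (X r w) (u r w) i j +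
    (phi r (Y2 r w) (shifted (fun r w => - e r w) r w) i j - phi r (X r w) (u r w) i j)).
  apply => r' /andP[r0 r'e]; apply: rho_eta.
  by rewrite r0 (le_trans r'e).
by rewrite /shifted; ring.
Qed.

Lemma quartic_error_le : exists2 K, 0 <= K & forall e del eta Y1 Y2,
  opposite_shifts e del eta Y1 Y2 ->
  [/\ joint_measurable T (quartic_error Y1 Y2),
      forall s : R, 0 <= s <= T -> E_le (quartic_error Y1 Y2 s) (K * del ^+ 4) &
      forall s : R, 0 <= s <= T ->
        process_le P s (quartic_error Y1 Y2) (K * del ^+ 4 * T)].
Proof.
have [K K0 hK] := state_difference4.
exists (d%:R * (2 * K)); first by nonneg.
move=> e del eta Y1 Y2 [[del0 de _ es] [adm1 adm2 st1 st2]].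
have m1 a n : joint_measurable T (fun r w => (Y1 r w - X r w) a 0 ^+ n).
  by have [mD _ _ _ _] := state_difference_ito a adm1 st1; exact: measurable_funX.
have m2 a n : joint_measurable T (fun r w => (Y2 r w - X r w) a 0 ^+ n).
  by have [mD _ _ _ _] := state_difference_ito a adm2 st2; exact: measurable_funX.
have mF : joint_measurable T (quartic_error Y1 Y2).
  apply: measurable_sum => c; apply: measurable_funD; first exact: m1.
  exact: m2.
have E s : 0 <= s <= T -> E_le (quartic_error Y1 Y2 s) (d%:R * (2 * K) * del ^+ 4).
  move=> sT; rewrite (_ : _ * _ * _ = \sum_(c < d) (K * del ^+ 4 + K * del ^+ 4)); last first.
    by rewrite sumr_const card_ord -mulr_natl; ring.
  have n1 a : measurable_fun setT (fun w => (Y1 s w - X s w) a 0 ^+ 4).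
    have [_ _ mD _ _] := state_difference_ito a adm1 st1.
    by apply: measurable_funX; exact: mD.
  have n2 a : measurable_fun setT (fun w => (Y2 s w - X s w) a 0 ^+ 4).
    have [_ _ mD _ _] := state_difference_ito a adm2 st2.
    by apply: measurable_funX; exact: mD.
  apply: int_le_sum => //.
  - by move=> c; apply: measurable_funD.
  - by move=> c w _; nonneg.
  move=> c; apply: int_leD => //.
  - by move=> w _; nonneg.
  - by move=> w _; nonneg.
  - exact: (hK _ _ _ (ltW del0) es adm1 st1).
  - exact: (hK _ _ _ (ltW del0) (small_shiftN es) adm2 st2).
split => // s sT; have /andP[s0 sT'] := sT.
apply: (@process_le_fun _ _ _ _ _ _ (fun=> d%:R * (2 * K) * del ^+ 4)).
- exact: joint_measurable_sub mF.
- by move=> r w _; rewrite /quartic_error; nonneg.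
- by move=> r /andP[r0 rs]; apply: E; rewrite r0 (le_trans rs).
- apply: int_le_cst => //; first by nonneg.
  rewrite /= lebesgue_measure_itv/= lte_fin; case: ifP => _; last by rewrite lee_fin ltW.
  by rewrite -EFinD subr0 lee_fin.
Qed.

(** The sum of the two differences solves a linear inequality whose source is
    of order [eta * del]: the first-order effects of [e] and [- e] cancel, and
    what is quadratic in the differences is controlled by their fourth
    moments. *)
Lemma state_second_difference : exists2 K, 0 <= K & forall e del eta Y1 Y2,
  opposite_shifts e del eta Y1 Y2 ->
  forall a (s : R), 0 <= s <= T ->
  E_le (fun w => second_difference Y1 Y2 s w a 0 ^+ 2) (K * (eta ^+ 2 * del ^+ 2)).
Proof.
have [K0 hK0] := ito_process_bounded2 Pcomplete Wbm X0cst (ltW T0) (C2 + C2).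
have [K4 K40 hK4] := quartic_error_le.
have T0' := ltW T0.
pose M := 2 * T + 2 * (260 * m%:R) * m%:R.
have M0 : 0 <= M by rewrite /M; nonneg.
pose p := 16 * C0 ^+ 2 * d%:R.
have p0 : 0 <= p by rewrite /p; nonneg.
pose B := M * ((8 + 8 * C0 ^+ 2) * d%:R ^+ 3 * K4 * T + 32 * T).
have B0 : 0 <= B by rewrite /B; nonneg.
exists (2 * B * expR ((2 * (M * p * d%:R) + 1) * T)); first by nonneg.
move=> e del eta Y1 Y2 os a s sT.
have [[del0 de rho_eta es] [adm1 adm2 st1 st2]] := os.
have eta0 := lt_le_trans del0 de.
have -> : 2 * B * expR ((2 * (M * p * d%:R) + 1) * T) * (eta ^+ 2 * del ^+ 2) =
  2 * (B * (eta ^+ 2 * del ^+ 2)) * expR ((2 * (M * p * d%:R) + 1) * T) by ring.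
have [mF _ FE] := hK4 _ _ _ _ _ os.
have dito a' := ito_processD (state_difference_ito a' adm1 st1) (state_difference_ito a' adm2 st2).
pose V (a : 'I_d) r w := second_difference Y1 Y2 r w a 0 ^+ 2.
have VE (a' : 'I_d) r w : second_difference Y1 Y2 r w a' 0 =
    (Y1 r w - X r w) a' 0 + (Y2 r w - X r w) a' 0 by rewrite mxE.
have mV a' : joint_measurable T (V a').
  have [mD _ _ _ _] := dito a'; rewrite /V.
  under eq_fun do under eq_fun do rewrite VE.
  exact: measurable_funX.
have V0 a' r w : 0 <= V a' r w by rewrite /V; nonneg.
apply: (@gronwall _ _ _ _ _ T (M * p) (B * (eta ^+ 2 * del ^+ 2)) K0 V) => //.
- by nonneg.
- by nonneg.
- move=> a' r rT; rewrite /V; under eq_fun do rewrite VE.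
  exact: (hK0 _ _ _ (dito a')).
move=> {a s sT} a s c sT hc; have /andP[s0 sT'] := sT.
have msV : joint_measurable s (fun r w => \sum_c V c r w).
  by apply: measurable_sum => c'; exact: joint_measurable_sub (mV c').
have sV0 r w : 0 <= \sum_c V c r w by nonneg.
have msF := joint_measurable_sub sT' mF.
have sF0 r w : 0 <= quartic_error Y1 Y2 r w by rewrite /quartic_error; nonneg.
have rT r : 0 <= r <= s -> 0 <= r <= T.
  by move=> /andP[-> rs]; exact: le_trans rs sT'.
pose p' := (8 * eta ^+ 2 / del ^+ 2 + 8 * C0 ^+ 2) * d%:R ^+ 3.
have p'0 : 0 <= p' by rewrite /p'; nonneg; exact: exprn_ge0 (ltW del0).
pose q := 32 * (eta ^+ 2 * del ^+ 2).
have q0 : 0 <= q by rewrite /q; nonneg.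
have pt n1 n2 (phi : R -> 'cV[R]_d -> 'cV[R]_k -> 'M[R]_(n1, n2)) i j r w :
    (forall t u, 0 <= t <= T -> U u -> classC2 (fun x => phi t x u)) ->
    x_regular T U C0 rho phi -> u_regular T U C0 rho phi -> 0 <= r <= s ->
    (phi r (Y1 r w) (shifted e r w) i j - phi r (X r w) (u r w) i j +
     (phi r (Y2 r w) (shifted (fun r w => - e r w) r w) i j - phi r (X r w) (u r w) i j)) ^+ 2 <=
    p * (\sum_c V c r w) + p' * quartic_error Y1 Y2 r w + q.
  move=> phi_C2 phi_x phi_u /rT rT'; have [_ ed] := es r w rT'.
  apply: sqr_second_le (ltW C00) (ltW eta0) del0 ed _.
  exact: coef_second_shifts os rT'.
have hb := @process_le_affine s (fun r w => (b r (Y1 r w) (shifted e r w) a 0 - b r (X r w) (u r w) a 0 +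
     (b r (Y2 r w) (shifted (fun r w => - e r w) r w) a 0 - b r (X r w) (u r w) a 0)) ^+ 2)
   _ _ p p' q c _ s0 msV msF sV0 sF0 p0 p'0 q0.
have hg := @process_le_affine s (fun r w => \sum_l (sigma r (Y1 r w) (shifted e r w) a l - sigma r (X r w) (u r w) a l +
     (sigma r (Y2 r w) (shifted (fun r w => - e r w) r w) a l - sigma r (X r w) (u r w) a l)) ^+ 2)
   _ _ (m%:R * p) (m%:R * p') (m%:R * q) c _ s0 msV msF sV0 sF0.
have h := ito_process_moment2 Pcomplete Wbm X0cst (ltW T0) (dito a) sT
  (hb _ _ hc (FE s sT)) (hg _ _ _ _ _ hc (FE s sT)).
have VfE : V a s = (fun w => ((Y1 s w - X s w) a 0 + (Y2 s w - X s w) a 0) ^+ 2).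
  by apply/funext => w; rewrite /V VE.
rewrite VfE; apply: int_le_wk (h _ _ _ _ _).
- set z := p * c + p' * (K4 * del ^+ 4 * T) + q * s.
  have z1 : z <= p * c + ((8 + 8 * C0 ^+ 2) * d%:R ^+ 3 * K4 * T + 32 * T) * (eta ^+ 2 * del ^+ 2).
    rewrite /z -addrA lerD2l mulrDl lerD//; last first.
      by rewrite /q mulrAC ler_wpM2r//; [nonneg|rewrite ler_wpM2l].
    rewrite /p'.
    have -> : (8 * eta ^+ 2 / del ^+ 2 + 8 * C0 ^+ 2) * d%:R ^+ 3 * (K4 * del ^+ 4 * T) =
      (8 * eta ^+ 2 + 8 * C0 ^+ 2 * del ^+ 2) * (d%:R ^+ 3 * K4 * T * del ^+ 2).
      by field; rewrite gt_eqF.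
    have -> : (8 + 8 * C0 ^+ 2) * d%:R ^+ 3 * K4 * T * (eta ^+ 2 * del ^+ 2) =
      (8 * eta ^+ 2 + 8 * C0 ^+ 2 * eta ^+ 2) * (d%:R ^+ 3 * K4 * T * del ^+ 2) by ring.
    rewrite ler_wpM2r//; first by nonneg.
    rewrite lerD2l ler_wpM2l//; first by nonneg.
    by rewrite lerXn2r ?nnegrE// ltW.
  apply: (@le_trans _ _ (M * z)); first by rewrite /M /z; le_ring.
  by apply: le_trans (ler_wpM2l M0 z1) _; rewrite /B; le_ring.
- by move=> r w rs; rewrite pt// andbT; nonneg.
- by nonneg.
- by nonneg.
- by nonneg.
- move=> r w rs; rewrite -[m%:R * p * _]mulrA -[m%:R * p' * _]mulrA -!mulrDr.
  apply/andP; split; first by nonneg.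
  apply: (@le_trans _ _ (\sum_(l < m) (p * (\sum_c V c r w) + p' * quartic_error Y1 Y2 r w + q))).
    by apply: ler_sum => l _; exact: pt.
  by rewrite sumr_const card_ord -[_ *+ m]mulr_natl.
Qed.

(** The bound of [abs_second_le], at a given time. *)
Definition second_error del eta Y1 Y2 r w :=
  (2 * C0 / (eta * del)) * (\sum_c second_difference Y1 Y2 r w c 0 ^+ 2) +
  (eta / del ^+ 3 + C0 * d%:R ^+ 3 / del ^+ 2) * quartic_error Y1 Y2 r w +
  (2 * C0 * d%:R + 2 * d%:R + 2 * C0 + 2) * (eta * del).

Lemma second_error_ge0 del eta Y1 Y2 r w : 0 < del -> del <= eta ->
  0 <= second_error del eta Y1 Y2 r w.
Proof.
move=> del0 de; have eta0 := ltW (lt_le_trans del0 de); have C0' := ltW C00.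
have del0' := ltW del0.
by rewrite /second_error /quartic_error; nonneg.
Qed.

Lemma value_second_error (F : R -> 'cV[R]_d -> R) e del eta Y1 Y2 r w :
  (forall t u, 0 <= t <= T -> U u -> classC2 (fun x => (F t x)%:M : 'M[R]_1)) ->
  x_regular T U C0 rho (fun t x _ => (F t x)%:M : 'M[R]_1) ->
  u_regular T U C0 rho (fun t x _ => (F t x)%:M : 'M[R]_1) ->
  opposite_shifts e del eta Y1 Y2 -> 0 <= r <= T ->
  `|F r (Y1 r w) - F r (X r w) + (F r (Y2 r w) - F r (X r w))| <=
  second_error del eta Y1 Y2 r w.
Proof.
move=> F_C2 F_x F_u os rT; have [[del0 de rho_eta es] _] := os.
have [_ ed] := es r w rT.
have := @coef_second_shifts _ _ (fun t x _ => (F t x)%:M : 'M[R]_1) _ _ _ _ _ 0 0 r w F_C2 F_x F_u os rT.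
rewrite /= !mxE eqxx !mulr1n => /le_trans; apply.
exact: abs_second_le (ltW C00) del0 de ed.
Qed.

Lemma second_error_le : exists2 K, 0 <= K & forall e del eta Y1 Y2,
  opposite_shifts e del eta Y1 Y2 ->
  [/\ joint_measurable T (second_error del eta Y1 Y2),
      forall s : R, 0 <= s <= T -> measurable_fun setT (second_error del eta Y1 Y2 s),
      forall s : R, 0 <= s <= T ->
        E_le (second_error del eta Y1 Y2 s) (K * (eta * del)) &
      process_le P T (second_error del eta Y1 Y2) (K * (eta * del) * T)].
Proof.
have [K4 K40 hK4] := quartic_error_le.
have [K2 K20 hK2] := state_second_difference.
have C0' := ltW C00.
pose h1 := 2 * C0 * d%:R + 2 * d%:R + 2 * C0 + 2.
have h10 : 0 <= h1 by rewrite /h1; nonneg.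
pose K := 2 * C0 * d%:R * K2 + (1 + C0 * d%:R ^+ 3) * K4 + h1.
have K0 : 0 <= K by rewrite /K; nonneg.
exists K => //.
move=> e del eta Y1 Y2 os; have [[del0 de _ es] [adm1 adm2 st1 st2]] := os.
have eta0 := lt_le_trans del0 de; have eta0' := ltW eta0; have del0' := ltW del0.
have [mF FE FE'] := hK4 _ _ _ _ _ os.
have dito a := ito_processD (state_difference_ito a adm1 st1) (state_difference_ito a adm2 st2).
have SE r w (a : 'I_d) : second_difference Y1 Y2 r w a 0 =
    (Y1 r w - X r w) a 0 + (Y2 r w - X r w) a 0 by rewrite mxE.
have mS : joint_measurable T (fun r w => \sum_c second_difference Y1 Y2 r w c 0 ^+ 2).
  apply: measurable_sum => c; have [mD _ _ _ _] := dito c.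
  under eq_fun do rewrite SE.
  exact: measurable_funX.
have mE : joint_measurable T (second_error del eta Y1 Y2).
  by apply: measurable_funD => //; apply: measurable_funD; exact: measurable_funM.
have mSs s : 0 <= s <= T ->
    measurable_fun setT (fun w => \sum_c second_difference Y1 Y2 s w c 0 ^+ 2).
  move=> sT; apply: measurable_sum => c; have [_ _ mD _ _] := dito c.
  under eq_fun do rewrite SE.
  by apply: measurable_funX; exact: mD.
have mFs s : 0 <= s <= T -> measurable_fun setT (quartic_error Y1 Y2 s).
  move=> sT; apply: measurable_sum => c; apply: measurable_funD; apply: measurable_funX.
    by have [_ _ mD _ _] := state_difference_ito c adm1 st1; exact: mD.
  by have [_ _ mD _ _] := state_difference_ito c adm2 st2; exact: mD.
have mEs s : 0 <= s <= T -> measurable_fun setT (second_error del eta Y1 Y2 s).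
  move=> sT; apply: measurable_funD => //; apply: measurable_funD.
    by apply: measurable_funM => //; exact: mSs.
  by apply: measurable_funM => //; exact: mFs.
have E s : 0 <= s <= T -> E_le (second_error del eta Y1 Y2 s) (K * (eta * del)).
  move=> sT.
  have hS : E_le (fun w => \sum_c second_difference Y1 Y2 s w c 0 ^+ 2)
      (\sum_(c < d) K2 * (eta ^+ 2 * del ^+ 2)).
    apply: int_le_sum => //.
    - move=> c; under eq_fun do rewrite SE.
      by apply: measurable_funX; have [_ _ mD _ _] := dito c; exact: mD.
    - by move=> c w _; nonneg.
    - by move=> c; exact: hK2 os _ _ sT.
  have P1 : (P setT <= 1%:E)%E by exact: probability_le1.
  have h := @int_le_affine _ _ _ P _ measurableT (second_error del eta Y1 Y2 s) _ _
    (2 * C0 / (eta * del)) (eta / del ^+ 3 + C0 * d%:R ^+ 3 / del ^+ 2)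
    (h1 * (eta * del)) _ _ 1 (mSs s sT) (mFs s sT) _ _ _ _ _ P1 _ hS (FE s sT).
  apply: int_le_wk (h _ _ _ _ _ _).
  - rewrite sumr_const card_ord -[_ *+ d]mulr_natl.
    have -> : 2 * C0 / (eta * del) * (d%:R * (K2 * (eta ^+ 2 * del ^+ 2))) +
        (eta / del ^+ 3 + C0 * d%:R ^+ 3 / del ^+ 2) * (K4 * del ^+ 4) + h1 * (eta * del) * 1 =
      2 * C0 * d%:R * K2 * (eta * del) + K4 * (eta * del) +
        C0 * d%:R ^+ 3 * K4 * (del * del) + h1 * (eta * del).
      by field; rewrite !gt_eqF.
    have -> : K * (eta * del) = 2 * C0 * d%:R * K2 * (eta * del) + K4 * (eta * del) +
        C0 * d%:R ^+ 3 * K4 * (eta * del) + h1 * (eta * del) by rewrite /K; ring.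
    rewrite lerD2r lerD2l ler_wpM2l//; first by nonneg.
    by rewrite ler_pM2r.
  - by move=> w _; nonneg.
  - by move=> w _; rewrite /quartic_error; nonneg.
  - by nonneg.
  - by nonneg.
  - by nonneg.
  - by move=> w _; rewrite second_error_ge0/=.
split => //.
apply: (@process_le_fun _ _ _ _ _ _ (fun=> K * (eta * del))) => //.
- by move=> r w _; exact: second_error_ge0.
- apply: int_le_cst => //; first by nonneg.
  by rewrite /= lebesgue_measure_itv/= lte_fin T0 -EFinD subr0 lee_fin.
Qed.

End state_expansion.

(** * Perturbations of a control *)

Section sup_norm.
Context {R : realType} {p q : nat}.
Implicit Types M : 'M[R]_(p, q).

Lemma entry_le_norm M i j : `|M i j| <= `|M|.
Proof.
rewrite [leRHS]/Num.norm/= mx_normrE.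
exact: (le_bigmax _ (fun ij : 'I_p * 'I_q => `|M ij.1 ij.2|) (i, j)).
Qed.

Lemma norm_le_entry M r : 0 <= r -> (forall i j, `|M i j| <= r) -> `|M| <= r.
Proof.
move=> r0 Mr; rewrite [leLHS]/Num.norm/= mx_normrE.
by apply: bigmax_le => // -[i j] _; exact: Mr.
Qed.

End sup_norm.

Lemma continuous_borel_map (V V' : ptopologicalType) (h : V -> V') :
  continuous h -> measurable_fun setT (h : borelType V -> borelType V').
Proof.
move=> /continuousP ch.
apply: (@measurability _ _ (borelType V) (borelType V') setT h (@open V')) => //.
by move=> _ [A oA <-]; rewrite setTI; apply: sub_sigma_algebra; exact: ch.
Qed.

Section depth.
Context {R : realType} {k : nat}.
Variable U : set 'cV[R]_k.
Implicit Types v y : 'cV[R]_k.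

Let radii v := [set r | r = 1 \/ exists2 y, ~ U y & r = `|y - v|].

(** The distance to the complement of [U], truncated at 1. *)
Definition depth v : R := inf (radii v).

Let radii0 v : radii v !=set0. Proof. by exists 1; left. Qed.

Let radii_lb v : lbound (radii v) 0.
Proof. by move=> r [->//|[y _ ->]]; exact: normr_ge0. Qed.

Let has_radii v : has_inf (radii v).
Proof. by split; [exact: radii0|exists 0; exact: radii_lb]. Qed.

Lemma depth_ge0 v : 0 <= depth v.
Proof. by apply: lb_le_inf => //; exact: radii_lb. Qed.

Lemma depth_le1 v : depth v <= 1.
Proof. by apply: ge_inf; [exists 0; exact: radii_lb|left]. Qed.

Lemma depth_ball v y : `|y - v| < depth v -> U y.
Proof.
move=> yv; apply: contrapT => Uy; move: yv; rewrite ltNge => /negP; apply.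
by apply: ge_inf; [exists 0; exact: radii_lb|right; exists y].
Qed.

Lemma depth_interior v y : `|y - v| < depth v -> (U°) y.
Proof.
move=> yv; apply/nbhs_ballP; exists (depth v - `|y - v|); rewrite /= ?subr_gt0//.
move=> z; rewrite -ball_normE/= => zy; apply: (@depth_ball v).
rewrite (_ : z - v = y - v - (y - z)); last by rewrite opprB [RHS]addrC subrKA.
by rewrite (le_lt_trans (ler_normB _ _))// -ltrBrDl.
Qed.

Lemma depth_gt0 v : (U°) v -> 0 < depth v.
Proof.
move=> /nbhs_ballP[r /= r0 rU]; apply: (@lt_le_trans _ _ (Num.min 1 r)).
  by rewrite lt_min ltr01.
apply: lb_le_inf => // _ [->|[y Uy ->]]; first by rewrite ge_min lexx.
rewrite ge_min; apply/orP; right; rewrite leNgt; apply/negP => yr; apply: Uy.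
by apply: rU; rewrite -ball_normE/= distrC.
Qed.

Lemma depth_lip v v' : depth v <= depth v' + `|v - v'|.
Proof.
rewrite -lerBlDr; apply: lb_le_inf => // _ [->|[y Uy ->]].
  by rewrite lerBlDr (le_trans (depth_le1 v))// lerDl.
rewrite lerBlDr; apply: (@le_trans _ _ `|y - v|).
  by apply: ge_inf; [exists 0; exact: radii_lb|right; exists y].
by rewrite (_ : y - v = y - v' - (v - v')) ?ler_normB// opprB addrA subrK.
Qed.

Lemma depth_continuous : continuous depth.
Proof.
move=> v; apply/(@cvgrPdist_lt _ _ _ (nbhs v) (nbhs_filter v)) => e e0.
apply/nbhs_ballP; exists e => //= y; rewrite -ball_normE/=.
apply: le_lt_trans; rewrite ler_distl; apply/andP; split.
  by rewrite lerBlDr distrC depth_lip.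
by rewrite depth_lip.
Qed.

End depth.

Section bounded_controls.
Context {R : realType} {dO : measure_display} {Omega : measurableType dO}.
Context (P : probability Omega R) {d k m : nat}.
Variables (T : R) (W : R -> Omega -> 'cV[R]_m) (X0 : Omega -> 'cV[R]_d).
Variable U : set 'cV[R]_k.
Hypothesis T0 : 0 < T.
Hypothesis Ucompact : compact U.
Local Notation admissible := (admissible P T W X0 U 0).

Lemma compact_entries : exists2 M, 1 <= M &
  forall v, U v -> `|v| <= M /\ enorm v ^+ 2 <= k%:R * M ^+ 2.
Proof.
have [M [_ /(_ (Num.max 1 (M + 1)))]] := compact_bounded Ucompact.
rewrite lt_max ltrDl ltr01 orbT => /(_ isT) UM.
exists (Num.max 1 (M + 1)); first by rewrite le_max lexx.
move=> v Uv; have vM := UM v Uv; split => //.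
rewrite enorm_sqr; under eq_bigr do rewrite big_ord1.
apply: (@le_trans _ _ (\sum_(i < k) Num.max 1 (M + 1) ^+ 2)).
  apply: ler_sum => i _; rewrite -real_normK ?num_real// lerXn2r ?nnegrE//.
    by rewrite le_max ler01.
  exact: le_trans (entry_le_norm _ _ _) vM.
by rewrite sumr_const card_ord mulr_natl.
Qed.

Lemma bounded_admissible v : (forall s w, 0 <= s <= T -> U (v s w)) ->
  adapted P W X0 0 T v -> jointly_measurable 0 T v -> admissible v.
Proof.
move=> Uv av jv; split => //; have [M _ UM] := compact_entries.
have mv : joint_measurable T (fun r w => enorm (v r w) ^+ 2).
  under eq_fun do under eq_fun do rewrite enorm_sqr.
  apply: measurable_sum => i; apply: measurable_sum => j; apply: measurable_funX.
  exact: borel_entry_measurable.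
have : process_le P T (fun r w => enorm (v r w) ^+ 2) (k%:R * M ^+ 2 * T).
  apply: process_le_bound => //; first exact: ltW.
  by move=> r w rT; have [_ ->] := UM _ (Uv r w rT); rewrite sqr_ge0.
rewrite /process_le /int_le (slab_integral21 P mv); last by move=> r w _; exact: sqr_ge0.
by move=> /le_lt_trans; apply; exact: ltry.
Qed.

Lemma mapped_admissible u (h : 'cV[R]_k -> 'cV[R]_k) :
  measurable_fun setT (h : borelType 'cV[R]_k -> borelType 'cV[R]_k) ->
  (forall v, U v -> U (h v)) -> admissible u ->
  admissible (fun r w => h (u r w)).
Proof.
move=> mh hU [Uu au ju _]; apply: bounded_admissible.
- by move=> s w sT; apply: hU; exact: Uu.
- by move=> r rT; apply: (measurableT_comp mh); exact: au.
- exact: (measurableT_comp mh).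
Qed.

End bounded_controls.

Section control_perturbations.
Context {R : realType} {k : nat}.
Variable U : set 'cV[R]_k.
Implicit Types (v : 'cV[R]_k) (eps : R).

(** Moving [v] along itself by a fraction that vanishes at the boundary of
    [U], so that it stays inside. *)
Definition depth_shift eps v := (eps * depth U v) *: v.

Lemma depth_shift_inner eps v M : U v -> `|v| <= M -> `|eps| * M < 1 ->
  inner_shift U v (depth_shift eps v).
Proof.
move=> Uv vM eM; split => //; rewrite /depth_shift.
have [->|dn0] := eqVneq (depth U v) 0; first by left; rewrite mulr0 scale0r.
have d0 : 0 < depth U v by rewrite lt_def dn0 depth_ge0.
right=> y yv; apply: (@depth_interior _ _ _ v).
have M0 : 0 <= M by exact: le_trans vM.
apply: (@le_lt_trans _ _ (`|eps| * M * depth U v)); last by rewrite gtr_pMl.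
apply: norm_le_entry => [|i j]; first by rewrite mulr_ge0 ?mulr_ge0// ltW.
rewrite ord1 !mxE (le_trans (yv i))// mxE !normrM (ger0_norm (depth_ge0 _ _)).
by rewrite mulrAC ler_wpM2r ?depth_ge0// ler_wpM2l// (le_trans (entry_le_norm _ _ _)).
Qed.

Lemma depth_shift_norm1 eps v M : `|v| <= M ->
  norm1 (depth_shift eps v) <= `|eps| * (k%:R * M).
Proof.
move=> vM; rewrite mulrCA -[k in k%:R](card_ord k) mulr_natl -sumr_const.
apply: ler_sum => c _; rewrite mxE !normrM (ger0_norm (depth_ge0 _ _)).
have v_c : `|v c 0| <= M by exact: le_trans (entry_le_norm _ _ _) vM.
rewrite -mulrA ler_wpM2l// -[leRHS]mul1r ler_pM ?depth_ge0//.
exact: depth_le1.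
Qed.

Lemma depth_shift_enorm eps v :
  enorm (v + depth_shift eps v) ^+ 2 = (1 + eps * depth U v) ^+ 2 * enorm v ^+ 2.
Proof.
rewrite !enorm_sqr mulr_sumr; apply: eq_bigr => i _.
rewrite mulr_sumr; apply: eq_bigr => j _.
by rewrite !mxE; ring.
Qed.

Lemma depth_shift_measurable eps :
  measurable_fun setT (fun v : borelType 'cV[R]_k => v + depth_shift eps v : borelType 'cV[R]_k).
Proof.
apply: (@continuous_borel_map 'cV[R]_k 'cV[R]_k (fun v => v + depth_shift eps v)).
move=> v; have FF : Filter (nbhs v) := nbhs_filter v.
apply: cvgD; first exact: cvg_id.
apply: cvgZ; last exact: cvg_id.
apply: cvgM; first exact: cvg_cst.
exact: depth_continuous.
Qed.

(** A point of least norm: it is 0 or lies on the boundary, since any other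
    interior point can be moved towards 0. *)
Lemma resting_point : compact U -> U !=set0 -> exists2 p, U p & ~ ((U°) p /\ p != 0).
Proof.
move=> Uc U0.
have [|p /set_mem Up pmin] := compact_EVT_min U0 Uc (f := fun v : 'cV[R]_k => `|v| : R).
  by apply: continuous_subspaceT => x; exact: norm_continuous.
exists p => // -[/depth_gt0 dp p0].
have np : 0 < `|p| by rewrite normr_gt0.
pose c := Num.min 1 (depth U p / (2 * `|p|)).
have c0 : 0 < c by rewrite lt_min ltr01 divr_gt0// mulr_gt0.
have c1 : c <= 1 by rewrite ge_min lexx.
have cp : c * `|p| < depth U p.
  have : c <= depth U p / (2 * `|p|) by rewrite ge_min lexx orbT.
  rewrite ler_pdivlMr ?mulr_gt0// => h; nra.
have Uy : U (p - c *: p).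
  apply: (@depth_ball _ _ _ p).
  by rewrite addrAC subrr add0r normrN normrZ gtr0_norm.
have := pmin _ (mem_set Uy).
rewrite -[X in X - _]scale1r -scalerBl normrZ ger0_norm ?subr_ge0//; nra.
Qed.

(** Avoids the nonzero interior values when [p] is a resting point. *)
Definition rest p v : 'cV[R]_k := if `[< (U°) v /\ v != 0 >] then p else v.

Lemma rest_measurable p :
  measurable_fun setT (rest p : borelType 'cV[R]_k -> borelType 'cV[R]_k).
Proof.
pose O := [set v : borelType 'cV[R]_k | (U°) v /\ v != 0].
have mO : measurable O.
  apply: sub_sigma_algebra; apply: openI; first exact: open_interior.
  rewrite [X in open X](_ : _ = ~` [set (0 : 'cV[R]_k)]).
    by apply: closed_openC; exact: (accessible_closed_set1 (hausdorff_accessible (@norm_hausdorff _ _))).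
  by apply/seteqP; split => v /=; [move=> /eqP|move=> /eqP].
move=> _ B mB; rewrite setTI.
have -> : rest p @^-1` B = (O `&` [set _ | B p]) `|` (~` O `&` B).
  apply/seteqP; split => v; rewrite /rest/=.
    by case: asboolP => hv Bv; [left|right].
  by case: asboolP => hv [[]|[]].
apply: measurableU; apply: measurableI => //.
  have [Bp|Bp] := pselect (B p).
    by rewrite (_ : [set _ | _] = setT)//; apply/seteqP; split.
  by rewrite (_ : [set _ | _] = set0)//; apply/seteqP; split.
exact: measurableC.
Qed.

End control_perturbations.

(** * The cost as a sum of means *)

Section bounded_integrals.
Context d (T : measurableType d) (R : realType) (mu : {measure set T -> \bar R}).
Variables (D : set T) (v : R).
Hypotheses (mD : measurable D) (muD : (mu D <= v%:E)%E).

Lemma bounded_integrable (f : T -> R) K : measurable_fun D f ->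
  (forall x, D x -> `|f x| <= K) -> mu.-integrable D (EFin \o f).
Proof.
move=> mf fK; apply: (@int_le_integrable _ _ _ _ _ _ (`|K| * v)) => //.
apply: (@int_le_mono _ _ _ _ _ _ (fun=> `|K|)).
  by move=> x Dx; rewrite normr_ge0 (le_trans (fK x Dx))// ler_norm.
exact: int_le_cst.
Qed.

Lemma Rintegral_le_int (f g : T -> R) c : mu.-integrable D (EFin \o f) ->
  measurable_fun D g -> (forall x, D x -> 0 <= g x) ->
  (forall x, D x -> f x <= g x) -> int_le mu D g c -> \int[mu]_(x in D) f x <= c.
Proof.
move=> fi mg g0 fg gc.
have gi : mu.-integrable D (EFin \o g).
  apply: (@int_le_integrable _ _ _ _ _ _ c) => //; apply: int_le_mono gc => x Dx.
  by rewrite normr_ge0 ger0_norm ?lexx ?g0.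
apply: (le_trans (le_Rintegral mD fi gi fg)).
by rewrite -lee_fin /Rintegral fineK// integrable_fin_num.
Qed.

End bounded_integrals.

Section costs.
Context {R : realType} {dO : measure_display} {Omega : measurableType dO}.
Context (P : probability Omega R) {d k m : nat}.
Variables (T : R) (W : R -> Omega -> 'cV[R]_m) (X0 : Omega -> 'cV[R]_d).
Variable U : set 'cV[R]_k.
Variable b : R -> 'cV[R]_d -> 'cV[R]_k -> 'cV[R]_d.
Variable sigma : R -> 'cV[R]_d -> 'cV[R]_k -> 'M[R]_(d, m).
Variable f : R -> 'cV[R]_d -> R.
Variable g : 'cV[R]_d -> R.
Variables (C0 : R) (rho : R -> R).
Hypothesis T0 : 0 < T.
Hypothesis Pcomplete : measure_is_complete P.
Hypothesis Wbm : brownian_motion P T W.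
Hypothesis X0cst : exists x0, X0 = cst x0.
Hypothesis Ucompact : compact U.
Hypothesis mcoef : measurable_coefficients T U b sigma f g.
Hypothesis f_u : u_regular T U C0 rho (fun t x _ => (f t x)%:M : 'M[R]_1).
Hypothesis g_u : u_regular T U C0 rho (fun _ x _ => (g x)%:M : 'M[R]_1).
Local Notation admissible := (admissible P T W X0 U 0).
Local Notation state := (state_process P T W X0 b sigma 0 X0).
Local Notation leb := (@lebesgue_measure R).
Local Notation slabT := (slab (Omega := Omega) T).

Definition terminal_mean (Y : R -> Omega -> 'cV[R]_d) := \int[P]_w g (Y T w).

Definition running_mean (Y : R -> Omega -> 'cV[R]_d) :=
  \int[(leb \x P)%E]_(z in slabT) f z.1 (Y z.1 z.2).

Definition energy (v : R -> Omega -> 'cV[R]_k) :=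
  \int[(leb \x P)%E]_(z in slabT) enorm (v z.1 z.2) ^+ 2.

Section one_control.
Variables (v : R -> Omega -> 'cV[R]_k) (Y : R -> Omega -> 'cV[R]_d).
Hypotheses (vadm : admissible v) (Ystate : state v Y).

Lemma running_cost_bound r w : 0 <= r <= T -> `|f r (Y r w)| <= C0.
Proof.
move=> rT; have [Uv _ _ _] := vadm.
have := coef_bound f_u 0 0 rT (Y r w) (Uv r w rT).
by rewrite mxE eqxx mulr1n.
Qed.

Lemma terminal_cost_bound w : `|g (Y T w)| <= C0.
Proof.
have TT : 0 <= T <= T by rewrite lexx ltW.
have [Uv _ _ _] := vadm.
have := coef_bound g_u 0 0 TT (Y T w) (Uv T w TT).
by rewrite mxE eqxx mulr1n.
Qed.

Lemma energy_joint_measurable :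
  joint_measurable T (fun r w => enorm (v r w) ^+ 2).
Proof.
under eq_fun do under eq_fun do rewrite enorm_sqr.
apply: measurable_sum => i; apply: measurable_sum => j; apply: measurable_funX.
by have [_ _ jv _] := vadm; exact: borel_entry_measurable.
Qed.

Lemma slab_bounded_integrable (h : R -> Omega -> R) K : joint_measurable T h ->
  (forall r w, 0 <= r <= T -> `|h r w| <= K) ->
  (leb \x P)%E.-integrable slabT (EFin \o (fun z : measurableTypeR R * Omega => h z.1 z.2)).
Proof.
move=> mh hK.
have sm : ((leb \x P)%E slabT <= T%:E)%E by apply: slab_measure_le; exact: ltW.
apply: (bounded_integrable (measurable_slab T) sm (K := K)) => //.
by move=> [r w] [/=]; rewrite in_itv/= => rs _; exact: hK.
Qed.

Lemma running_integrable :
  (leb \x P)%E.-integrable slabT (EFin \o (fun z : measurableTypeR R * Omega => f z.1 (Y z.1 z.2))).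
Proof.
apply: (@slab_bounded_integrable (fun r w => f r (Y r w)) C0).
  exact: (running_cost_joint_measurable Pcomplete Wbm X0cst mcoef vadm Ystate).
exact: running_cost_bound.
Qed.

Lemma terminal_integrable : P.-integrable setT (EFin \o (fun w => g (Y T w))).
Proof.
have P1 : (P setT <= 1%:E)%E by exact: probability_le1.
apply: (bounded_integrable measurableT P1 (K := C0)).
  exact: (terminal_cost_measurable T0 Pcomplete Wbm X0cst mcoef Ystate).
by move=> w _; exact: terminal_cost_bound.
Qed.

Lemma energy_integrable :
  (leb \x P)%E.-integrable slabT (EFin \o (fun z : measurableTypeR R * Omega => enorm (v z.1 z.2) ^+ 2)).
Proof.
have [M _ UM] := compact_entries Ucompact; have [Uv _ _ _] := vadm.
apply: (@slab_bounded_integrable (fun r w => enorm (v r w) ^+ 2) (k%:R * M ^+ 2)).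
  exact: energy_joint_measurable.
by move=> r w rT; rewrite ger0_norm ?sqr_ge0//; have [] := UM _ (Uv r w rT).
Qed.

Lemma cost_expectation theta : exists c : Omega -> R,
  [/\ P.-integrable setT (EFin \o c),
      (forall w, pathwise_cost T f g 0 theta v Y w = (c w)%:E) &
      \int[P]_w c w = terminal_mean Y + running_mean Y + theta * energy v].
Proof.
have [M _ UM] := compact_entries Ucompact; have [Uv _ _ _] := vadm.
pose h r w := f r (Y r w) + theta * enorm (v r w) ^+ 2.
pose K := C0 + `|theta| * (k%:R * M ^+ 2).
have mf : joint_measurable T (fun r w => f r (Y r w)).
  exact: (running_cost_joint_measurable Pcomplete Wbm X0cst mcoef vadm Ystate).
have mh : joint_measurable T h.
  apply: measurable_funD; first exact: mf.
  apply: measurable_funM => //; exact: energy_joint_measurable.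
have hK r w : 0 <= r <= T -> `|h r w| <= K.
  move=> rT; rewrite (le_trans (ler_normD _ _))// lerD ?running_cost_bound//.
  rewrite normrM ler_wpM2l// ger0_norm ?sqr_ge0//.
  by have [] := UM _ (Uv r w rT).
have T0' := ltW T0.
have mt := measurable_tint T0' mh hK.
have P1 : (P setT <= 1%:E)%E by exact: probability_le1.
have ti : P.-integrable setT (EFin \o tint T h).
  apply: (bounded_integrable measurableT P1 (K := K * T)) => //.
  by move=> w _; exact: (norm_tint_le T0' mh hK).
have gi := terminal_integrable.
exists (fun w => g (Y T w) + tint T h w); split.
- rewrite (_ : _ \o _ = (EFin \o (fun w => g (Y T w))) \+ (EFin \o tint T h))%E.
    exact: integrableD.
  by apply/funext => w /=; rewrite EFinD.
- by move=> w; rewrite EFinD (tint_EFin T0' mh hK).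
rewrite RintegralD// -addrA; congr (_ + _).
rewrite (expectation_tint P T0' mh hK) /h.
rewrite (@RintegralD _ _ _ (leb \x P)%E slabT (fun z => f z.1 (Y z.1 z.2)) (fun z => theta * enorm (v z.1 z.2) ^+ 2)).
- congr (_ + _); exact: (RintegralZl _ (measurable_slab T) energy_integrable).
- exact: measurable_slab.
- exact: running_integrable.
- have := integrableZl (measurable_slab T) theta energy_integrable.
  by congr (_.-integrable _ _); apply/funext => z /=; rewrite EFinM.
Qed.

Lemma cost_decomposition theta : cost P T f g 0 theta v Y =
  (terminal_mean Y + running_mean Y + theta * energy v)%:E.
Proof.
have [c [ci cE <-]] := cost_expectation theta.
rewrite /cost; under eq_integral do rewrite cE.
by rewrite /Rintegral fineK// integrable_fin_num.
Qed.

Lemma cost_lower_bound theta : 0 <= theta ->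
  - C0 - C0 * T <= terminal_mean Y + running_mean Y + theta * energy v.
Proof.
move=> th0; rewrite -[leLHS]addr0 lerD//; last first.
  by rewrite mulr_ge0// Rintegral_ge0// => z _; exact: sqr_ge0.
have P1 : (P setT <= 1%:E)%E by exact: probability_le1.
have T0' := ltW T0.
have cP : P.-integrable setT (EFin \o (fun=> - C0)).
  by apply: (bounded_integrable measurableT P1 (K := `|- C0|)).
have cS : (leb \x P)%E.-integrable slabT (EFin \o (fun=> - C0)).
  by apply: (@slab_bounded_integrable (fun _ _ => - C0) `|- C0|) => //; exact: measurable_cst.
apply: lerD.
- have -> : - C0 = \int[P]_w (- C0).
    rewrite Rintegral_cst// [fine _](_ : _ = 1) ?mulr1//.
    exact: (congr1 fine (probability_setT P)).
  apply: le_Rintegral => //; first exact: terminal_integrable.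
  by move=> w _; have := terminal_cost_bound w; rewrite ler_norml => /andP[].
- have -> : - (C0 * T) = \int[(leb \x P)%E]_(z in slabT) (- C0).
    rewrite Rintegral_cst//; last exact: measurable_slab.
    rewrite [fine _](_ : _ = T) ?mulNr//.
    exact: (congr1 fine (slab_measure P T0')).
  apply: (le_Rintegral (measurable_slab T) cS running_integrable).
  move=> [r w] [/=]; rewrite in_itv/= => rT _.
  by have := running_cost_bound w rT; rewrite ler_norml => /andP[].
Qed.

End one_control.

Section gap.
Variables (u : R -> Omega -> 'cV[R]_k) (X : R -> Omega -> 'cV[R]_d).
Hypotheses (uadm : admissible u) (Xstate : state u X).
Variable theta : R.
Hypothesis theta0 : 0 < theta.

(** Since [X0] is constant, the value function enters as a single number, the
    infimum of the costs, and it is finite because the costs are bounded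
    below. *)
Lemma Phi_eq0 : Phi P T W X0 U b sigma f g u X theta = 0%E <->
  forall v Y, admissible v -> state v Y ->
    (cost P T f g 0 theta u X <= cost P T f g 0 theta v Y)%E.
Proof.
have [x0 X0E] := X0cst.
set V := value_function P T W X0 U b sigma f g 0 x0 theta.
have VE v Y : admissible v -> state v Y -> (V <= cost P T f g 0 theta v Y)%E.
  move=> vadm Ystate; apply: ereal_inf_lbound; exists v, Y; split; [exact: vadm| |reflexivity].
  exact: (eq_ind _ (fun xi => state_process P T W X0 b sigma 0 xi v Y) Ystate _ X0E).
have lbV c : (forall v Y, admissible v -> state v Y -> (c <= cost P T f g 0 theta v Y)%E) ->
    (c <= V)%E.
  move=> cle; apply: le_ereal_inf_tmp => _ [v [Y [vadm Ystate ->]]].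
  apply: (cle v Y vadm).
  exact: (eq_ind_r (fun xi => state_process P T W X0 b sigma 0 xi v Y) Ystate X0E).
have [c [ci cE cI]] := cost_expectation uadm Xstate theta.
have costE := cost_decomposition uadm Xstate theta; rewrite -cI in costE.
have Vlb : ((- C0 - C0 * T)%:E <= V)%E.
  apply: lbV => v Y vadm Ystate; rewrite (cost_decomposition vadm Ystate) lee_fin.
  by apply: (cost_lower_bound vadm Ystate); exact: ltW.
have [y yE] : exists y, V = y%:E.
  exists (fine V); rewrite fineK// fin_real// (lt_le_trans (ltNyr _) Vlb)/=.
  by apply: le_lt_trans (VE u X uadm Xstate) _; rewrite costE ltry.
have PhiE : Phi P T W X0 U b sigma f g u X theta = (\int[P]_w c w - y)%:E.
  have yi : P.-integrable setT (EFin \o (fun=> y)).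
    have P1 : (P setT <= 1%:E)%E by exact: probability_le1.
    exact: (bounded_integrable measurableT P1 (K := `|y|)).
  have cyi : P.-integrable setT (EFin \o (fun w => c w - y)).
    rewrite (_ : _ \o _ = (EFin \o c) \- (EFin \o (fun=> y)))%E.
      exact: integrableB.
    by apply/funext => w /=; rewrite EFinB.
  have -> : \int[P]_w c w - y = \int[P]_w (c w - y).
    rewrite RintegralB// Rintegral_cst// [fine _](_ : _ = 1) ?mulr1//.
    exact: (congr1 fine (probability_setT P)).
  have X0w w : X0 w = x0 := congr1 (fun h => h w) X0E.
  rewrite /Phi; under eq_integral do rewrite cE X0w -/V yE -EFinB.
  by rewrite /Rintegral fineK// integrable_fin_num.
rewrite PhiE; split=> [[/subr0_eq cy] v Y vadm Ystate|uopt].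
  by rewrite costE cy -yE; exact: VE.
congr (_%:E); apply/eqP; rewrite subr_eq0 eq_le -2!lee_fin -costE -yE.
by rewrite VE// lbV.
Qed.

End gap.

End costs.

(** * Uniqueness of the root *)

Section uniqueness.
Context {R : realType} {dO : measure_display} {Omega : measurableType dO}.
Context (P : probability Omega R) {d k m : nat}.
Variables (T : R) (W : R -> Omega -> 'cV[R]_m) (X0 : Omega -> 'cV[R]_d).
Variable U : set 'cV[R]_k.
Variable b : R -> 'cV[R]_d -> 'cV[R]_k -> 'cV[R]_d.
Variable sigma : R -> 'cV[R]_d -> 'cV[R]_k -> 'M[R]_(d, m).
Variable f : R -> 'cV[R]_d -> R.
Variable g : 'cV[R]_d -> R.
Variables (C0 : R) (rho : R -> R).
Hypothesis T0 : 0 < T.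
Hypothesis Pcomplete : measure_is_complete P.
Hypothesis Wbm : brownian_motion P T W.
Hypothesis X0cst : exists x0, X0 = cst x0.
Hypothesis Uclosed : closed U.
Hypothesis mcoef : measurable_coefficients T U b sigma f g.
Hypothesis wp : well_posed P T W X0 U b sigma.
Hypothesis Ucompact : compact U.
Hypothesis coef_C2 : forall (t : R) u, 0 <= t <= T -> U u ->
  [/\ classC2 (fun x => b t x u), classC2 (fun x => sigma t x u),
      classC2 (fun x => (f t x)%:M : 'M[R]_1) &
      classC2 (fun x => (g x)%:M : 'M[R]_1)].
Hypotheses (C00 : 0 < C0) (rho_mod : modulus_of_continuity rho).
Hypotheses (b_x : x_regular T U C0 rho b) (s_x : x_regular T U C0 rho sigma).
Hypothesis f_x : x_regular T U C0 rho (fun t x _ => (f t x)%:M : 'M[R]_1).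
Hypothesis g_x : x_regular T U C0 rho (fun _ x _ => (g x)%:M : 'M[R]_1).
Hypotheses (b_u : u_regular T U C0 rho b) (s_u : u_regular T U C0 rho sigma).
Hypothesis f_u : u_regular T U C0 rho (fun t x _ => (f t x)%:M : 'M[R]_1).
Hypothesis g_u : u_regular T U C0 rho (fun _ x _ => (g x)%:M : 'M[R]_1).
Local Notation admissible := (admissible P T W X0 U 0).
Local Notation state := (state_process P T W X0 b sigma 0 X0).
Local Notation leb := (@lebesgue_measure R).
Local Notation slabT := (slab (Omega := Omega) T).
Variables (u : R -> Omega -> 'cV[R]_k) (X : R -> Omega -> 'cV[R]_d).
Hypotheses (uadm : admissible u) (Xstate : state u X).

(** For n = 1 and n = 2 the density of the coefficients of [2 * eps] and of
    [eps ^+ 2] in the energy of the control shifted by [eps]. *)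
Definition depth_energy n (r : R) (w : Omega) := depth U (u r w) ^+ n * enorm (u r w) ^+ 2.

Definition mean_depth_energy n :=
  \int[(leb \x P)%E]_(z in slabT) depth_energy n z.1 z.2.

Lemma depth_energy_measurable n : joint_measurable T (depth_energy n).
Proof.
apply: measurable_funM; last exact: energy_joint_measurable uadm.
apply: measurable_funX; have [_ _ ju _] := uadm.
apply: (continuous_borel_measurable (@depth_continuous _ _ U)
  (f := fun z : measurableTypeR R * Omega => u z.1 z.2)).
exact: ju.
Qed.

Lemma depth_energy_bound : exists2 M2, 0 <= M2 & forall n (r : R) w, 0 <= r <= T ->
  0 <= depth_energy n r w <= M2.
Proof.
have [M M1 UM] := compact_entries Ucompact; have [Uu _ _ _] := uadm.
exists (k%:R * M ^+ 2); first by nonneg.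
move=> n r w rT; have [_ uM] := UM _ (Uu r w rT).
apply/andP; split; first by rewrite mulr_ge0 ?sqr_ge0// exprn_ge0 ?depth_ge0.
apply: le_trans uM; rewrite ler_piMl ?sqr_ge0//.
by rewrite exprn_ile1 ?depth_ge0 ?depth_le1.
Qed.

Lemma depth_energy_integrable n : (leb \x P)%E.-integrable slabT
  (EFin \o (fun z : measurableTypeR R * Omega => depth_energy n z.1 z.2)).
Proof.
have [M2 _ hM] := depth_energy_bound.
apply: (@slab_bounded_integrable _ _ _ P T T0 (depth_energy n) M2).
  exact: depth_energy_measurable.
by move=> r w rT; have /andP[? ?] := hM n r w rT; rewrite ger0_norm.
Qed.

Lemma energy_shift eps :
  energy P T (fun r w => u r w + depth_shift U eps (u r w)) =
  energy P T u + 2 * eps * mean_depth_energy 1 + eps ^+ 2 * mean_depth_energy 2.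
Proof.
have msl := @measurable_slab R dO Omega T.
have i0 := energy_integrable T0 Ucompact uadm.
have sc n c : (leb \x P)%E.-integrable slabT
    (EFin \o (fun z : measurableTypeR R * Omega => c * depth_energy n z.1 z.2)).
  have := integrableZl msl c (depth_energy_integrable n).
  by congr (_.-integrable _ _); apply/funext => z /=; rewrite EFinM.
rewrite /mean_depth_energy /energy.
rewrite -(RintegralZl _ msl (depth_energy_integrable 1)).
rewrite -(RintegralZl _ msl (depth_energy_integrable 2)).
rewrite -(RintegralD msl i0 (sc 1%N _)).
have i1 : (leb \x P)%E.-integrable slabT (EFin \o (fun z : measurableTypeR R * Omega =>
    enorm (u z.1 z.2) ^+ 2 + 2 * eps * depth_energy 1 z.1 z.2)).
  have := integrableD msl i0 (sc 1%N (2 * eps)).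
  by congr (_.-integrable _ _); apply/funext => z /=; rewrite EFinD.
rewrite -(RintegralD msl i1 (sc 2%N _)).
apply: eq_Rintegral => z _; rewrite depth_shift_enorm /depth_energy; ring.
Qed.

(** The second differences of the two parts of the state cost. *)
(** To first order the effects of opposite shifts on the state cost cancel. *)
Lemma state_cost_second_difference : exists2 K, 0 <= K & forall e del eta Y1 Y2,
  opposite_shifts P T W X0 U b sigma rho u e del eta Y1 Y2 ->
  terminal_mean P T g Y1 + running_mean P T f Y1 +
    (terminal_mean P T g Y2 + running_mean P T f Y2) -
    2 * (terminal_mean P T g X + running_mean P T f X) <= K * (eta * del) * (1 + T).
Proof.
have b_C2 (t : R) v : 0 <= t <= T -> U v -> classC2 (fun x => b t x v).
  by move=> tT Uv; have [] := coef_C2 tT Uv.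
have s_C2 (t : R) v : 0 <= t <= T -> U v -> classC2 (fun x => sigma t x v).
  by move=> tT Uv; have [] := coef_C2 tT Uv.
have f_C2 (t : R) v : 0 <= t <= T -> U v -> classC2 (fun x => (f t x)%:M : 'M[R]_1).
  by move=> tT Uv; have [] := coef_C2 tT Uv.
have g_C2 (t : R) v : 0 <= t <= T -> U v -> classC2 (fun x => (g x)%:M : 'M[R]_1).
  by move=> tT Uv; have [] := coef_C2 tT Uv.
have [K K0 hK] := second_error_le T0 Pcomplete Wbm X0cst Uclosed mcoef C00 rho_mod
  b_C2 s_C2 b_x s_x b_u s_u uadm Xstate.
exists K => // e del eta Y1 Y2 os.
have [mE mEs E PE] := hK _ _ _ _ _ os.
have [[del0 de _ _] [adm1 adm2 st1 st2]] := os.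
have E0 r w : 0 <= second_error C0 X del eta Y1 Y2 r w by exact: second_error_ge0.
have TT : 0 <= T <= T by rewrite lexx ltW.
have g0 := terminal_integrable T0 Pcomplete Wbm X0cst mcoef g_u uadm Xstate.
have g1 := terminal_integrable T0 Pcomplete Wbm X0cst mcoef g_u adm1 st1.
have g2 := terminal_integrable T0 Pcomplete Wbm X0cst mcoef g_u adm2 st2.
have f0 := running_integrable T0 Pcomplete Wbm X0cst mcoef f_u uadm Xstate.
have f1 := running_integrable T0 Pcomplete Wbm X0cst mcoef f_u adm1 st1.
have f2 := running_integrable T0 Pcomplete Wbm X0cst mcoef f_u adm2 st2.
have msl := @measurable_slab R dO Omega T.
have iB dd (S : measurableType dd) (mu : {measure set S -> \bar R}) D (h1 h2 : S -> R) :
    measurable D -> mu.-integrable D (EFin \o h1) -> mu.-integrable D (EFin \o h2) ->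
    mu.-integrable D (EFin \o (fun x => h1 x - h2 x)).
  move=> mD i1 i2; rewrite (_ : _ \o _ = (EFin \o h1) \- (EFin \o h2))%E.
    exact: integrableB.
  by apply/funext => x /=; rewrite EFinB.
have second dd (S : measurableType dd) (mu : {measure set S -> \bar R}) D
    (h0 h1 h2 err : S -> R) c :
    measurable D -> mu.-integrable D (EFin \o h0) -> mu.-integrable D (EFin \o h1) ->
    mu.-integrable D (EFin \o h2) -> measurable_fun D err ->
    (forall x, D x -> 0 <= err x) ->
    (forall x, D x -> `|h1 x - h0 x + (h2 x - h0 x)| <= err x) -> int_le mu D err c ->
    \int[mu]_(x in D) h1 x + \int[mu]_(x in D) h2 x - 2 * \int[mu]_(x in D) h0 x <= c.
  move=> mD i0 i1 i2 merr err0 herr errc.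
  have i10 := iB _ _ _ _ _ _ mD i1 i0; have i20 := iB _ _ _ _ _ _ mD i2 i0.
  have -> : \int[mu]_(x in D) h1 x + \int[mu]_(x in D) h2 x - 2 * \int[mu]_(x in D) h0 x =
      \int[mu]_(x in D) (h1 x - h0 x + (h2 x - h0 x)).
    by rewrite RintegralD// !RintegralB//; ring.
  apply: (@Rintegral_le_int _ _ _ mu D mD _ err c _ merr err0 _ errc).
    rewrite (_ : _ \o _ = (EFin \o (fun x => (h1 x - h0 x)%R)) \+ (EFin \o (fun x => (h2 x - h0 x)%R)))%E.
      exact: integrableD.
    by apply/funext => x /=; rewrite EFinD.
  by move=> x Dx; apply: le_trans (ler_norm _) (herr x Dx).
have hg := second _ _ P setT _ _ _ _ _ measurableT g0 g1 g2 (mEs T TT) (fun w _ => E0 T w)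
  (fun w _ => value_second_error C00 rho_mod X w (F := fun _ x => g x) g_C2 g_x g_u os TT) (E T TT).
have hf := second _ _ (leb \x P)%E slabT _ _ _ _ _ msl f0 f1 f2 mE (fun z _ => E0 z.1 z.2) _ PE.
have {}hf := hf _.
have h : terminal_mean P T g Y1 + terminal_mean P T g Y2 - 2 * terminal_mean P T g X <=
  K * (eta * del) by exact: hg.
have h' : running_mean P T f Y1 + running_mean P T f Y2 - 2 * running_mean P T f X <=
  K * (eta * del) * T.
  apply: hf => -[r w] [/=]; rewrite in_itv/= => rT _.
  exact: (value_second_error C00 rho_mod X w f_C2 f_x f_u os rT).
have := lerD h h'.
have -> : K * (eta * del) * (1 + T) = K * (eta * del) + K * (eta * del) * T by ring.
by apply: le_trans; le_ring.
Qed.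

Section two_minima.
Variables theta1 theta2 : R.
Hypotheses (theta10 : 0 < theta1) (theta12 : theta1 < theta2).
Hypothesis min1 : forall v Y, admissible v -> state v Y ->
  (cost P T f g 0 theta1 u X <= cost P T f g 0 theta1 v Y)%E.
Hypothesis min2 : forall v Y, admissible v -> state v Y ->
  (cost P T f g 0 theta2 u X <= cost P T f g 0 theta2 v Y)%E.

(** Compare [u] at [theta1] with its shift by [eps], and at [theta2] with its
    shift by [- eps]. The first-order changes of the two energy costs add up
    to - 2 (theta2 - theta1) eps times the mean in question, while the state costs
    change by o(eps) altogether. Minimality at both parameters leaves no room
    for a positive mean. *)
Let mean_depth_energy_small : exists2 K, 0 < K & forall eta, 0 < eta ->
  mean_depth_energy 1 <= K * eta.
Proof.
have [M M1 UM] := compact_entries Ucompact; have [Uu _ _ _] := uadm.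
have [M2 M20 hM2] := depth_energy_bound.
have [K K0 hK] := state_cost_second_difference.
have M0 : 0 < M by exact: lt_le_trans M1.
(* bounds norm1 on U, and k.+1 instead of k keeps it positive when k = 0 *)
pose L := k.+1%:R * M; have L0 : 0 < L by rewrite mulr_gt0.
have ML : M <= L by rewrite -[leLHS]mul1r ler_wpM2r ?(ltW M0)// ler1n.
have kML : k%:R * M <= L by rewrite ler_wpM2r ?(ltW M0)// ler_nat.
pose K' := K * L * (1 + T) + (theta1 + theta2) * (M2 * T).
have T0' := ltW T0; have L0' := ltW L0; have theta10' := ltW theta10.
have theta20' : 0 <= theta2 by rewrite ltW// (lt_trans theta10).
have K'0 : 0 <= K' by rewrite /K'; nonneg.
have th : 0 < 2 * (theta2 - theta1) by rewrite mulr_gt0// subr_gt0.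
exists (K' / (2 * (theta2 - theta1)) + 1).
  by rewrite ltr_wpDl// divr_ge0// (ltW th).
move=> eta eta0; have [rho0 _ rho_lim] := rho_mod.
have [r0 r00 r0P] : exists2 r0, 0 < r0 & forall r, 0 <= r <= r0 -> rho r <= eta.
  have /cvgrPdist_lt/(_ eta eta0)[e /= e0 he] := rho_lim.
  exists (e / 2); first by rewrite divr_gt0.
  move=> r /andP[]; rewrite le_eqVlt => /orP[/eqP <- _|r_gt0 re].
    by have [_ -> _] := rho_mod; exact: ltW.
  have : ball (0 : R) e r.
    rewrite -ball_normE/= sub0r normrN gtr0_norm// (le_lt_trans re)//.
    by rewrite ltr_pdivrMr// ltr_pMr// ltr1n.
  move=> /he/(_ r_gt0); rewrite sub0r normrN => h.
  exact: le_trans (ler_norm _) (ltW h).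
(* eps is the relative size of the shift and del bounds its norm1; the bound
   1 / 2 keeps the shifted controls in U *)
pose del := Num.min 2^-1 (Num.min eta r0).
have del0 : 0 < del by rewrite !lt_min invr_gt0 ltr0n eta0.
have del_half : del <= 2^-1 by rewrite ge_min lexx.
have del_eta : del <= eta by rewrite !ge_min lexx orbT.
have del_r0 : del <= r0 by rewrite !ge_min lexx !orbT.
pose eps := del / L; have eps0 : 0 < eps by rewrite divr_gt0.
have epsL : eps * L = del by rewrite /eps divfK// gt_eqF.
have eps_eta : eps <= eta.
  by apply: le_trans del_eta; rewrite -epsL -[leLHS]mulr1 ler_wpM2l ?(ltW eps0)// (le_trans M1).
have epsM : eps * M < 1.
  rewrite (@le_lt_trans _ _ (eps * L))// ?ler_wpM2l ?(ltW eps0)// epsL.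
  by rewrite (le_lt_trans del_half)// invf_lt1// ltr1n.
pose e r w := depth_shift U eps (u r w).
have eN r w : - e r w = depth_shift U (- eps) (u r w).
  by rewrite /e /depth_shift mulNr scaleNr.
have inner (s : R) v : `|s| = eps -> U v -> inner_shift U v (depth_shift U s v).
  move=> se Uv; have [vM _] := UM v Uv.
  by apply: (depth_shift_inner Uv vM); rewrite se.
have eps_norm : `|eps| = eps by rewrite gtr0_norm.
have epsN_norm : `|- eps| = eps by rewrite normrN.
have adm (s : R) : `|s| = eps -> admissible (fun r w => u r w + depth_shift U s (u r w)).
  move=> se; apply: (mapped_admissible T0 Ucompact (depth_shift_measurable U s)) uadm.
  by move=> v Uv; apply: inner_shift_edge; exact: inner.
have adm1 : admissible (shifted u e) := adm eps eps_norm.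
have shN : shifted u (fun r w => - e r w) = fun r w => u r w + depth_shift U (- eps) (u r w).
  by apply/funext => r; apply/funext => w; rewrite /shifted eN.
have adm2 : admissible (shifted u (fun r w => - e r w)) by rewrite shN; exact: adm.
have [[Y1 st1] _] := wp adm1; have [[Y2 st2] _] := wp adm2.
have os : opposite_shifts P T W X0 U b sigma rho u e del eta Y1 Y2.
  split; [split; [exact: del0|exact: del_eta| |]|by split].
  - by move=> r /andP[r_ge0 rd]; apply: r0P; rewrite r_ge0 (le_trans rd).
  - move=> r w rT; have Urw := Uu r w rT; split; first exact: inner.
    have [vM _] := UM _ Urw; apply: le_trans (depth_shift_norm1 U eps vM) _.
    by rewrite eps_norm -epsL ler_wpM2l// ltW.
have hF := hK _ _ _ _ _ os.
have c1 := min1 adm1 st1; have c2 := min2 adm2 st2.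
rewrite (cost_decomposition T0 Pcomplete Wbm X0cst Ucompact mcoef f_u g_u uadm Xstate) in c1.
rewrite (cost_decomposition T0 Pcomplete Wbm X0cst Ucompact mcoef f_u g_u uadm Xstate) in c2.
rewrite (cost_decomposition T0 Pcomplete Wbm X0cst Ucompact mcoef f_u g_u adm1 st1) in c1.
rewrite (cost_decomposition T0 Pcomplete Wbm X0cst Ucompact mcoef f_u g_u adm2 st2) in c2.
rewrite !lee_fin in c1 c2.
rewrite [energy P T (shifted u e)](energy_shift eps) in c1.
rewrite shN (energy_shift (- eps)) in c2.
have q2 : mean_depth_energy 2 <= M2 * T.
  apply: (@Rintegral_le_int _ _ _ (leb \x P)%E slabT (measurable_slab T)
    _ (fun z : measurableTypeR R * Omega => depth_energy 2 z.1 z.2)).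
  - exact: depth_energy_integrable.
  - exact: depth_energy_measurable.
  - by move=> [r w] [/=]; rewrite in_itv/= => rT _; have /andP[] := hM2 2%N r w rT.
  - by move=> [r w] [/=]; rewrite in_itv/= => rT _.
  - apply: process_le_bound => //.
      exact: depth_energy_measurable.
    by move=> r w rT; exact: hM2.
have main : 2 * (theta2 - theta1) * mean_depth_energy 1 <= K' * eta.
  have e2 : eps ^+ 2 * mean_depth_energy 2 <= eps * eta * (M2 * T).
    apply: (@le_trans _ _ (eps ^+ 2 * (M2 * T))); first by rewrite ler_wpM2l ?sqr_ge0.
    have M2T : 0 <= M2 * T by nonneg.
    by rewrite (ler_wpM2r M2T)// expr2 (ler_wpM2l (ltW eps0)).
  have th2 : 0 <= theta1 + theta2 by nonneg.
  have e3 := ler_wpM2l th2 e2.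
  rewrite -(ler_pM2l eps0).
  have -> : eps * (K' * eta) = K * (eta * del) * (1 + T) + (theta1 + theta2) * (eps * eta * (M2 * T)).
    by rewrite /K' -epsL; ring.
  move: c1 c2 hF e3; rewrite sqrrN.
  move: (mean_depth_energy 1) (mean_depth_energy 2) (terminal_mean _ _ _ _) => q q' G.
  move: (terminal_mean _ _ _ _) (running_mean _ _ _ _) (K * _ * _) (energy _ _ _) => G1 F1 KK Q.
  move=> *; lra.
have : mean_depth_energy 1 <= K' / (2 * (theta2 - theta1)) * eta.
  by rewrite mulrAC ler_pdivlMr// mulrC.
by move/le_trans; apply; rewrite ler_wpM2r ?(ltW eta0)// lerDl.
Qed.

(** The mean of the nonnegative [depth_energy 1] vanishes, and this density is
    positive wherever the control takes a nonzero interior value. *)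
Lemma two_minima_rest : {ae (leb \x P)%E, forall z, 0 <= z.1 <= T ->
  ~ ((U°) (u z.1 z.2) /\ u z.1 z.2 != 0)}.
Proof.
have [K K0 hK] := mean_depth_energy_small.
have q0 : mean_depth_energy 1 <= 0.
  apply/ler_addgt0Pr => e e0; rewrite add0r.
  by have := hK (e / K); rewrite divr_gt0// mulrC divfK ?gt_eqF//; apply.
have [M2 M20 hM2] := depth_energy_bound.
pose h := (fun z : measurableTypeR R * Omega => (depth_energy 1 z.1 z.2)%:E).
have mh : measurable_fun slabT h.
  by apply: measurable_EFin_fun; exact: depth_energy_measurable.
have h0 z : slabT z -> (0 <= h z)%E.
  by case: z => r w [/=]; rewrite in_itv/= lee_fin => rT _; have /andP[] := hM2 1%N r w rT.
have h_eq0 : (\int[(leb \x P)%E]_(z in slabT) `|h z|)%E = 0%E.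
  rewrite (eq_integral h); last first.
    by move=> z /set_mem zT; rewrite gee0_abs ?h0.
  apply/eqP; rewrite eq_le integral_ge0// andbT.
  rewrite -[leLHS]fineK ?lee_fin//.
  exact: (integrable_fin_num (measurable_slab T) (depth_energy_integrable 1)).
have /(ae_eq_integral_abs _ (measurable_slab T) mh) := h_eq0.
apply: filterS => -[r w] /= hz rT [/depth_gt0 ud un0].
have : h (r, w) = 0%E by apply: hz; split => //=; rewrite in_itv.
move=> [] /eqP; rewrite /depth_energy expr1 mulf_eq0 gt_eqF//= sqrf_eq0 => /eqP e0.
move/eqP: un0; apply; apply/matrixP => i j; rewrite mxE.
by apply/eqP; rewrite -normr_le0 -e0 entry_le_enorm.
Qed.

End two_minima.

(** A control that almost never takes nonzero interior values has a version
    that never does, against the hypothesis on all versions of [u]. *)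
Lemma minimal_theta_unique theta1 theta2 :
  somewhere_interior_nonzero P T W X0 U u -> 0 < theta1 -> 0 < theta2 ->
  (forall v Y, admissible v -> state v Y ->
    (cost P T f g 0 theta1 u X <= cost P T f g 0 theta1 v Y)%E) ->
  (forall v Y, admissible v -> state v Y ->
    (cost P T f g 0 theta2 u X <= cost P T f g 0 theta2 v Y)%E) ->
  theta1 = theta2.
Proof.
move=> u_int th1 th2 min1 min2; apply: contrapT => /eqP th12.
have rest_ae : {ae (leb \x P)%E, forall z, 0 <= z.1 <= T ->
    ~ ((U°) (u z.1 z.2) /\ u z.1 z.2 != 0)}.
  by move: th12; rewrite neq_lt => /orP[lt12|lt21];
    [exact: two_minima_rest th1 lt12 min1 min2|exact: two_minima_rest th2 lt21 min2 min1].
have [w0 _] : [set: Omega] !=set0 by exists point.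
have [Uu _ _ _] := uadm.
have [|p Up p_rest] := resting_point Ucompact.
  by exists (u 0 w0); apply: Uu; rewrite lexx ltW.
have vadm := mapped_admissible T0 Ucompact (rest_measurable U p) _ uadm.
have {}vadm : admissible (fun r w => rest U p (u r w)).
  by apply: vadm => v Uv; rewrite /rest; case: ifP.
have [|t0 t0T] := u_int _ vadm.
  apply: negligibleS rest_ae => z /=; apply: contra_not => hz zT; rewrite /rest; case: asboolP => // uz.
  by case: (hz zT).
rewrite (_ : [set _ | _] = set0) ?measure0 ?ltxx//.
apply/seteqP; split => // w [] /=; rewrite /rest.
by case: asboolP => [_ pU p0|u_rest uU u0]; [apply: p_rest|apply: u_rest].
Qed.

End uniqueness.

Theorem theorem4p1 (R : realType) (dO : measure_display)
    (Omega : measurableType dO) (P : probability Omega R) (d k m : nat)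
    (T : R) (W : R -> Omega -> 'cV[R]_m) (X0 : Omega -> 'cV[R]_d)
    (U : set 'cV[R]_k)
    (b : R -> 'cV[R]_d -> 'cV[R]_k -> 'cV[R]_d)
    (sigma : R -> 'cV[R]_d -> 'cV[R]_k -> 'M[R]_(d, m))
    (f : R -> 'cV[R]_d -> R) (g : 'cV[R]_d -> R)
    (C0 : R) (rho : R -> R)
    (theta_star : R) (u_star : R -> Omega -> 'cV[R]_k)
    (X_star : R -> Omega -> 'cV[R]_d) :
  0 < T ->
  measure_is_complete P ->
  brownian_motion P T W ->
  measurable_fun [set: Omega] (X0 : Omega -> borelType 'cV[R]_d) ->
  initial_independent P T W X0 ->
  closed U ->
  measurable_coefficients T U b sigma f g ->
  well_posed P T W X0 U b sigma ->
  cost_bounded_below P T W X0 U b sigma f g ->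
  (exists x0, X0 = cst x0) ->
  compact U -> U° !=set0 ->
  (forall t u, 0 <= t <= T -> U u ->
     [/\ classC2 (fun x => b t x u), classC2 (fun x => sigma t x u),
         classC2 (fun x => (f t x)%:M : 'M[R]_1) &
         classC2 (fun x => (g x)%:M : 'M[R]_1)]) ->
  0 < C0 -> modulus_of_continuity rho ->
  [/\ x_regular T U C0 rho b, x_regular T U C0 rho sigma,
      x_regular T U C0 rho (fun t x _ => (f t x)%:M : 'M[R]_1) &
      x_regular T U C0 rho (fun _ x _ => (g x)%:M : 'M[R]_1)] ->
  [/\ u_regular T U C0 rho b, u_regular T U C0 rho sigma,
      u_regular T U C0 rho (fun t x _ => (f t x)%:M : 'M[R]_1) &
      u_regular T U C0 rho (fun _ x _ => (g x)%:M : 'M[R]_1)] ->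
  0 < theta_star ->
  optimal P T W X0 U b sigma f g theta_star u_star ->
  state_process P T W X0 b sigma 0 X0 u_star X_star ->
  somewhere_interior_nonzero P T W X0 U u_star ->
  forall theta, 0 < theta ->
    Phi P T W X0 U b sigma f g u_star X_star theta = 0%E <->
    theta = theta_star.
Proof.
move=> T0 Pcomplete Wbm _ _ Uclosed mcoef wp _ X0cst Ucompact _ coef_C2 C00 rho_mod.
move=> [b_x s_x f_x g_x] [b_u s_u f_u g_u] ths0 [uadm uopt] Xstate u_int theta th0.
have PhiP := Phi_eq0 T0 Pcomplete Wbm X0cst Ucompact mcoef f_u g_u uadm Xstate.
have mins v Y : admissible P T W X0 U 0 v -> state_process P T W X0 b sigma 0 X0 v Y ->
    (cost P T f g 0 theta_star u_star X_star <= cost P T f g 0 theta_star v Y)%E.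
  exact: uopt.
split=> [/(PhiP _ th0) min_theta|->]; last exact/(PhiP _ ths0).
exact: (minimal_theta_unique T0 Pcomplete Wbm X0cst Uclosed mcoef wp Ucompact coef_C2
  C00 rho_mod b_x s_x f_x g_x b_u s_u f_u g_u uadm Xstate u_int).
Qed.
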